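(* Assume that $A$, $F$, $q$, $\phi$ satisfy conditions (a), (b), (c) of the Hypothesis in the context. Let $W_1\in C^0(\Lambda)$ be a viscosity subsolution and $W_2\in C^0(\Lambda)$ a viscosity supersolution of the PHJB equation $$\begin{cases}\partial_tV(\gamma_t)+(A^*\partial_xV(\gamma_t),\gamma_t(t))_H+\mathbf{H}(\gamma_t,\partial_xV(\gamma_t))=0, & t\in[0,T),\ \gamma_t\in\Lambda_t,\\ V(\gamma_T)=\phi(\gamma_T), & \gamma_T\in\Lambda_T.\end{cases}$$ Suppose there exists a constant $K>0$ such that, for all $0\le t\le s\le T$ and all $\gamma_t,\eta_t\in\Lambda_t$, $$|W_1(\gamma_t)|\vee|W_2(\gamma_t)|\le K(1+\|\gamma_t\|_0),$$ $$|W_1(\gamma_{t,s,A})-W_1(\eta_t)|\vee|W_2(\gamma_{t,s,A})-W_2(\eta_t)|\le K(1+\|\gamma_t\|_0+\|\eta_t\|_0)|s-t|+K\|\gamma_t-\eta_t\|_0 .$$ Then $W_1\le W_2$ on $\Lambda$.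
   Context: **Path spaces.** $H$ is a real separable Hilbert space with inner product $(\cdot,\cdot)_H$ and norm $|\cdot|$; $T>0$ is fixed; $A$ generates a $C_0$-semigroup $\{e^{tA}\}_{t\ge0}$ of bounded linear operators on $H$, and $A^*$ is its adjoint. For $t\in[0,T]$, $\hat\Lambda_t=D([0,t];H)$ is the set of càdlàg functions $[0,t]\to H$ and $\Lambda_t=C([0,t];H)$. Put $\hat\Lambda^t=\bigcup_{s\in[t,T]}\hat\Lambda_s$, $\hat\Lambda=\hat\Lambda^0$, $\Lambda^t=\bigcup_{s\in[t,T]}\Lambda_s$, $\Lambda=\Lambda^0$. An element with subscript $t$, such as $\gamma_t$, is a path on $[0,t]$; $\gamma_t(s)$ is its value at $s$. For $x\in H$ and $t\le\bar t\le T$: $\gamma_t^x$ is the path on $[0,t]$ equal to $\gamma_t$ on $[0,t)$ with $\gamma_t^x(t)=\gamma_t(t)+x$; $\gamma_{t,\bar t}$ is the path on $[0,\bar t]$ equal to $\gamma_t$ on $[0,t)$ and to $\gamma_t(t)$ on $[t,\bar t]$; $\gamma_{t,\bar t,A}$ is the path on $[0,\bar t]$ equal to $\gamma_t$ on $[0,t)$ and to $e^{(s-t)A}\gamma_t(t)$ at $s\in[t,\bar t]$. Set $\|\gamma_t\|_0=\sup_{0\le s\le t}|\gamma_t(s)|$ and $d_\infty(\gamma_t,\eta_s)=|t-s|+\|\gamma_{t,T,A}-\eta_{s,T,A}\|_0$. **Derivatives.** For $f$ on paths in $\hat\Lambda$: $\partial_xf(\gamma_t)=B\in H$ if $\lim_{|h|\to0}|f(\gamma_t^h)-f(\gamma_t)-(B,h)_H|/|h|=0$;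 $\partial_tf(\gamma_t)=\lim_{l\downarrow0}\frac1l[f(\gamma_{t,t+l})-f(\gamma_t)]$ for $t<T$. $C^0(\hat\Lambda^t)$, $C^0(\Lambda^t)$ denote functionals continuous under $d_\infty$. $f\in C^1(\hat\Lambda^t)$ if $f\in C^0(\hat\Lambda^t)$ and $\partial_tf,\partial_xf$ exist and are continuous. $f\in C^1(\Lambda^t)$ if $f$ is the restriction to $\Lambda^t$ of some $\hat f\in C^1(\hat\Lambda^t)$; then $\partial_tf,\partial_xf$ on $\Lambda^t$ denote the restrictions of $\partial_t\hat f,\partial_x\hat f$. ''$A^*\partial_xf\in C^0(\Lambda^t)$'' means that $\partial_xf$ takes values in the domain of $A^*$ and $\gamma\mapsto A^*\partial_xf(\gamma)$ is $d_\infty$-continuous on $\Lambda^t$. **Hypothesis.** $(U,d)$ is a metric space; $F:\Lambda\times U\to H$, $q:\Lambda\times U\to\mathbb R$, $\phi:\Lambda_T\to\mathbb R$. (a) $\{e^{tA}\}$ is a $C_0$ contraction semigroup. (b) For every $\gamma_t\in\Lambda$, $F(\gamma_t,\cdot)$ and $q(\gamma_t,\cdot)$ are continuous in $u$. (c) There is $L>0$ such that for all $\gamma_t,\eta_s\in\Lambda$, $\zeta_T,\zeta_T'\in\Lambda_T$, $u\in U$: $|F(\gamma_t,u)|^2\le L^2(1+\|\gamma_t\|_0^2)$, $|F(\gamma_t,u)-F(\eta_s,u)|\le Ld_\infty(\gamma_t,\eta_s)$, $|q(\gamma_t,u)-q(\eta_s,u)|\le Ld_\infty(\gamma_t,\eta_s)$,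 $|q(\gamma_t,u)|\le L(1+\|\gamma_t\|_0)$, $|\phi(\zeta_T)-\phi(\zeta'_T)|\le L\|\zeta_T-\zeta_T'\|_0$, $|\phi(\zeta_T)|\le L(1+\|\zeta_T\|_0)$. **Hamiltonian.** $\mathbf H(\gamma_t,p)=\inf_{u\in U}[(p,F(\gamma_t,u))_H+q(\gamma_t,u)]$, $(\gamma_t,p)\in\Lambda\times H$. **Test functionals.** $S(\gamma_t)=(\|\gamma_t\|_0^2-|\gamma_t(t)|^2)^2/\|\gamma_t\|_0^2$ if $\|\gamma_t\|_0\ne0$ and $S(\gamma_t)=0$ otherwise; $\Upsilon^2(\gamma_t)=S(\gamma_t)+2|\gamma_t(t)|^2$ (the superscript $2$ is an index; $\partial_x\Upsilon^2$ is computed on $\hat\Lambda$ with the same formula). $\Phi=\{\varphi\in C^1(\Lambda): A^*\partial_x\varphi\in C^0(\Lambda)\}$. $\mathcal G_t$ is the set of $g\in C^0(\Lambda^t)$ for which there are $h\in C^1([0,T]\times\mathbb R)$ with $\nabla_xh\ge0$ (derivative in the second variable), $N>0$, $\delta_i>0$, $t_i\le t$, $\gamma^i_{t_i}\in\Lambda_{t_i}$ ($i=0,1,2,\dots$) with $\|\gamma^i_{t_i}\|_0\le N$, $\sum_i\delta_i\le N$, such that for all $\gamma_s\in\Lambda^t$ $$g(\gamma_s)=h(s,\Upsilon^2(\gamma_s))+\sum_{i=0}^\infty\delta_i\big[\Upsilon^2(\gamma_s-\gamma^i_{t_i,s,A})+|s-t_i|^2\big].$$ For such $g$ (with this representation)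 one writes $\partial_tg(\gamma_s):=h_t(s,\Upsilon^2(\gamma_s))+2\sum_i\delta_i(s-t_i)$ and $\partial_xg(\gamma_s):=\nabla_xh(s,\Upsilon^2(\gamma_s))\partial_x\Upsilon^2(\gamma_s)+\sum_i\delta_i\partial_x\Upsilon^2(\gamma_s-\gamma^i_{t_i,s,A})$. **Viscosity solutions.** $w\in C^0(\Lambda)$ is a viscosity subsolution (resp. supersolution) of the PHJB equation if $w(\gamma_T)\le\phi(\gamma_T)$ (resp. $\ge$) for all $\gamma_T\in\Lambda_T$ and, for all $t\in[0,T)$, $\varphi\in\Phi$, $g\in\mathcal G_t$ and $\gamma_t\in\Lambda_t$, whenever $0=(w-\varphi-g)(\gamma_t)=\sup_{\eta_s\in\Lambda^t}(w-\varphi-g)(\eta_s)$ (resp. $0=(w+\varphi+g)(\gamma_t)=\inf_{\eta_s\in\Lambda^t}(w+\varphi+g)(\eta_s)$), one has $$\partial_t\varphi(\gamma_t)+\partial_tg(\gamma_t)+(A^*\partial_x\varphi(\gamma_t),\gamma_t(t))_H+\mathbf H(\gamma_t,\partial_x\varphi(\gamma_t)+\partial_xg(\gamma_t))\ge0$$ (resp. $-\partial_t\varphi(\gamma_t)-\partial_tg(\gamma_t)-(A^*\partial_x\varphi(\gamma_t),\gamma_t(t))_H+\mathbf H(\gamma_t,-\partial_x\varphi(\gamma_t)-\partial_xg(\gamma_t))\le0$). *)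

(* Defs.v *)
From HB Require Import structures.
From mathcomp Require Import all_boot all_order all_algebra.
From mathcomp Require Import all_classical all_reals all_analysis.

Set Implicit Arguments.
Unset Strict Implicit.
Unset Printing Implicit Defensive.

Import Order.TTheory GRing.Theory Num.Theory.
Import numFieldNormedType.Exports.

Local Open Scope classical_set_scope.
Local Open Scope ring_scope.

Section HilbertAndSemigroup.
Context {R : realType} {H : completeNormedModType R}.

(* The positive definite symmetric form [ip] induces the norm of the complete
   normed space [H]. *)
Definition hilbert_product (ip : {dot H for (@idfun R)}) :=
  forall x : H, ip x x = `|x| ^+ 2.

Definition separable := exists2 D : set H, countable D & dense D.

(* Only the values at nonnegative times are meaningful. *)
Definition C0_semigroup (S : R -> {linear H -> H}) :=
  [/\ forall t, 0 <= t -> continuous (S t),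
      forall x, S 0 x = x,
      forall s t x, 0 <= s -> 0 <= t -> S (s + t) x = S s (S t x)
    & forall x, S t x @[t --> 0^'+] --> x].

Definition contraction_semigroup (S : R -> {linear H -> H}) :=
  C0_semigroup S /\ forall t x, 0 <= t -> `|S t x| <= `|x|.

(* An unbounded operator is a pair of a domain [DA] and a function [A], whose
   values outside [DA] are irrelevant. *)
Definition generates (DA : set H) (A : H -> H) (S : R -> {linear H -> H}) :=
  let quot x := fun t : R => t^-1 *: (S t x - x) in
  (forall x, DA x <-> exists y : H, quot x t @[t --> 0^'+] --> y) /\
  (forall x, DA x -> quot x t @[t --> 0^'+] --> A x).

Definition is_adjoint_value (ip : {dot H for (@idfun R)})
    (DA : set H) (A : H -> H) (y z : H) :=
  forall x, DA x -> ip (A x) y = ip x z.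

Definition adjoint_dom (ip : {dot H for (@idfun R)}) (DA : set H) (A : H -> H)
    : set H :=
  [set y | exists z, is_adjoint_value ip DA A y z].

Definition adjoint (ip : {dot H for (@idfun R)}) (DA : set H) (A : H -> H)
    (y : H) : H :=
  xget 0 [set z | is_adjoint_value ip DA A y z].

End HilbertAndSemigroup.

Arguments separable {R} H.

(* A path on [0, t] is stored with its final time t and as a function on the
   whole line, extended by its end values (see [stopped]); with this convention
   equal paths are represented by equal terms of [Hpath]. *)
Record Hpath (R : realType) (H : completeNormedModType R) :=
  Path { ptime : R ; pval :> R -> H }.

Arguments Path {R H}.

Section Paths.
Context {R : realType} {H : completeNormedModType R}.
Implicit Types (g d : Hpath H) (t s r : R).

Definition clamp t r : R := Num.max 0 (Num.min r t).

Definition mkpath t (f : R -> H) : Hpath H := Path t (fun r => f (clamp t r)).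

Definition stopped g := forall r, g r = g (clamp (ptime g) r).

Definition cadlag_path g :=
  [/\ 0 <= ptime g, stopped g,
      forall s, 0 <= s < ptime g -> g r @[r --> s^'+] --> g s
    & forall s, 0 < s <= ptime g -> exists l : H, g r @[r --> s^'-] --> l].

Definition continuous_path g :=
  [/\ 0 <= ptime g, stopped g & {within `[0, ptime g], continuous (pval g)}].

Definition hatLambda_at t : set (Hpath H) :=
  [set g | ptime g = t /\ cadlag_path g].

Definition Lambda_at t : set (Hpath H) :=
  [set g | ptime g = t /\ continuous_path g].

Definition hatLambda_from (T t : R) : set (Hpath H) :=
  \bigcup_(s in `[t, T]) hatLambda_at s.

Definition Lambda_from (T t : R) : set (Hpath H) :=
  \bigcup_(s in `[t, T]) Lambda_at s.

Definition hatLambda (T : R) : set (Hpath H) := hatLambda_from T 0.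

Definition Lambda (T : R) : set (Hpath H) := Lambda_from T 0.

Definition vbump g (x : H) : Hpath H :=
  mkpath (ptime g) (fun r => if r < ptime g then g r else g (ptime g) + x).

Definition freeze g s : Hpath H :=
  mkpath s (fun r => if r < ptime g then g r else g (ptime g)).

Definition flow (S : R -> {linear H -> H}) g s : Hpath H :=
  mkpath s (fun r =>
    if r < ptime g then g r else S (r - ptime g) (g (ptime g))).

(* Meant for paths with the same final time. *)
Definition psub g d : Hpath H := Path (ptime g) (fun r => g r - d r).

Definition norm0 g : R := sup [set `|g r| | r in `[0, ptime g]].

Definition dinf (T : R) (S : R -> {linear H -> H}) g d : R :=
  `|ptime g - ptime d| + norm0 (psub (flow S g T) (flow S d T)).

(* Functionals are total functions on [Hpath H], considered on a set [X]. *)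
Definition C0_on (T : R) (S : R -> {linear H -> H}) (V : normedZmodType R)
    (X : set (Hpath H)) (f : Hpath H -> V) :=
  forall g, X g -> forall e : R, 0 < e -> exists2 r : R, 0 < r &
    forall d, X d -> dinf T S g d < r -> `|f d - f g| < e.

End Paths.

Section Derivatives.
Context {R : realType} {H : completeNormedModType R}.
Variables (ip : {dot H for (@idfun R)}) (T : R) (S : R -> {linear H -> H}).
Implicit Types (g : Hpath H) (f : Hpath H -> R).

Definition is_dx f g (B : H) :=
  (f (vbump g h) - f g - ip B h) / `|h| @[h --> (0 : H)^'] --> (0 : R).

Definition dx f g : H := xget 0 [set B | is_dx f g B].

Definition is_dt f g (a : R) :=
  l^-1 * (f (freeze g (ptime g + l)) - f g) @[l --> 0^'+] --> a.

Definition dt f g : R := xget 0 [set a | is_dt f g a].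

(* The time derivative is only defined, hence only required to exist and to be
   continuous, at paths whose final time is smaller than T. *)
Definition C1_hatLambda_from (t : R) f :=
  let X := hatLambda_from T t in
  let X' := X `&` [set g | ptime g < T] in
  [/\ C0_on T S X f,
      forall g, X' g -> exists a, is_dt f g a,
      forall g, X g -> exists B, is_dx f g B,
      C0_on T S X' (dt f)
    & C0_on T S X (dx f)].

End Derivatives.

Section PHJB.
Context {R : realType} {H : completeNormedModType R}.
Variables (ip : {dot H for (@idfun R)}) (T : R).
Variables (DA : set H) (A : H -> H) (S : R -> {linear H -> H}).

Definition Sfun (g : Hpath H) : R :=
  if norm0 g == 0 then 0
  else (norm0 g ^+ 2 - `|g (ptime g)| ^+ 2) ^+ 2 / norm0 g ^+ 2.

Definition Upsilon2 (g : Hpath H) : R := Sfun g + 2 * `|g (ptime g)| ^+ 2.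

(* An element of Phi is given by its extension [f] to cadlag paths, from which
   its derivatives are computed. *)
Definition Phi (f : Hpath H -> R) :=
  [/\ C1_hatLambda_from ip T S 0 f,
      forall g, Lambda T g -> adjoint_dom ip DA A (dx ip f g)
    & C0_on T S (Lambda T) (fun g => adjoint ip DA A (dx ip f g))].

(* [h] is C^1 on [0, T] x R, with partial derivatives [ht] and [hx]; the time
   derivative is one-sided at 0 and T. *)
Definition C1_strip (h ht hx : R -> R -> R) :=
  [/\ forall t x : R, 0 <= t <= T ->
        (h r x - h t x) / (r - t) @[r --> within `[0, T] t^'] --> ht t x,
      forall t x : R, 0 <= t <= T -> is_derive x (1 : R) (h t) (hx t x),
      {within `[0, T] `*` setT, continuous (fun z : R * R => ht z.1 z.2)}
    & {within `[0, T] `*` setT, continuous (fun z : R * R => hx z.1 z.2)}].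

Record gauge_rep := GaugeRep {
  gh : R -> R -> R ; ght : R -> R -> R ; ghx : R -> R -> R ;
  gdelta : nat -> R ;
  gpath : nat -> Hpath H }.

Implicit Type D : gauge_rep.

Definition gauge_value D (g : Hpath H) : R :=
  gh D (ptime g) (Upsilon2 g) +
  limn (series (fun i =>
    gdelta D i * (Upsilon2 (psub g (flow S (gpath D i) (ptime g)))
                  + `|ptime g - ptime (gpath D i)| ^+ 2))).

Definition gauge_dt D (g : Hpath H) : R :=
  ght D (ptime g) (Upsilon2 g) +
  2 * limn (series (fun i => gdelta D i * (ptime g - ptime (gpath D i)))).

Definition gauge_dx D (g : Hpath H) : H :=
  ghx D (ptime g) (Upsilon2 g) *: dx ip Upsilon2 g +
  limn (series (fun i =>
    gdelta D i *:
      dx ip Upsilon2 (psub g (flow S (gpath D i) (ptime g))) : H)).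

(* [g] belongs to G_t, with the representation [D]. *)
Definition gauge_class (t : R) (g : Hpath H -> R) D :=
  [/\ C0_on T S (Lambda_from T t) g,
      C1_strip (gh D) (ght D) (ghx D),
      forall s x : R, 0 <= s <= T -> 0 <= ghx D s x,
      exists2 N : R, 0 < N &
        (forall i, [/\ 0 < gdelta D i, ptime (gpath D i) <= t,
                       continuous_path (gpath D i) & norm0 (gpath D i) <= N]) /\
        (\sum_(i <oo) (gdelta D i)%:E <= N%:E)%E
    & forall d, Lambda_from T t d -> g d = gauge_value D d].

Variables (U : metricType R) (F : Hpath H -> U -> H) (q : Hpath H -> U -> R).
Variable phi : Hpath H -> R.

Definition Hamiltonian (g : Hpath H) (p : H) : R :=
  inf [set ip p (F g u) + q g u | u in [set: U]].

Definition hypothesis_b :=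
  forall g, Lambda T g -> continuous (F g) /\ continuous (q g).

Definition hypothesis_c :=
  exists2 L : R, 0 < L &
    [/\ forall g u, Lambda T g ->
          `|F g u| ^+ 2 <= L ^+ 2 * (1 + norm0 g ^+ 2),
        forall g d u, Lambda T g -> Lambda T d ->
          `|F g u - F d u| <= L * dinf T S g d /\
          `|q g u - q d u| <= L * dinf T S g d,
        forall g u, Lambda T g -> `|q g u| <= L * (1 + norm0 g),
        forall z z', Lambda_at T z -> Lambda_at T z' ->
          `|phi z - phi z'| <= L * norm0 (psub z z')
      & forall z, Lambda_at T z -> `|phi z| <= L * (1 + norm0 z)].

Definition viscosity_subsolution (w : Hpath H -> R) :=
  [/\ C0_on T S (Lambda T) w,
      forall z, Lambda_at T z -> w z <= phi z
    & forall (t : R) (f g : Hpath H -> R) D (z : Hpath H),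
        0 <= t < T -> Phi f -> gauge_class t g D -> Lambda_at t z ->
        w z - f z - g z = 0 ->
        ereal_sup [set (w d - f d - g d)%:E | d in Lambda_from T t] = 0%E ->
        0 <= dt f z + gauge_dt D z
             + ip (adjoint ip DA A (dx ip f z)) (z t)
             + Hamiltonian z (dx ip f z + gauge_dx D z)].

Definition viscosity_supersolution (w : Hpath H -> R) :=
  [/\ C0_on T S (Lambda T) w,
      forall z, Lambda_at T z -> phi z <= w z
    & forall (t : R) (f g : Hpath H -> R) D (z : Hpath H),
        0 <= t < T -> Phi f -> gauge_class t g D -> Lambda_at t z ->
        w z + f z + g z = 0 ->
        ereal_inf [set (w d + f d + g d)%:E | d in Lambda_from T t] = 0%E ->
        - dt f z - gauge_dt D z
        - ip (adjoint ip DA A (dx ip f z)) (z t)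
        + Hamiltonian z (- dx ip f z - gauge_dx D z) <= 0].

End PHJB.

(* Main.v *)
Require Import Defs.
From mathcomp Require Import all_boot all_order all_algebra.
From mathcomp Require Import all_classical all_reals all_analysis.
From mathcomp Require Import ring lra.

Set Implicit Arguments.
Unset Strict Implicit.
Unset Printing Implicit Defensive.

Import Order.TTheory GRing.Theory Num.Theory.
Import numFieldNormedType.Exports.

Local Open Scope classical_set_scope.
Local Open Scope ring_scope.

(** For a path with maximum norm m and end norm a, Upsilon2 equals
    m^2 + a^4/m^2. This expression increases with m and a, is convex and
    homogeneous of degree two ([ups_add]), and its vertical gradient
    4 (a/m)^2 x at the end value x is Lipschitz in x and m ([upsgrad_dist]).
    Extending a path by a contraction keeps m and shrinks a, so it does not
    increase the gauge ([Upsilon2_flow]). These properties allow a doubling of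
    variables in which the only smooth test functional is 0; its adjoint term
    vanishes because the domain of the generator is dense
    ([domain_orthogonal]).

    Suppose W1 > W2 at some path. With a discounted penalty
    alpha e^(kappa (T - t)) (1 + Upsilon2), which makes suprema finite and whose
    decay in time beats the linear growth of F, consider for pairs with the same
    final time the functional [Psi],
    W1(g) - W2(d) - beta Upsilon2(g - d) - penalty(g) - penalty(d).
    As W1 and W2 are Lipschitz, a near maximizer (g0, d0) has g0 and d0 at
    distance at most (K + 1)/beta. A test functional may only be centred at paths
    that end no later than the path where it is tested, so the term beta Upsilon2(g - d)
    cannot serve as a test in both variables. It is replaced by
    2 beta Upsilon2(g - xi) + 2 beta Upsilon2(d - xi), where xi is the midpoint of
    g0 and d0: by convexity this is larger, and at (g0, d0) it is equal. The
    variables are now separated, the final times can be doubled with a penalty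
    (t - s)^2/theta ([Theta]), and [Theta_le_Psi] bounds the new functional by
    the old one, up to a multiple of |t - s|, by extending the shorter path.

    Since (g0, d0) nearly maximizes the new functional, the Borwein-Preiss
    principle ([borwein_preiss], [doubled_maximum]) provides an exact maximum
    (g1, d1) of a small perturbation of it, at distance at most lam from
    (g0, d0); the perturbing gauges are centred at paths that end no later
    than the maximizers, so they are admissible tests. The final times of g1 and d1 are
    smaller than T, because at time T, where W1 <= W2, the functional Psi is at
    most K^2/(4 beta) ([Psi_terminal]). Subtracting the two viscosity
    inequalities at (g1, d1), the derivatives of the time penalty cancel. The gradients of the
    two gauges centred at xi nearly cancel as well: the end values of g1 and d1
    relative to xi are close to S(t - t0) v and - S(s - t0) v, where v is half
    the difference of the end values of g0 and d0. This vector is fixed before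
    theta, and |t - s| tends to 0 with theta, so the strong continuity of the
    semigroup at v suffices ([gradients_cancel]). What remains is
    2 alpha <= small, a contradiction ([interior_maximum], [comparison]). *)

(** * Inner product and orbits of the semigroup *)

Section HilbertSpace.
Context {R : realType} {H : completeNormedModType R}.
Variable ip : {dot H for (@idfun R)}.
Hypothesis ipH : hilbert_product ip.
Implicit Types x y z : H.

Lemma ip_sym x y : ip x y = ip y x.
Proof. by rewrite hermC expr0 mul1r. Qed.

Lemma ipDl x y z : ip (x + y) z = ip x z + ip y z.
Proof. exact: linearDl. Qed.

Lemma ipDr x y z : ip x (y + z) = ip x y + ip x z.
Proof. exact: linearDr. Qed.

Lemma ipNl x y : ip (- x) y = - ip x y.
Proof. exact: linearNl. Qed.

Lemma ipNr x y : ip x (- y) = - ip x y.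
Proof. exact: linearNr. Qed.

Lemma ipZl (a : R) x y : ip (a *: x) y = a * ip x y.
Proof. by rewrite linearZl_LR. Qed.

Lemma ipZr (a : R) x y : ip x (a *: y) = a * ip x y.
Proof. by rewrite linearZr_LR. Qed.

Lemma ip0r x : ip x 0 = 0.
Proof. exact: linear0r. Qed.

Lemma ip0l x : ip 0 x = 0.
Proof. by rewrite ip_sym ip0r. Qed.

Lemma sqr_normD x y : `|x + y| ^+ 2 = `|x| ^+ 2 + 2 * ip x y + `|y| ^+ 2.
Proof. by rewrite -!ipH ipDl !ipDr (ip_sym y x); ring. Qed.

Lemma cauchy_schwarz x y : ip x y <= `|x| * `|y|.
Proof.
have h1 := sqr_ge0 `|(`|y|) *: x + (- `|x|) *: y|.
have : 0 <= (`|x| * `|y|) * (`|x| * `|y| - ip x y).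
  move: h1; rewrite sqr_normD ipZl ipZr !normrZ normrN !normr_id.
  by nra.
have [-> _|x0] := eqVneq x 0; first by rewrite ip0l normr0 mul0r.
have [-> _|y0] := eqVneq y 0; first by rewrite ip0r normr0 mulr0.
by rewrite pmulr_rge0 ?subr_ge0// mulr_gt0 ?normr_gt0.
Qed.

Lemma norm_ip_le x y : `|ip x y| <= `|x| * `|y|.
Proof.
rewrite ler_norml cauchy_schwarz andbT lerNl -ipNl.
by rewrite (le_trans (cauchy_schwarz _ _))// normrN.
Qed.

Lemma ip_ext x y : (forall z, ip x z = ip y z) -> x = y.
Proof.
move=> h; apply/eqP; rewrite -subr_eq0 -normr_eq0 -sqrf_eq0 -ipH.
by rewrite ipDl ipNl h subrr.
Qed.

End HilbertSpace.

(** Vector identities are checked after pairing with an arbitrary vector, where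
    [ring] applies. *)
Ltac vring ipH := let z := fresh "z" in
  apply: (ip_ext ipH) => z; rewrite ?(ipDl, ipNl, ipZl, ip0l); ring.

Section Orbits.
Context {R : realType} {H : completeNormedModType R}.
Variable S : R -> {linear H -> H}.
Hypothesis hS : contraction_semigroup S.
Implicit Types (a b r t : R) (x y : H).

Lemma semigroup0 x : S 0 x = x.
Proof. by have [[_ -> _ _] _] := hS. Qed.

Lemma semigroupD a b x : 0 <= a -> 0 <= b -> S (a + b) x = S a (S b x).
Proof. by have [[_ _ + _] _] := hS; apply. Qed.

Lemma semigroupB a x y : S a (x - y) = S a x - S a y.
Proof. exact: linearB. Qed.

Lemma semigroupZ a c x : S a (c *: x) = c *: S a x.
Proof. exact: linearZ. Qed.

Lemma semigroup_contr a x : 0 <= a -> `|S a x| <= `|x|.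
Proof. by have [_ +] := hS; apply. Qed.

Lemma semigroup_dist a x y : 0 <= a -> `|S a x - S a y| <= `|x - y|.
Proof. by move=> a0; rewrite -linearB semigroup_contr. Qed.

Lemma semigroup_near0 x (e : R) : 0 < e ->
  exists2 r : R, 0 < r & forall a, 0 <= a <= r -> `|S a x - x| <= e.
Proof.
move=> e0; have [[_ _ _ /(_ x)/cvgrPdist_le/(_ e e0) hn] _] := hS.
case: hn => r /= r0 hr.
exists (r / 2); first by rewrite divr_gt0.
move=> a /andP[a0 ar].
have [->|an0] := eqVneq a 0; first by rewrite semigroup0 subrr normr0 ltW.
rewrite distrC; apply: hr; last by rewrite lt_neqAle eq_sym an0.
rewrite /ball/= sub0r normrN ger0_norm//; lra.
Qed.

(** By the semigroup law, the modulus of continuity of an orbit is the same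
    everywhere as at time 0. *)
Lemma orbit_dist a b x : 0 <= a -> 0 <= b ->
  `|S a x - S b x| <= `|S (`|a - b|) x - x|.
Proof.
wlog ab : a b / a <= b => [hw a0 b0|a0 b0].
  have [ab|/ltW ba] := leP a b; first exact: hw.
  by rewrite distrC (distrC a b); exact: hw.
have -> : `|a - b| = b - a by rewrite ler0_norm ?subr_le0// opprB.
rewrite [in S b x](_ : b = a + (b - a)); last by ring.
rewrite semigroupD ?subr_ge0//.
by rewrite -linearB (le_trans (semigroup_contr _ _))// distrC.
Qed.

End Orbits.

(** * Density of the domain of the generator *)

Section LimitsOfSequences.
Context {R : realType} {V : completeNormedModType R}.
Implicit Type u : nat -> V.

Lemma cauchy_seq_limit u :
  (forall e : R, 0 < e -> exists N : nat, forall n m, (N <= n)%N -> (N <= m)%N ->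
     `|u n - u m| <= e) ->
  exists l : V, forall e : R, 0 < e -> exists N : nat, forall n, (N <= n)%N ->
     `|u n - l| <= e.
Proof.
move=> hu; have cu : cvgn u.
  apply/cauchy_cvgP/cauchy_ballP => e e0 /=.
  have [|N hN] := hu (e / 2); first by rewrite divr_gt0.
  exists (u @` [set n | (N <= n)%N], u @` [set n | (N <= n)%N]).
    by split; exists N => // n /= Nn; exists n.
  move=> [_ _] [/= [n Nn <-] [m Nm <-]]; rewrite -ball_normE /=.
  by apply: le_lt_trans (hN _ _ Nn Nm) _; lra.
exists (limn u) => e e0.
move/cvgrPdist_le : cu => /(_ e e0) [N _ hN].
by exists N => n /hN; rewrite distrC.
Qed.

End LimitsOfSequences.

Section Resolvent.
Context {R : realType} {H : completeNormedModType R}.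
Variable S : R -> {linear H -> H}.
Variable ip : {dot H for (@idfun R)}.
Hypothesis ipH : hilbert_product ip.
Hypothesis hS : contraction_semigroup S.
Implicit Types (a b r t h e w : R) (x y : H).

(** The equation is a fixed point problem for a contraction of ratio e^(-e). *)
Lemma discrete_resolvent e x : 0 < e ->
  exists y, y = expR (- e) *: S e y + (1 - expR (- e)) *: x.
Proof.
move=> e0.
pose f := [fun of totalfun (fun y => expR (- e) *: S e y + (1 - expR (- e)) *: x)].
have [|||y _ hy] := @banach_fixed_point R H setT f; last by exists y.
- have l0 : 0 <= expR (- e) :> R by apply: expR_ge0.
  exists (NngNum l0); split => /=; first by rewrite expR_lt1; lra.
  move=> [y z] _ /=; rewrite opprD addrACA subrr addr0 -scalerBr normrZ.
  by rewrite gtr0_norm ?expR_gt0// ler_wpM2l// (semigroup_dist hS)// ltW.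
- exact: closedT.
- by exists 0.
Qed.

(** The resolvent y at 1 of x is the integral of e^(-s) S(s) x over s >= 0, so
    y - e^(-h) S(h) y is the part of the integral over [0, h]. The defect measures
    what is lost when S(s) x is replaced there by x. *)
Definition resolvent_defect x h y :=
  y - expR (- h) *: S h y - (1 - expR (- h)) *: x.

Lemma resolvent_defectD x a b y : 0 <= a -> 0 <= b ->
  resolvent_defect x (a + b) y =
  resolvent_defect x a y + expR (- a) *: S a (resolvent_defect x b y)
  + (expR (- a) * (1 - expR (- b))) *: (S a x - x).
Proof.
move=> a0 b0; rewrite /resolvent_defect (semigroupD hS)// opprD expRD.
by rewrite !(semigroupB S) !(semigroupZ S); vring ipH.
Qed.

(** Exact solutions at step b have a small defect at all multiples of b at which
    the orbit of x has not moved far: the errors add up like the integral of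
    e^(-s). *)
Lemma resolvent_defectM x b y w r :
  0 < b -> resolvent_defect x b y = 0 ->
  (forall a, 0 <= a <= r -> `|S a x - x| <= w) ->
  forall k : nat, k%:R * b <= r ->
    `|resolvent_defect x (k%:R * b) y| <= (1 - expR (- (k%:R * b))) * w.
Proof.
move=> b0 hb hr; elim=> [|k IH] hk.
  rewrite mul0r /resolvent_defect oppr0 expR0 (semigroup0 hS).
  by rewrite !subrr scale0r subr0 scale1r subrr normr0 mul0r.
have kb0 : 0 <= k%:R * b by rewrite mulr_ge0// ltW.
have kbr : k%:R * b <= r by apply: le_trans hk; rewrite ler_pM2r// ler_nat.
have -> : k.+1%:R * b = k%:R * b + b by rewrite -natr1; ring.
rewrite (resolvent_defectD x y kb0 (ltW b0)) hb linear0 scaler0 addr0.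
rewrite (le_trans (ler_normD _ _))// normrZ ger0_norm; last first.
  by rewrite mulr_ge0 ?expR_ge0// subr_ge0 -expR0 ler_expR; lra.
have e1 := IH kbr.
have e2 : `|S (k%:R * b) x - x| <= w by apply: hr; rewrite kb0.
have e3 : 0 <= expR (- (k%:R * b)) * (1 - expR (- b)).
  by rewrite mulr_ge0 ?expR_ge0// subr_ge0 -expR0 ler_expR; lra.
have := ler_wpM2l e3 e2.
by rewrite opprD expRD; lra.
Qed.

Lemma resolvent_defectB x h y z :
  resolvent_defect x h y - resolvent_defect x h z =
  (y - z) - expR (- h) *: S h (y - z).
Proof. by rewrite /resolvent_defect !(semigroupB S); vring ipH. Qed.

(** The map y - e^(-h) S(h) y expands distances by at least 1 - e^(-h), because S
    is a contraction. *)
Lemma resolvent_stable x h y z w : 0 < h ->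
  resolvent_defect x h z = 0 ->
  `|resolvent_defect x h y| <= (1 - expR (- h)) * w -> `|y - z| <= w.
Proof.
move=> h0 hz hy; have l1 : 0 < 1 - expR (- h) by rewrite subr_gt0 expR_lt1; lra.
rewrite -(ler_pM2l l1); apply: le_trans hy.
have -> : resolvent_defect x h y = (y - z) - expR (- h) *: S h (y - z).
  by rewrite -(resolvent_defectB x) hz subr0.
have := lerB_dist (y - z) (expR (- h) *: S h (y - z)).
apply: le_trans; rewrite mulrBl mul1r lerD2l lerN2 normrZ gtr0_norm ?expR_gt0//.
by rewrite ler_wpM2l ?expR_ge0// (semigroup_contr hS)// ltW.
Qed.

Lemma expRN_dist a b : 0 <= a -> a <= b ->
  0 <= expR (- a) - expR (- b) <= b - a.
Proof.
move=> a0 ab; rewrite subr_ge0 ler_expR lerN2 ab /=.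
have -> : expR (- b) = expR (- a) * expR (- (b - a)).
  by rewrite -expRD; congr expR; ring.
have h1 : 1 + - (b - a) <= expR (- (b - a)) := expR_ge1Dx _.
have h2 : expR (- a) <= 1 by rewrite -expR0 ler_expR; lra.
have h3 : 0 < expR (- a) := expR_gt0 _.
have h4 : expR (- (b - a)) <= 1 by rewrite -expR0 ler_expR; lra.
by nra.
Qed.

(** The vector is the limit of the discrete resolvents at dyadic steps. They form
    a Cauchy sequence by stability, since each of them almost solves the coarser
    equations; the estimate passes from dyadic to real h by continuity of the
    orbit. *)
Lemma resolvent_exists x : exists y, forall w, 0 < w -> exists2 r, 0 < r &
  forall h, 0 <= h <= r ->
    `|resolvent_defect x h y| <= (1 - expR (- h)) * w.
Proof.
pose ep (n : nat) : R := (2 ^+ n)^-1.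
have ep0 n : 0 < ep n by rewrite invr_gt0 exprn_gt0.
have epM n k : ep n = (2 ^ k)%:R * ep (n + k)%N.
  by rewrite /ep exprD invfM natrX mulrCA divff ?mulr1// expf_neq0.
have ep_small e : 0 < e -> exists N, forall n, (N <= n)%N -> ep n <= e.
  move=> e0; exists (Num.truncn e^-1).+1 => n Nn.
  rewrite /ep -[leRHS]invrK lef_pV2 ?posrE ?exprn_gt0 ?invr_gt0//.
  have h := truncnS_gt e^-1; apply: le_trans (ltW h) _.
  by rewrite -natrX ler_nat (leq_trans Nn)// ltnW// ltn_expl.
have /choice[u hu] (n : nat) : exists y, resolvent_defect x (ep n) y = 0.
  have [y hy] := discrete_resolvent x (ep0 n).
  exists y; rewrite /resolvent_defect {1}hy; vring ipH.
have hmul w r : (forall a, 0 <= a <= r -> `|S a x - x| <= w) ->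
    forall n m k, (n <= m)%N -> k%:R * ep n <= r ->
    `|resolvent_defect x (k%:R * ep n) (u m)|
      <= (1 - expR (- (k%:R * ep n))) * w.
  move=> hr n m k nm; rewrite (epM n (m - n)%N) subnKC// mulrA -natrM => hk.
  exact: (resolvent_defectM (ep0 m) (hu m) hr).
have hcau w : 0 < w -> exists N, forall n m, (N <= n)%N -> (n <= m)%N ->
    `|u m - u n| <= w.
  move=> w0; have [r r0 hr] := semigroup_near0 hS x w0.
  have [N hN] := ep_small r r0.
  exists N => n m Nn nm; apply: (resolvent_stable (ep0 n) (hu n)).
  by have := hmul w r hr n m 1%N nm; rewrite mul1r; apply; apply: hN.
have [|y hy] := @cauchy_seq_limit _ _ u.
  move=> e e0; have [N hN] := hcau e e0; exists N => n m Nn Nm.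
  have [nm|/ltnW mn] := leqP n m; last exact: hN.
  by rewrite distrC; exact: hN.
exists y => w w0; have [r r0 hr] := semigroup_near0 hS x w0.
exists r => // h /andP[h0 hhr].
apply/ler_addgt0Pr => e e0.
have [s s0 hs] := semigroup_near0 hS y (divr_gt0 e0 (ltr0n R 4)).
pose c := 2 * (1 + `|y| + `|x|).
have c0 : 0 < c by rewrite /c; have := normr_ge0 x; have := normr_ge0 y; lra.
have [N1 hN1] := ep_small s s0.
have [N2 hN2] := hy (e / 8) (divr_gt0 e0 (ltr0n R 8)).
have [N3 hN3] := ep_small (e / (2 * c)) (divr_gt0 e0 (mulr_gt0 (ltr0n R 2) c0)).
pose n := maxn N1 (maxn N2 N3).
have n1 : (N1 <= n)%N by rewrite leq_maxl.
have n2 : (N2 <= n)%N by rewrite /n leq_max leq_maxl orbT.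
have n3 : (N3 <= n)%N by rewrite /n !leq_max leqnn !orbT.
pose k := Num.truncn (h / ep n).
pose a := k%:R * ep n.
have hep : 0 <= h / ep n by rewrite divr_ge0// ltW.
have ah : a <= h.
  by rewrite /a -ler_pdivlMr//; have /andP[] := truncn_itv hep.
have ha : h - a <= ep n.
  have : h / ep n < k.+1%:R by have /andP[] := truncn_itv hep.
  by rewrite ltr_pdivrMr// -natr1 mulrDl mul1r -/a; lra.
have a0 : 0 <= a by rewrite /a mulr_ge0// ltW.
have ha0 : 0 <= h - a by rewrite subr_ge0.
have /andP[d0 d1] := expRN_dist a0 ah.
have b1 : `|resolvent_defect x a (u n)| <= (1 - expR (- a)) * w.
  by apply: (hmul w r) => //; rewrite -/a (le_trans ah).
have b2 : (1 - expR (- a)) * w <= (1 - expR (- h)) * w by rewrite ler_pM2r//; lra.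
have b3 : `|u n - y| <= e / 8 by apply: hN2.
have b4 : `|S h y - S a y| <= e / 4.
  apply: le_trans (orbit_dist hS _ h0 a0) _; apply: hs.
  rewrite normr_ge0 /= ger0_norm//; apply: le_trans ha _; exact: hN1.
have b5 : (h - a) * c <= e / 2.
  rewrite -ler_pdivlMr//; apply: le_trans ha _.
  rewrite -mulrA -invfM; exact: hN3.
have -> : resolvent_defect x h y = resolvent_defect x a (u n)
    + ((y - u n) - expR (- a) *: S a (y - u n))
    + ((expR (- a) - expR (- h)) *: S h y
    + (expR (- a) *: (S a y - S h y))
    + (expR (- h) - expR (- a)) *: x).
  by rewrite /resolvent_defect !(semigroupB S); vring ipH.
have c1 : `|(y - u n) - expR (- a) *: S a (y - u n)| <= e / 4.
  apply: le_trans (ler_normB _ _) _; rewrite normrZ gtr0_norm ?expR_gt0//.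
  have h1 : expR (- a) <= 1 by rewrite -expR0 ler_expR; lra.
  have h2 := semigroup_contr hS (y - u n) a0.
  have h3 : expR (- a) * `|S a (y - u n)| <= 1 * `|S a (y - u n)|.
    by rewrite ler_wpM2r.
  by move: b3; rewrite distrC; lra.
have c2 : `|(expR (- a) - expR (- h)) *: S h y
    + (expR (- a) *: (S a y - S h y))
    + (expR (- h) - expR (- a)) *: x| <= e / 4 + (h - a) * c / 2.
  apply: le_trans (ler_normD _ _) _.
  apply: le_trans (lerD (ler_normD _ _) (lexx _)) _.
  rewrite !normrZ (distrC (expR (- h))) !ger0_norm ?expR_ge0//.
  have h1 : expR (- a) <= 1 by rewrite -expR0 ler_expR; lra.
  have h2 := semigroup_contr hS y h0.
  have h3 : expR (- a) * `|S a y - S h y| <= 1 * `|S a y - S h y|.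
    by rewrite ler_wpM2r.
  have h4 : (expR (- a) - expR (- h)) * `|S h y| <= (h - a) * `|y|.
    by apply: ler_pM.
  have h5 : (expR (- a) - expR (- h)) * `|x| <= (h - a) * `|x|.
    by apply: ler_wpM2r.
  move: b4; rewrite (distrC (S h y)) /c => b4; lra.
apply: le_trans (ler_normD _ _) _.
apply: le_trans (lerD (ler_normD _ _) (lexx _)) _.
by lra.
Qed.

End Resolvent.

Section AdjointAtZero.
Context {R : realType} {H : completeNormedModType R}.
Variable S : R -> {linear H -> H}.
Variable ip : {dot H for (@idfun R)}.
Hypothesis ipH : hilbert_product ip.
Hypothesis hS : contraction_semigroup S.
Implicit Types (a b r t h e w : R) (x y : H).

(** Dividing the defect by h shows that y lies in the domain of the generator,
    which maps it to y - x. *)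
Lemma resolvent_dom x y :
  (forall w, 0 < w -> exists2 r, 0 < r & forall h, 0 <= h <= r ->
    `|resolvent_defect S x h y| <= (1 - expR (- h)) * w) ->
  t^-1 *: (S t y - y) @[t --> 0^'+] --> y - x.
Proof.
move=> hy; apply/cvgrPdist_le => e e0.
have [r r0 hr] := hy (e / 4) (divr_gt0 e0 (ltr0n R 4)).
pose c := 1 + `|y - x|.
have c1 : 1 <= c by rewrite /c lerDl.
pose d := Num.min r (Num.min (1/2) (e / (4 * c))).
have d0 : 0 < d.
  by rewrite !lt_min r0 !divr_gt0//; lra.
near=> h.
have h0 : 0 < h by near: h; exact: nbhs_right_gt.
have hd : h <= d by near: h; exact: nbhs_right_le.
have /and3P[h1 h2 h3] : [&& h <= r, h <= 1/2 & h <= e / (4 * c)].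
  by move: hd; rewrite !le_min.
have hD : `|resolvent_defect S x h y| <= (1 - expR (- h)) * (e / 4).
  by apply: hr; rewrite ltW.
set E := expR h; have E0 : 0 < E := expR_gt0 _.
have EN : expR (- h) = E^-1 by rewrite expRN.
have E1 : 1 + h <= E := expR_ge1Dx _.
have E3 : E <= 1 + h * E.
  have : 1 + - h <= E^-1 by rewrite -EN; exact: expR_ge1Dx.
  rewrite -(ler_pM2l E0) divff ?gt_eqF//; lra.
have E2 : E <= 1 + 2 * h by nra.
have -> : y - x - h^-1 *: (S h y - y) =
   (1 - h^-1 * (E - 1)) *: (y - x) + (h^-1 * E) *: resolvent_defect S x h y.
  rewrite /resolvent_defect EN; apply: (ip_ext ipH) => z.
  rewrite !(ipDl, ipNl, ipZl); field.
  by rewrite !gt_eqF.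
apply: le_trans (ler_normD _ _) _; rewrite !normrZ.
have k1 : `|1 - h^-1 * (E - 1)| <= 2 * h.
  set Q := h^-1 * (E - 1).
  have QE : Q * h = E - 1 by rewrite /Q mulrC mulrA divff ?mul1r// gt_eqF.
  have Q1 : 1 <= Q by rewrite -(ler_pM2r h0) mul1r QE; lra.
  have Q2 : Q <= 1 + 2 * h by rewrite -(ler_pM2r h0) QE; nra.
  by rewrite ler_norml; lra.
have k2 : `|h^-1| * `|E| * `|resolvent_defect S x h y| <= 2 * (e / 4).
  rewrite -normrM ger0_norm; last by rewrite mulr_ge0// ?invr_ge0 ltW.
  apply: le_trans (ler_wpM2l _ hD) _; first by rewrite mulr_ge0// ?invr_ge0 ltW.
  rewrite EN.
  have -> : h^-1 * E * ((1 - E^-1) * (e / 4)) = h^-1 * (E - 1) * (e / 4).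
    by field; rewrite !gt_eqF.
  rewrite ler_pM2r; last by lra.
  by rewrite mulrC ler_pdivrMr//; lra.
have k3 : `|1 - h^-1 * (E - 1)| * `|y - x| <= 2 * h * c.
  by apply: ler_pM => //; rewrite /c lerDr.
have k4 : h * (4 * c) <= e by rewrite -ler_pdivlMr//; lra.
lra.
Unshelve. all: by end_near. Qed.

(** If x is orthogonal to the domain, pairing the resolvent equation of y with y
    gives |y|^2 <= 0; and x = 0 follows from y = 0. *)
Lemma domain_orthogonal DA (A : H -> H) x :
  generates DA A S -> (forall y, DA y -> ip y x = 0) -> x = 0.
Proof.
move=> [hDA _] hx; have [y hy] := resolvent_exists ipH hS x.
have yx : ip y x = 0 by apply: hx; apply/hDA; exists (y - x); exact: resolvent_dom.
have small w : 0 < w -> `|y| <= w.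
  move=> w0; have [r r0 hr] := hy w w0.
  have := hr r; rewrite lexx ltW// => /(_ isT) hd.
  have l0 : 0 < 1 - expR (- r) by rewrite subr_gt0 expR_lt1; lra.
  have h1 := cauchy_schwarz ipH (resolvent_defect S x r y) y.
  have h2 := cauchy_schwarz ipH (S r y) y.
  have h3 : ip (resolvent_defect S x r y) y = `|y| ^+ 2 - expR (- r) * ip (S r y) y.
    by rewrite /resolvent_defect !(ipDl, ipNl, ipZl) (ip_sym ip x) yx ipH; ring.
  have h4 := semigroup_contr hS y (ltW r0).
  have h5 : ip (S r y) y <= `|y| ^+ 2 by apply: le_trans h2 _; rewrite expr2 ler_wpM2r.
  have h6 : expR (- r) * ip (S r y) y <= expR (- r) * `|y| ^+ 2.
    by rewrite ler_wpM2l ?expR_ge0.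
  have h7 : `|resolvent_defect S x r y| * `|y| <= (1 - expR (- r)) * w * `|y|.
    by rewrite ler_wpM2r.
  have [y0|yn0] := eqVneq `|y| 0; first by rewrite y0 ltW.
  have y0 : 0 < `|y| by rewrite lt_neqAle eq_sym yn0 normr_ge0.
  have : (1 - expR (- r)) * `|y| * (`|y| - w) <= 0 by nra.
  by rewrite pmulr_rle0 ?mulr_gt0// subr_le0.
have y0 : y = 0.
  apply/eqP; rewrite -normr_le0; apply/ler_addgt0Pl => w w0; rewrite addr0.
  exact: small.
apply/eqP; rewrite -normr_le0; apply/ler_addgt0Pl => w w0; rewrite addr0.
have [r r0 hr] := hy w w0.
have := hr r; rewrite lexx ltW// => /(_ isT).
have l0 : 0 < 1 - expR (- r) by rewrite subr_gt0 expR_lt1; lra.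
rewrite /resolvent_defect y0 linear0 scaler0 subr0 sub0r normrN normrZ.
by rewrite gtr0_norm// ler_pM2l.
Qed.

(** The values of the adjoint are determined only up to vectors orthogonal to the
    domain. *)
Lemma adjoint0 DA (A : H -> H) : generates DA A S -> adjoint ip DA A 0 = 0.
Proof.
move=> hA; rewrite /adjoint; apply: xget_unique.
  by move=> x _; rewrite !ip0r.
move=> z hz; apply: (domain_orthogonal hA) => y yD.
by rewrite -(hz y yD) ip0r.
Qed.

Lemma adjoint_dom0 DA (A : H -> H) : adjoint_dom ip DA A 0.
Proof. by exists 0 => x _; rewrite !ip0r. Qed.

End AdjointAtZero.

(** * Paths and their extension by the semigroup *)

Section PathCalculus.
Context {R : realType} {H : completeNormedModType R}.
Implicit Types (g d k : Hpath H) (r s t e : R).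

Lemma clamp_itv t r : 0 <= t -> 0 <= clamp t r <= t.
Proof. by move=> t0; rewrite /clamp le_max lexx /= ge_max t0 /= ge_min lexx orbT. Qed.

Lemma clamp_id t r : 0 <= r <= t -> clamp t r = r.
Proof. by move=> /andP[r0 rt]; rewrite /clamp min_l// max_r. Qed.

Lemma clampK t r : 0 <= t -> clamp t (clamp t r) = clamp t r.
Proof. by move=> t0; rewrite clamp_id// clamp_itv. Qed.

Lemma clamp_end t : 0 <= t -> clamp t t = t.
Proof. by move=> t0; rewrite clamp_id// t0 lexx. Qed.

Lemma clamp_dist t r s : `|clamp t r - clamp t s| <= `|r - s|.
Proof.
wlog rs : r s / r <= s => [hw|].
  have [|/ltW] := leP r s; first exact: hw.
  by move=> /hw; rewrite distrC (distrC s).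
have -> : `|r - s| = s - r by rewrite ler0_norm ?subr_le0// opprB.
rewrite /clamp !maxElt !minElt ler_norml.
case: (ltP r t) => ?; case: (ltP s t) => ?; repeat (case: ltP => ?); lra.
Qed.

Lemma max0_dist r s : `|Num.max r 0 - Num.max s 0| <= `|r - s|.
Proof.
have h1 := ler_norm (r - s); have h2 := ler_norm (- (r - s)).
rewrite normrN in h2; rewrite !maxElt ler_norml.
by case: (ltP r 0) => ?; case: (ltP s 0) => ?; lra.
Qed.

Definition curve_eps (c : R -> H) := forall r e, 0 < e ->
  exists2 d, 0 < d & forall s, `|s - r| < d -> `|c s - c r| < e.

Lemma curve_eps_continuous (c : R -> H) : curve_eps c -> continuous c.
Proof.
move=> hc r; apply/cvgrPdist_lt => e e0; have [d d0 hd] := hc r e e0.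
by exists d => // s; rewrite /ball/= distrC => /hd; rewrite distrC.
Qed.

Lemma cpath_eps g : continuous_path g -> curve_eps g.
Proof.
move=> [t0 st] /subspace_continuousP hc r e e0.
have rt : `[0, ptime g]%classic (clamp (ptime g) r).
  by rewrite /= in_itv /= clamp_itv.
have /cvgrPdist_lt/(_ e e0) := hc _ rt.
move=> [d /= d0 hd]; exists d => // s sr.
rewrite st [in X in _ - X]st distrC; apply: hd => /=.
  by rewrite distrC (le_lt_trans (clamp_dist _ _ _)).
by rewrite in_itv /= clamp_itv.
Qed.

Lemma cpathI g : 0 <= ptime g -> stopped g -> curve_eps g -> continuous_path g.
Proof.
move=> t0 st /curve_eps_continuous hc; split => //.
exact: continuous_subspaceT.
Qed.

Lemma cpath_bound g : continuous_path g -> exists M, forall r, `|g r| <= M.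
Proof.
move=> hg; have [t0 st _] := hg.
have hc : {within `[0, ptime g], continuous (fun r => `|g r|)}.
  apply: continuous_subspaceT => r; apply: continuous_comp; last exact: norm_continuous.
  by apply: curve_eps_continuous; exact: cpath_eps.
have [c _ h] := EVT_max t0 hc.
by exists `|g c| => r; rewrite st; apply: h; rewrite in_itv/= clamp_itv.
Qed.

Lemma norm0_le g M : 0 <= ptime g -> (forall r, 0 <= r <= ptime g -> `|g r| <= M) ->
  norm0 g <= M.
Proof.
move=> t0 h; apply: ge_sup.
  by exists `|g 0|, 0 => //=; rewrite in_itv/= lexx t0.
by move=> _ [r /= + <-]; rewrite in_itv/= => /h.
Qed.

Lemma le_norm0_bounded g M r : (forall r, `|g r| <= M) -> 0 <= r <= ptime g ->
  `|g r| <= norm0 g.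
Proof.
move=> hM hr; apply: ub_le_sup; last by exists r.
by exists M => _ [s _ <-].
Qed.

Lemma le_norm0 g r : continuous_path g -> `|g r| <= norm0 g.
Proof.
move=> hg; have [M hM] := cpath_bound hg; have [t0 st _] := hg.
by rewrite st; apply: (le_norm0_bounded hM); rewrite clamp_itv.
Qed.

Lemma norm0_ge0 g : continuous_path g -> 0 <= norm0 g.
Proof. by move=> hg; apply: le_trans (le_norm0 0 hg). Qed.

Lemma path_eq g d : ptime g = ptime d -> (forall r, g r = d r) -> g = d.
Proof.
by case: g d => [t f] [s h] /= -> fh; congr Path; apply/funext.
Qed.

Lemma cpath_psub g d : continuous_path g -> continuous_path d ->
  ptime d = ptime g -> continuous_path (psub g d).
Proof.
move=> hg hd dg; have [t0 sg _] := hg; have [_ sd _] := hd.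
apply: cpathI => //= [r|r e e0] /=; first by rewrite -sg sd dg.
have [a a0 ha] := cpath_eps hg r (divr_gt0 e0 (ltr0n R 2)).
have [b b0 hb] := cpath_eps hd r (divr_gt0 e0 (ltr0n R 2)).
exists (Num.min a b) => [|s]; rewrite lt_min ?a0// => /andP[sa sb].
have -> : g s - d s - (g r - d r) = (g s - g r) - (d s - d r).
  by rewrite !opprD addrACA.
have := ha s sa; have := hb s sb; have := ler_normB (g s - g r) (d s - d r).
lra.
Qed.

Section Flow.
Variable S : R -> {linear H -> H}.
Hypothesis hS : contraction_semigroup S.

Lemma ptime_flow g s : ptime (flow S g s) = s.
Proof. by []. Qed.

(** As a path is constant after its final time, its extension by the semigroup
    has a formula without case distinction. *)
Lemma flowE g s r : continuous_path g ->
  flow S g s r = S (Num.max (clamp s r - ptime g) 0) (g (clamp s r)).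
Proof.
move=> [t0 st _] /=; set c := clamp s r; case: ltP => hc.
  by rewrite max_r ?semigroup0//; lra.
rewrite max_l ?subr_ge0//; congr (S _ _).
by rewrite (st c); congr (g _); rewrite /clamp min_r// max_r.
Qed.

Lemma flow_before g s r : continuous_path g -> ptime g <= s ->
  r <= ptime g -> flow S g s r = g r.
Proof.
move=> hg ts rt; have [t0 st _] := hg; rewrite flowE//.
have h0 : clamp s r <= ptime g.
  by rewrite /clamp ge_max t0 ge_min rt.
rewrite max_r ?semigroup0// ?subr_le0// st [RHS]st; congr (g _).
have -> : clamp s r = clamp (ptime g) r.
  by rewrite /clamp !min_l// (le_trans rt).
exact: clampK.
Qed.

Lemma flow_after g s r : continuous_path g -> ptime g <= r -> r <= s ->
  flow S g s r = S (r - ptime g) (g (ptime g)).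
Proof.
move=> hg tr rs; have [t0 st _] := hg.
by rewrite /= clamp_id ?rs ?andbT ?(le_trans t0)// ltNge tr.
Qed.

Lemma cpath_flow g s : continuous_path g -> 0 <= s -> continuous_path (flow S g s).
Proof.
move=> hg s0; have [t0 st _] := hg; apply: cpathI => //.
  by move=> r /=; rewrite clampK.
move=> r e e0; rewrite /= -!/(flow S g s _).
have [a a0 ha] := cpath_eps hg (clamp s r) (divr_gt0 e0 (ltr0n R 2)).
have [b b0 hb] := semigroup_near0 hS (g (clamp s r)) (divr_gt0 e0 (ltr0n R 3)).
exists (Num.min a b) => [|q]; rewrite lt_min ?a0// => /andP[qa qb].
have hqr := clamp_dist s q r.
change (`|flow S g s q - flow S g s r| < e); rewrite !flowE//.
set x := g (clamp s r); set u := Num.max _ 0; set v := Num.max (clamp s r - _) 0.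
have u0 : 0 <= u by rewrite le_max lexx orbT.
have v0 : 0 <= v by rewrite le_max lexx orbT.
have uv : `|u - v| <= `|clamp s q - clamp s r|.
  apply: le_trans (max0_dist _ _) _.
  by have -> : clamp s q - ptime g - (clamp s r - ptime g) = clamp s q - clamp s r
    by ring.
have h1 : `|S u (g (clamp s q)) - S u x| < e / 2.
  by apply: le_lt_trans (semigroup_dist hS _ _ u0) _; apply: ha; lra.
have h2 : `|S u x - S v x| <= e / 3.
  apply: le_trans (orbit_dist hS x u0 v0) _; apply: hb.
  by rewrite normr_ge0 /=; lra.
have -> : S u (g (clamp s q)) - S v x
  = (S u (g (clamp s q)) - S u x) + (S u x - S v x) by rewrite addrA subrK.
by apply: le_lt_trans (ler_normD _ _) _; lra.
Qed.

Lemma flow_id g : continuous_path g -> flow S g (ptime g) = g.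
Proof.
move=> hg; have [t0 st _] := hg; apply: path_eq => // r.
rewrite flowE// max_r ?semigroup0// -?st// subr_le0.
by have /andP[] := clamp_itv r t0.
Qed.

Lemma flow_flow g s t : continuous_path g -> ptime g <= s -> s <= t ->
  flow S (flow S g s) t = flow S g t.
Proof.
move=> hg gs st; have [t0 _ _] := hg.
have s0 : 0 <= s := le_trans t0 gs.
apply: path_eq => // r; rewrite [LHS]/= -/(flow S g s _) [RHS]/=.
have /andP[c0 ct] := clamp_itv r (le_trans s0 st); set c := clamp t r in c0 ct *.
change ((if c < s then flow S g s c else S (c - s) (flow S g s s)) =
  if c < ptime g then g c else S (c - ptime g) (g (ptime g))).
case: (ltP c (ptime g)) => h1; first by rewrite (lt_le_trans h1)// flow_before// ltW.
case: ltP => h2; first by rewrite flow_after// ltW.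
rewrite flow_after// -semigroupD ?subr_ge0//; congr (S _ _); ring.
Qed.

Lemma flow_psub g d s : continuous_path g -> continuous_path d ->
  ptime d = ptime g ->
  psub (flow S g s) (flow S d s) = flow S (psub g d) s.
Proof.
move=> hg hd dg; apply: path_eq => // r.
rewrite [RHS](flowE); last exact: cpath_psub.
change (flow S g s r - flow S d s r = S (Num.max (clamp s r - ptime g) 0)
   (g (clamp s r) - d (clamp s r))).
by rewrite !flowE// dg semigroupB.
Qed.

Lemma norm0_flow g s : continuous_path g -> ptime g <= s ->
  norm0 (flow S g s) = norm0 g.
Proof.
move=> hg gs; have [t0 _ _] := hg.
have s0 : 0 <= s := le_trans t0 gs.
apply/le_anti/andP; split; apply: norm0_le => // r /andP[r0 rs].
  rewrite flowE//; apply: le_trans (semigroup_contr hS _ _) (le_norm0 _ hg).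
  by rewrite le_max lexx orbT.
by rewrite -(flow_before hg gs rs); apply: le_norm0; exact: cpath_flow.
Qed.

End Flow.

End PathCalculus.

(** * The gauge function and its vertical gradient *)

Section GaugeFunction.
Context {R : realType}.
Implicit Types (m n a b : R).

(** The value of Upsilon2 in terms of the maximum norm m and the end norm a:
    (m^2 - a^2)^2/m^2 + 2 a^2 = m^2 + a^4/m^2. *)
Definition ups m a := m ^+ 2 + (a ^+ 2 / m) ^+ 2.

(** With division by 0 equal to 0, the case m = 0 needs no separate treatment,
    because it forces a = 0. *)
Lemma ratio_mul m a : 0 <= a <= m -> a / m * m = a.
Proof.
move=> /andP[a0 am]; have [m0|m0] := eqVneq m 0; last by rewrite divfK.
by rewrite m0 mulr0; apply/le_anti; rewrite a0 -m0 am.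
Qed.

Lemma ratio_itv m a : 0 <= a <= m -> 0 <= a / m <= 1.
Proof.
move=> /andP[a0 am]; rewrite divr_ge0 ?(le_trans a0)//=.
have [->|m0] := eqVneq m 0; first by rewrite invr0 mulr0 ler01.
by rewrite ler_pdivrMr ?mul1r// lt_neqAle eq_sym m0 (le_trans a0).
Qed.

Lemma upsE m a : ups m a = m ^+ 2 + (a / m * a) ^+ 2.
Proof. by rewrite /ups; congr (_ + _ ^+ 2); rewrite expr2 mulrAC. Qed.

Lemma ups_ge m a : m ^+ 2 <= ups m a.
Proof. by rewrite lerDl sqr_ge0. Qed.

Lemma ups_ge0 m a : 0 <= ups m a.
Proof. by rewrite (le_trans (sqr_ge0 m) (ups_ge _ _)). Qed.

Lemma ups_le m a : 0 <= a <= m -> ups m a <= 2 * m ^+ 2.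
Proof.
move=> h; have /andP[r0 r1] := ratio_itv h; rewrite upsE.
have /andP[a0 am] := h.
have h1 : a / m * a <= m by nra.
have h2 : 0 <= a / m * a by exact: mulr_ge0.
nra.
Qed.

Lemma ups_diag m : ups m m = 2 * m ^+ 2.
Proof.
rewrite /ups; have [->|m0] := eqVneq m 0; last by field.
by rewrite invr0 mulr0 !expr0n /= mulr0 addr0.
Qed.

(** The term a^4/m^2 decreases with m, but more slowly than m^2 increases as long
    as a <= m. *)
Lemma ups_mono_size m n a : 0 <= a <= m -> m <= n -> ups m a <= ups n a.
Proof.
move=> h mn; have /andP[a0 am] := h.
have h' : 0 <= a <= n by rewrite a0 (le_trans am).
rewrite !upsE; have := ratio_mul h; have := ratio_mul h'.
have /andP[] := ratio_itv h; have /andP[] := ratio_itv h'.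
set x := a / m; set y := a / n => y0 y1 x0 x1 yn xm.
have e1 : (x * a) ^+ 2 - (y * a) ^+ 2 = (x - y) * a * ((x + y) * a) by ring.
have e2 : (x - y) * a = y * x * (n - m).
  have : x * (y * n) = y * (x * m) + x * y * (n - m) by ring.
  by rewrite yn xm => e; rewrite mulrBl e; ring.
have e3 : (x + y) * a <= n + m by nra.
have e4 : 0 <= (x + y) * a by rewrite mulr_ge0// addr_ge0.
have e5 : 0 <= y * x by exact: mulr_ge0.
have e5' : y * x <= 1 by nra.
have e6 : y * x * (n - m) * ((x + y) * a) <= (n - m) * (n + m).
  by apply: ler_pM => //; nra.
by move: e6; rewrite -e2 -e1; lra.
Qed.

Lemma ups_mono_end m a b : 0 <= a -> a <= b -> 0 <= m -> ups m a <= ups m b.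
Proof.
move=> a0 ab m0; rewrite /ups lerD2l lerXn2r ?nnegrE ?divr_ge0 ?sqr_ge0//.
  by rewrite ler_wpM2r ?invr_ge0// lerXn2r ?nnegrE// (le_trans a0).
Qed.

(** If b exceeds m, the pairs (m, m), (b, m) and (b, b) are intermediate steps. *)
Lemma ups_mono m n a b : 0 <= a <= m -> a <= b -> b <= n -> m <= n ->
  ups m a <= ups n b.
Proof.
move=> /andP[a0 am] ab bn mn; have m0 : 0 <= m := le_trans a0 am.
have b0 : 0 <= b := le_trans a0 ab.
have [bm|/ltW mb] := leP b m.
  apply: le_trans (ups_mono_end a0 ab m0) _.
  by apply: ups_mono_size => //; rewrite b0.
apply: le_trans (ups_mono_end a0 am m0) _.
apply: le_trans (_ : ups b m <= _); last first.
  apply: le_trans (ups_mono_end m0 mb b0) _.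
  by apply: ups_mono_size => //; rewrite b0 lexx.
by apply: ups_mono_size => //; rewrite m0 lexx.
Qed.

(** The function is the sum of two squares of nonnegative convex functions that
    are homogeneous of degree one, here m and a^2/m. *)
Lemma ups_add m n a b : 0 <= a <= m -> 0 <= b <= n ->
  ups (m + n) (a + b) <= 2 * ups m a + 2 * ups n b.
Proof.
move=> h k; have /andP[a0 am] := h; have /andP[b0 bn] := k.
have hk : 0 <= a + b <= m + n by rewrite addr_ge0//= lerD.
rewrite !upsE.
have := ratio_mul h; have := ratio_mul k; have := ratio_mul hk.
have /andP[] := ratio_itv h; have /andP[] := ratio_itv k.
have /andP[] := ratio_itv hk.
set x := a / m; set y := b / n; set z := (a + b) / (m + n).
move=> z0 z1 y0 y1 x0 x1 hz hy hx.
have e1 : z * (a + b) <= x * a + y * b.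
  have : 0 <= m * (x - z) ^+ 2 + n * (y - z) ^+ 2.
    by rewrite addr_ge0// mulr_ge0 ?sqr_ge0//; lra.
  have -> : m * (x - z) ^+ 2 + n * (y - z) ^+ 2 =
    x * (x * m) - 2 * z * (x * m) + y * (y * n) - 2 * z * (y * n)
     + z * (z * (m + n)) by ring.
  by rewrite hx hy hz; lra.
have e2 : 0 <= z * (a + b) by rewrite mulr_ge0// addr_ge0.
have e3 : (z * (a + b)) ^+ 2 <= (x * a + y * b) ^+ 2.
  by rewrite lerXn2r ?nnegrE ?(le_trans e2).
have e4 := sqr_ge0 (x * a - y * b).
have e5 := sqr_ge0 (m - n).
nra.
Qed.

Lemma ratio_dist m n a b : 0 <= a <= m -> 0 <= b <= n ->
  `|a / m - b / n| * b <= `|m - n| + `|a - b|.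
Proof.
move=> h k; have /andP[a0 am] := h; have /andP[b0 bn] := k.
have := ratio_mul h; have := ratio_mul k.
have /andP[] := ratio_itv h; have /andP[] := ratio_itv k.
set x := a / m; set y := b / n => y0 y1 x0 x1 hy hx.
rewrite -[in X in _ * X](ger0_norm b0) -normrM.
have -> : (x - y) * b = y * (x * (n - m) + (a - b)).
  have : x * (y * n) - y * (y * n) = y * (x * (n - m) + (x * m - y * n)) by ring.
  by rewrite hx hy => <-; ring.
rewrite normrM (ger0_norm y0) -[leRHS]mul1r.
apply: ler_pM => //; apply: le_trans (ler_normD _ _) _.
rewrite lerD2r normrM (ger0_norm x0) (distrC m) -[leRHS]mul1r.
exact: ler_wpM2r.
Qed.

Lemma ups_dist m n a b : 0 <= a <= m -> 0 <= b <= n ->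
  `|ups m a - ups n b| <= 3 * (m + n) * (`|m - n| + `|a - b|).
Proof.
move=> h k; have := ratio_dist h k.
have /andP[a0 am] := h; have /andP[b0 bn] := k.
rewrite !upsE.
have /andP[] := ratio_itv h; have /andP[] := ratio_itv k.
move: (a / m) (b / n) => x y y0 y1 x0 x1 hxy.
have e0 : `|x * a - y * b| <= `|m - n| + 2 * `|a - b|.
  have -> : x * a - y * b = x * (a - b) + (x - y) * b by ring.
  apply: le_trans (ler_normD _ _) _.
  rewrite !normrM (ger0_norm b0) (ger0_norm x0).
  have : x * `|a - b| <= 1 * `|a - b| by exact: ler_wpM2r.
  lra.
have -> : m ^+ 2 + (x * a) ^+ 2 - (n ^+ 2 + (y * b) ^+ 2) =
  (m - n) * (m + n) + (x * a - y * b) * (x * a + y * b) by ring.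
have s0 : 0 <= m + n by lra.
have t0 : 0 <= x * a + y * b by rewrite addr_ge0// mulr_ge0.
have t1 : x * a + y * b <= m + n by nra.
apply: le_trans (ler_normD _ _) _.
rewrite !normrM (ger0_norm s0) (ger0_norm t0).
have : `|x * a - y * b| * (x * a + y * b) <=
  (`|m - n| + 2 * `|a - b|) * (m + n) by apply: ler_pM.
have := normr_ge0 (m - n); have := normr_ge0 (a - b).
nra.
Qed.

End GaugeFunction.

Section GaugeGradient.
Context {R : realType} {H : completeNormedModType R}.
Variable ip : {dot H for (@idfun R)}.
Hypothesis ipH : hilbert_product ip.
Implicit Types (g d : Hpath H) (m n r s t e : R) (x y h : H).

Definition upsgrad m x := (4 * (`|x| / m) ^+ 2) *: x.

Lemma upsgradN m x : upsgrad m (- x) = - upsgrad m x.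
Proof. by rewrite /upsgrad normrN scalerN. Qed.

Lemma upsgrad_norm m x : `|x| <= m -> `|upsgrad m x| <= 4 * `|x|.
Proof.
move=> xm; have hx : 0 <= `|x| <= m by rewrite normr_ge0.
have /andP[r0 r1] := ratio_itv hx; rewrite normrZ ler_wpM2r//.
by rewrite ger0_norm; nra.
Qed.

(** Writing the gradient as 4 (|x|/m)^2 x, the factor varies like |x|/m, and
    its variation is multiplied by a vector of norm at most n ([ratio_dist]). *)
Lemma upsgrad_dist m n x y : `|x| <= m -> `|y| <= n ->
  `|upsgrad m x - upsgrad n y| <= 12 * `|x - y| + 8 * `|m - n|.
Proof.
move=> xm yn; have hx : 0 <= `|x| <= m by rewrite normr_ge0.
have hy : 0 <= `|y| <= n by rewrite normr_ge0.
have := ratio_dist hx hy.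
have /andP[] := ratio_itv hx; have /andP[] := ratio_itv hy.
rewrite /upsgrad; move: (`|x| / m) (`|y| / n) => a b b0 b1 a0 a1 hab.
have -> : (4 * a ^+ 2) *: x - (4 * b ^+ 2) *: y =
   (4 * a ^+ 2) *: (x - y) + (4 * (a + b) * (a - b)) *: y by vring ipH.
apply: le_trans (ler_normD _ _) _.
rewrite (normrZ _ (x - y)) (normrZ _ y).
have h1 : `|4 * a ^+ 2| <= 4 by rewrite ger0_norm; nra.
have h2 : `|4 * (a + b)| <= 8 by rewrite ger0_norm; lra.
have h3 := ler_dist_dist x y.
have h4 : `|4 * a ^+ 2| * `|x - y| <= 4 * `|x - y| by exact: ler_wpM2r.
have h5 : `|4 * (a + b) * (a - b)| * `|y| <= 8 * (`|m - n| + `|(`|x|) - (`|y|)|).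
  by rewrite normrM -mulrA; apply: ler_pM => //; rewrite mulr_ge0.
lra.
Qed.

Lemma Upsilon2_ups g : (norm0 g = 0 -> g (ptime g) = 0) ->
  Upsilon2 g = ups (norm0 g) `|g (ptime g)|.
Proof.
rewrite /Upsilon2 /Sfun /ups; have [m0 /(_ m0) ->|m0 _] := eqVneq (norm0 g) 0.
  by rewrite m0 normr0 !expr0n /= mulr0 mul0r expr0n !addr0.
by field.
Qed.

Lemma Upsilon2E g : continuous_path g ->
  Upsilon2 g = ups (norm0 g) `|g (ptime g)|.
Proof.
move=> hg; apply: Upsilon2_ups => m0; apply/eqP.
by rewrite -normr_le0 -m0; exact: le_norm0.
Qed.

Lemma vbump_end g h : 0 <= ptime g -> vbump g h (ptime g) = g (ptime g) + h.
Proof. by move=> t0; rewrite /= clamp_end// ltxx. Qed.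

(** The bumped path takes the original values on [0, t); by continuity their
    supremum is still the maximum of the whole path, provided t > 0. *)
Lemma norm0_vbump g h : continuous_path g -> 0 < ptime g ->
  norm0 (vbump g h) = Num.max (norm0 g) `|g (ptime g) + h|.
Proof.
move=> hg t0; have bnd r : `|vbump g h r| <= Num.max (norm0 g) `|g (ptime g) + h|.
  rewrite /=; case: ifP => _; last by rewrite le_max lexx orbT.
  by rewrite le_max le_norm0.
apply/le_anti/andP; split; first by apply: norm0_le => [|r _]; [exact: ltW | exact: bnd].
rewrite ge_max; apply/andP; split; last first.
  rewrite -(vbump_end h (ltW t0)).
  apply: (le_norm0_bounded bnd) => /=.
  by rewrite ltW//= lexx.
have lt_t r : 0 <= r < ptime g -> `|g r| <= norm0 (vbump g h).
  move=> /andP[r0 rt]; have hr : 0 <= r <= ptime g by rewrite r0 ltW.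
  by have := le_norm0_bounded bnd hr; rewrite /= clamp_id// rt.
apply: norm0_le => [|r /andP[r0]]; first exact: ltW.
rewrite le_eqVlt => /orP[/eqP rt|rt]; last by apply: lt_t; rewrite r0.
apply/ler_addgt0Pr => e e0; have [d d0 hd] := cpath_eps hg r e0.
pose s := Num.max 0 (r - d / 2).
have s0 : 0 <= s by rewrite le_max lexx.
have sr : s < r by rewrite gt_max rt t0 /=; lra.
have sd : r - d / 2 <= s by rewrite le_max lexx orbT.
have h1 : `|g s - g r| < e.
  by apply: hd; rewrite ltr0_norm ?subr_lt0// opprB; lra.
have h2 : `|g s| <= norm0 (vbump g h) by apply: lt_t; rewrite s0 -rt.
have := ler_dist_dist (g r) (g s); rewrite distrC in h1.
have := ler_norm ((`|g r|) - (`|g s|)); lra.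
Qed.

(** Bumping the end value x by h changes the squared end norm by
    2(x,h) + |h|^2; the maximum of the path changes only when |x + h| exceeds it,
    and then by a quantity that enters quadratically. *)
Lemma ups_expansion m x h : `|x| <= m -> `|h| <= m ->
  `|ups (Num.max m `|x + h|) `|x + h| - ups m `|x| - ip (upsgrad m x) h|
    <= 20 * `|h| ^+ 2.
Proof.
move=> xm hm; have [m0|m0] := eqVneq m 0.
  have x0 : x = 0 by apply/eqP; rewrite -normr_le0 -m0.
  have h0 : h = 0 by apply/eqP; rewrite -normr_le0 -m0.
  by rewrite x0 h0 addr0 normr0 m0 maxxx subrr ip0r subr0 normr0 expr0n /= mulr0.
have mp : 0 < m by rewrite lt_neqAle eq_sym m0 (le_trans (normr_ge0 x)).
rewrite /upsgrad ipZl.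
have := sqr_normD ipH x h; have := norm_ip_le ipH x h.
have := ler_normD x h; have := normr_ge0 (x + h).
have := normr_ge0 x; have := normr_ge0 h.
move: xm hm; move: (`|x|) (`|h|) (`|x + h|) (ip x h) => a k b p am km k0 a0 b0 bak.
rewrite ler_norml => /andP[p1 p2] hb.
pose E := b ^+ 2 - a ^+ 2.
have E1 : E <= 3 * m * k by rewrite /E hb; nra.
have E2 : - (3 * m * k) <= E by rewrite /E hb; nra.
have E3 : E ^+ 2 <= 9 * m ^+ 2 * k ^+ 2 by nra.
have km2 : k ^+ 2 = 9^-1 * (9 * m ^+ 2 * k ^+ 2) / m ^+ 2 by field.
have main : 0 <= ups m b - ups m a - 4 * (a / m) ^+ 2 * p <= 11 * k ^+ 2.
  have -> : ups m b - ups m a - 4 * (a / m) ^+ 2 * p =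
      2 * (a / m) ^+ 2 * k ^+ 2 + E ^+ 2 / m ^+ 2.
    rewrite /ups /E; have -> : b ^+ 2 = a ^+ 2 + 2 * p + k ^+ 2 by [].
    by field.
  have ha : 0 <= a <= m by rewrite a0.
  have /andP[r0 r1] := ratio_itv ha.
  have q1 : E ^+ 2 / m ^+ 2 <= 9 * k ^+ 2.
    by rewrite ler_pdivrMr ?exprn_gt0//; lra.
  have q2 : 0 <= E ^+ 2 / m ^+ 2 by rewrite divr_ge0 ?sqr_ge0.
  have q3 : (a / m) ^+ 2 * k ^+ 2 <= k ^+ 2.
    by rewrite ler_piMl ?sqr_ge0// expr_le1.
  have q4 : 0 <= (a / m) ^+ 2 * k ^+ 2 by rewrite mulr_ge0// sqr_ge0.
  by apply/andP; split; lra.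
have k2 := sqr_ge0 k.
have /andP[M1 M2] := main.
case: (leP m b) => mb; last by rewrite ler_norml; lra.
have bp : 0 < b by apply: lt_le_trans mb.
have gap : 0 <= ups m b - ups b b <= 9 * k ^+ 2.
  have -> : ups m b - ups b b = ((b ^+ 2 - m ^+ 2) / m) ^+ 2.
    rewrite /ups; field; rewrite m0 gt_eqF//.
  rewrite sqr_ge0 /= expr_div_n ler_pdivrMr ?exprn_gt0//.
  have q0 : 0 <= b ^+ 2 - m ^+ 2 by nra.
  have q1 : b ^+ 2 - m ^+ 2 <= 3 * m * k by nra.
  by nra.
have /andP[G1 G2] := gap.
by rewrite ler_norml; lra.
Qed.

(** At time 0 the path consists of its end value and Upsilon2 is 2 |x|^2, whose
    gradient is given by the same formula with m = |x|. *)
Lemma is_dx_Upsilon2 g : continuous_path g ->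
  is_dx ip (@Upsilon2 R H) g (upsgrad (norm0 g) (g (ptime g))).
Proof.
move=> hg; set x := g (ptime g); set m := norm0 g; have [t0 st _] := hg.
have xm : `|x| <= m by exact: le_norm0.
have key h : (m = 0 \/ `|h| <= m) ->
  `|Upsilon2 (vbump g h) - Upsilon2 g - ip (upsgrad m x) h| <= 20 * `|h| ^+ 2.
  move=> hm; rewrite (Upsilon2E hg) -/x -/m.
  have [tp|tn] := eqVneq (ptime g) 0.
    have mx : m = `|x|.
      apply/le_anti; rewrite xm andbT; apply: norm0_le => // r.
      by rewrite tp => /le_anti <-; rewrite /x tp.
    have nb : norm0 (vbump g h) = `|x + h|.
      have bnd r : `|vbump g h r| <= `|x + h|.
        by rewrite /= tp; have /le_anti <- := clamp_itv r (lexx 0); rewrite ltxx /x tp.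
      apply/le_anti/andP; split; first exact: norm0_le.
      rewrite /x -(vbump_end h t0); apply: (le_norm0_bounded bnd) => /=.
      by rewrite t0 lexx.
    rewrite Upsilon2_ups nb /= clamp_end// ltxx -/x; last first.
      by move/normr0_eq0.
    rewrite mx !ups_diag (sqr_normD ipH) /upsgrad ipZl.
    have -> : 4 * (`|x| / `|x|) ^+ 2 * ip x h = 4 * ip x h.
      have [->|xn] := eqVneq x 0; first by rewrite ip0l !mulr0.
      by rewrite divff ?normr_eq0// expr1n mulr1.
    have := sqr_ge0 `|h| => k2.
    by rewrite ler_norml; lra.
  have tp : 0 < ptime g by rewrite lt_neqAle eq_sym tn.
  rewrite Upsilon2_ups norm0_vbump// vbump_end// -/x -/m; last first.
    move=> h0; apply/eqP; rewrite -normr_le0 -[leRHS]h0.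
    by rewrite le_max lexx orbT.
  case: hm => [m0|]; last exact: ups_expansion.
  have x0 : x = 0 by apply/eqP; rewrite -normr_le0 -m0.
  rewrite x0 add0r normr0 m0 max_r// /upsgrad scaler0 ip0l subr0.
  rewrite !ups_diag expr0n /= mulr0 subr0 ger0_norm ?mulr_ge0 ?sqr_ge0//.
  by rewrite ler_wpM2r ?sqr_ge0//; lra.
rewrite /is_dx; apply/cvgrPdist_le => e e0.
have [d d0 hd] : exists2 d, 0 < d & forall h, `|h| < d -> m = 0 \/ `|h| <= m.
  have [m0|mn] := eqVneq m 0; first by exists 1 => // h _; left.
  exists m; last by move=> h /ltW; right.
  by rewrite lt_neqAle eq_sym mn (le_trans (normr_ge0 x)).
have ed : 0 < Num.min d (e / 20) by rewrite lt_min d0 divr_gt0.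
apply/nbhs_ballP; exists (Num.min d (e / 20)) => //= h.
rewrite -ball_normE /= sub0r normrN lt_min => /andP[h1 h2] hn.
rewrite sub0r normrN normrM normfV normr_id ler_pdivrMr ?normr_gt0//.
apply: le_trans (key h (hd h h1)) _; rewrite expr2 mulrA ler_wpM2r//; lra.
Qed.

Lemma is_dx_unique (f : Hpath H -> R) g B C :
  is_dx ip f g B -> is_dx ip f g C -> B = C.
Proof.
move=> hB hC; apply/eqP; rewrite -subr_eq0; apply/negPn/negP => v0.
set v := B - C in v0; have vp : 0 < `|v| by rewrite normr_gt0.
move/cvgrPdist_le : hB => /(_ (`|v| / 4) (divr_gt0 vp (ltr0n R 4))).
move/nbhs_ballP => [b /= b0 hb].
move/cvgrPdist_le : hC => /(_ (`|v| / 4) (divr_gt0 vp (ltr0n R 4))).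
move/nbhs_ballP => [c /= c0 hc].
pose l := Num.min b c / (2 * `|v|).
have bc0 : 0 < Num.min b c by rewrite lt_min b0.
have l0 : 0 < l by rewrite divr_gt0// mulr_gt0.
have nh : `|l *: v| = Num.min b c / 2.
  by rewrite normrZ gtr0_norm// /l; field; rewrite gt_eqF.
have h0 : l *: v != 0 by rewrite scaler_eq0 negb_or gt_eqF//= v0.
have /andP[lb lc] : (`|l *: v| < b) && (`|l *: v| < c).
  by rewrite -lt_min nh; lra.
have := hb (l *: v); have := hc (l *: v).
rewrite -!ball_normE /= !sub0r !normrN => /(_ lc h0) + /(_ lb h0).
set D := f _ - f g; have hp : 0 < `|l *: v| by rewrite normr_gt0.
rewrite !normrM !normfV !normr_id !ler_pdivrMr//.
have e1 : ip B (l *: v) - ip C (l *: v) = l * `|v| ^+ 2.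
  by rewrite -ipH -ipNl -ipDl ipZr.
have e2 : `|l *: v| = l * `|v| by rewrite normrZ gtr0_norm.
rewrite !ler_norml e2 => /andP[x1 x2] /andP[y1 y2].
have : 0 < l * `|v| ^+ 2 by rewrite mulr_gt0// exprn_gt0.
nra.
Qed.

Lemma dx_eq (f : Hpath H -> R) g B : is_dx ip f g B -> dx ip f g = B.
Proof. by move=> hB; apply: xget_unique => // C hC; exact: is_dx_unique hC hB. Qed.

Lemma dx_Upsilon2 g : continuous_path g ->
  dx ip (@Upsilon2 R H) g = upsgrad (norm0 g) (g (ptime g)).
Proof. by move=> hg; apply: dx_eq; exact: is_dx_Upsilon2. Qed.

End GaugeGradient.

(** * Distance and gauge between paths *)

Section PathDistance.
Context {R : realType} {H : completeNormedModType R}.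
Variables (S : R -> {linear H -> H}) (T : R).
Hypothesis hS : contraction_semigroup S.
Hypothesis T0 : 0 < T.
Implicit Types (g d k : Hpath H) (r s t e : R).

(** The term of dinf that compares the curves; the other one is the time
    difference. *)
Definition pdist g d := norm0 (psub (flow S g T) (flow S d T)).

Definition pgap g d := psub g (flow S d (ptime g)).

Definition past t g := continuous_path g /\ t <= ptime g <= T.

Lemma Lambda_fromP t g : Lambda_from T t g <-> past t g.
Proof.
split=> [[s /=]|[hg ht]]; first by rewrite in_itv/= => ts [gs hg]; rewrite /past gs.
by exists (ptime g); rewrite //= in_itv.
Qed.

Lemma LambdaP g : Lambda T g <-> continuous_path g /\ ptime g <= T.
Proof.
rewrite /Lambda Lambda_fromP /past; split=> [[hg /andP[]]|[hg ht]] //.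
by split=> //; have [-> _ _] := hg.
Qed.

Lemma cpath_horizon g : continuous_path g -> continuous_path (flow S g T).
Proof. by move=> hg; apply: cpath_flow => //; exact: ltW. Qed.

Lemma cpath_pdiff g d : continuous_path g -> continuous_path d ->
  continuous_path (psub (flow S g T) (flow S d T)).
Proof. by move=> hg hd; apply: cpath_psub => //; exact: cpath_horizon. Qed.

Lemma pdist_ge0 g d : continuous_path g -> continuous_path d -> 0 <= pdist g d.
Proof. by move=> hg hd; apply: norm0_ge0; exact: cpath_pdiff. Qed.

Lemma le_pdist g d r : continuous_path g -> continuous_path d ->
  `|flow S g T r - flow S d T r| <= pdist g d.
Proof. by move=> hg hd; exact: (le_norm0 r (cpath_pdiff hg hd)). Qed.

Lemma pdist_le g d e :
  (forall r, 0 <= r <= T -> `|flow S g T r - flow S d T r| <= e) ->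
  pdist g d <= e.
Proof. by move=> h; apply: norm0_le => //=; exact: ltW. Qed.

Lemma pdistxx g : pdist g g = 0.
Proof.
apply/le_anti; rewrite pdist_le//=; last by move=> r _; rewrite subrr normr0.
apply: (@le_trans _ _ `|psub (flow S g T) (flow S g T) 0|) => //.
apply: (@le_norm0_bounded _ _ _ 0) => /= [r|]; first by rewrite subrr normr0.
by rewrite lexx ltW.
Qed.

Lemma pdistC g d : continuous_path g -> continuous_path d -> pdist g d = pdist d g.
Proof.
move=> hg hd; apply/le_anti/andP; split; apply: pdist_le => r _;
  by rewrite distrC le_pdist.
Qed.

Lemma pdist_triangle g d k : continuous_path g -> continuous_path d ->
  continuous_path k -> pdist g d <= pdist g k + pdist k d.
Proof.
move=> hg hd hk; apply: pdist_le => r _.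
apply: le_trans (ler_distD (flow S k T r) _ _) _.
by apply: lerD; exact: le_pdist.
Qed.

Lemma norm0_pdist g d : continuous_path g -> continuous_path d ->
  ptime g <= T -> ptime d <= T -> norm0 g <= norm0 d + pdist g d.
Proof.
move=> hg hd gT dT; rewrite -(norm0_flow hS hg gT) -(norm0_flow hS hd dT).
apply: norm0_le => [|r _]; first exact: ltW.
have := le_pdist r hg hd; have := le_norm0 r (cpath_horizon hd).
have := ler_normD (flow S d T r) (flow S g T r - flow S d T r).
by rewrite addrC subrK; lra.
Qed.

Lemma flow_step g s r : continuous_path g -> ptime g <= s -> s <= r -> r <= T ->
  flow S g T r = S (r - s) (flow S g T s).
Proof.
move=> hg gs sr rT; rewrite (flow_after S hg gs (le_trans sr rT)).
rewrite (flow_after S hg (le_trans gs sr) rT) -semigroupD ?subr_ge0//.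
by congr (S _ _); ring.
Qed.

Lemma flow_horizon g s r : continuous_path g -> ptime g <= s -> s <= T ->
  0 <= r <= s -> flow S g s r = flow S g T r.
Proof.
move=> hg gs sT /andP[r0 rs]; rewrite /= !clamp_id ?r0//.
exact: le_trans sT.
Qed.

Lemma flow_at_end g : continuous_path g -> ptime g <= T -> flow S g T (ptime g) = g (ptime g).
Proof. by move=> hg gT; rewrite flow_before. Qed.

Lemma flow_pgap g d s : continuous_path g -> continuous_path d ->
  ptime d <= ptime g -> ptime g <= s ->
  flow S (pgap g d) s = psub (flow S g s) (flow S d s).
Proof.
move=> hg hd dg gs; have [t0 _ _] := hg.
rewrite -flow_psub//; last exact: cpath_flow.
by rewrite flow_flow.
Qed.

Lemma cpath_pgap g d : continuous_path g -> continuous_path d ->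
  continuous_path (pgap g d).
Proof.
by move=> hg hd; have [t0 _ _] := hg; apply: cpath_psub => //; exact: cpath_flow.
Qed.

(** After its end the difference evolves by a contraction, so extending both
    paths to the horizon does not change the maximum. *)
Lemma norm0_pgap g d : continuous_path g -> continuous_path d ->
  ptime d <= ptime g -> ptime g <= T -> norm0 (pgap g d) = pdist g d.
Proof.
move=> hg hd dg gT; rewrite /pdist -flow_pgap// norm0_flow//.
exact: cpath_pgap.
Qed.

Lemma pgap_end g d : continuous_path g -> continuous_path d ->
  ptime d <= ptime g -> ptime g <= T ->
  pgap g d (ptime g) = flow S g T (ptime g) - flow S d T (ptime g).
Proof.
move=> hg hd dg gT; have [t0 _ _] := hg.
rewrite flow_at_end// -(@flow_horizon d (ptime g))//.
by rewrite t0 lexx.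
Qed.

Lemma Upsilon2_pgap g d : continuous_path g -> continuous_path d ->
  ptime d <= ptime g -> ptime g <= T -> Upsilon2 (pgap g d) =
  ups (pdist g d) `|flow S g T (ptime g) - flow S d T (ptime g)|.
Proof.
move=> hg hd dg gT; rewrite Upsilon2E; last exact: cpath_pgap.
by rewrite norm0_pgap// pgap_end.
Qed.

Lemma pgap_end_le g d r : continuous_path g -> continuous_path d ->
  0 <= `|flow S g T r - flow S d T r| <= pdist g d.
Proof. by move=> hg hd; rewrite normr_ge0 le_pdist. Qed.

(** The extension by a contraction does not increase the gauge, because the
    maximum is kept and the end value shrinks. *)
Lemma Upsilon2_flow g s : continuous_path g -> ptime g <= s ->
  Upsilon2 (flow S g s) <= Upsilon2 g.
Proof.
move=> hg gs; have [t0 _ _] := hg; have s0 := le_trans t0 gs.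
rewrite !Upsilon2E//; last exact: cpath_flow.
rewrite norm0_flow//; apply: ups_mono_end => //; last exact: norm0_ge0.
by rewrite ptime_flow flow_after// semigroup_contr// subr_ge0.
Qed.

Lemma Upsilon2_pgap_flow g d s : continuous_path g -> continuous_path d ->
  ptime d <= ptime g -> ptime g <= s ->
  Upsilon2 (pgap (flow S g s) d) <= Upsilon2 (pgap g d).
Proof.
move=> hg hd dg gs; rewrite /pgap ptime_flow -/(pgap g d) -flow_pgap//.
by apply: Upsilon2_flow => //; exact: cpath_pgap.
Qed.

Lemma Upsilon2_pgap_add g d k r : continuous_path g -> continuous_path d ->
  continuous_path k -> ptime k <= ptime g -> ptime d <= ptime g -> ptime g <= T ->
  `|flow S k T (ptime g) - flow S d T (ptime g)| <= r -> r <= pdist k d ->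
  Upsilon2 (pgap g d) <= 2 * Upsilon2 (pgap g k) + 2 * ups (pdist k d) r.
Proof.
move=> hg hd hk kg dg gT h1 h2.
rewrite !Upsilon2_pgap//.
have b1 := pgap_end_le (ptime g) hg hk.
have b2 : 0 <= r <= pdist k d by rewrite h2 (le_trans _ h1).
apply: le_trans (ups_add b1 b2); apply: ups_mono.
- exact: pgap_end_le.
- by apply: le_trans (ler_distD (flow S k T (ptime g)) _ _) _; rewrite lerD2l.
- by have /andP[_ h3] := b1; exact: lerD.
- exact: pdist_triangle.
Qed.

Definition gauge g d := Upsilon2 (pgap g d) + `|ptime g - ptime d| ^+ 2.

Lemma gauge_ge0 g d : continuous_path g -> continuous_path d -> 0 <= gauge g d.
Proof.
move=> hg hd; rewrite addr_ge0 ?sqr_ge0// Upsilon2E ?ups_ge0//.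
exact: cpath_pgap.
Qed.

Lemma gaugexx g : continuous_path g -> ptime g <= T -> gauge g g = 0.
Proof.
move=> hg gT; rewrite /gauge Upsilon2_pgap// pdistxx !subrr !normr0.
by rewrite ups_diag !expr0n /= mulr0 addr0.
Qed.

(** Both terms of the gauge are homogeneous of degree two and convex, hence the
    factors 2. *)
Lemma gauge_quasi_triangle g k d : continuous_path g -> continuous_path d ->
  continuous_path k -> ptime d <= ptime k -> ptime k <= ptime g -> ptime g <= T ->
  gauge g d <= 2 * gauge g k + 2 * gauge k d.
Proof.
move=> hg hd hk dk kg gT; rewrite /gauge.
have kT := le_trans kg gT; have dg := le_trans dk kg.
have b : `|flow S k T (ptime g) - flow S d T (ptime g)| <=
    `|flow S k T (ptime k) - flow S d T (ptime k)|.
  rewrite !(@flow_step _ (ptime k) (ptime g))//.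
  by apply: semigroup_dist; rewrite ?subr_ge0.
have := Upsilon2_pgap_add hg hd hk kg dg gT b (le_pdist _ hk hd).
rewrite -Upsilon2_pgap//.
have : `|ptime g - ptime d| ^+ 2 <=
  2 * `|ptime g - ptime k| ^+ 2 + 2 * `|ptime k - ptime d| ^+ 2.
  rewrite !real_normK ?num_real//.
  have := sqr_ge0 (ptime g - ptime k - (ptime k - ptime d)); nra.
lra.
Qed.

Lemma gauge_lower g d : continuous_path g -> continuous_path d ->
  ptime d <= ptime g -> ptime g <= T ->
  pdist g d ^+ 2 <= gauge g d /\ `|ptime g - ptime d| ^+ 2 <= gauge g d.
Proof.
move=> hg hd dg gT; rewrite /gauge Upsilon2_pgap//.
have := ups_ge (pdist g d) `|flow S g T (ptime g) - flow S d T (ptime g)|.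
have := sqr_ge0 (pdist g d); have := sqr_ge0 `|ptime g - ptime d|.
by split; lra.
Qed.

Lemma gauge_upper g d : continuous_path g -> continuous_path d ->
  ptime d <= ptime g -> ptime g <= T ->
  gauge g d <= 2 * pdist g d ^+ 2 + `|ptime g - ptime d| ^+ 2.
Proof.
move=> hg hd dg gT; rewrite /gauge lerD2r Upsilon2_pgap//.
by apply: ups_le; exact: pgap_end_le.
Qed.

End PathDistance.

(** * Continuous functionals and completeness *)

Section ContinuousFunctionals.
Context {R : realType} {H : completeNormedModType R}.
Variables (S : R -> {linear H -> H}) (T : R).
Hypothesis hS : contraction_semigroup S.
Hypothesis T0 : 0 < T.
Implicit Types (g d k : Hpath H) (r s t e : R) (X : set (Hpath H)).

Definition path_near X g : set_system (Hpath H) :=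
  filter_from [set r : R | 0 < r] (fun r => [set d | X d /\ dinf T S g d < r]).

#[local] Instance path_near_filter X g : Filter (path_near X g).
Proof.
apply: filter_from_filter; first by exists 1 => /=.
move=> r s /= r0 s0; exists (Num.min r s); first by rewrite /= lt_min r0.
by move=> d [Xd] /=; rewrite lt_min => /andP[].
Qed.

Lemma C0_onP X (f : Hpath H -> R) :
  C0_on T S X f <-> forall g, X g -> f x @[x --> path_near X g] --> f g.
Proof.
split=> hf g Xg.
  apply/cvgrPdist_lt => e e0; have [r r0 hr] := hf g Xg e e0.
  by exists r => // d [Xd hd] /=; rewrite distrC; exact: hr.
move=> e e0; have /cvgrPdist_lt/(_ e e0) [r /= r0 hr] := hf g Xg.
by exists r => // d Xd hd; rewrite distrC; exact: hr.
Qed.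

Lemma C0_cst X (c : R) : C0_on T S X (fun=> c).
Proof. by apply/C0_onP => g _; exact: cvg_cst. Qed.

Lemma C0_add X (f h : Hpath H -> R) : C0_on T S X f -> C0_on T S X h ->
  C0_on T S X (fun g => f g + h g).
Proof.
move=> /C0_onP hf /C0_onP hh; apply/C0_onP => g Xg.
by apply: cvgD; [exact: hf|exact: hh].
Qed.

Lemma C0_mul X (f h : Hpath H -> R) : C0_on T S X f -> C0_on T S X h ->
  C0_on T S X (fun g => f g * h g).
Proof.
move=> /C0_onP hf /C0_onP hh; apply/C0_onP => g Xg.
by apply: cvgM; [exact: hf|exact: hh].
Qed.

Lemma C0_opp X (f : Hpath H -> R) : C0_on T S X f -> C0_on T S X (fun g => - f g).
Proof.
by move=> /C0_onP hf; apply/C0_onP => g Xg; apply: cvgN; exact: hf.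
Qed.

Lemma C0_sub X (f h : Hpath H -> R) : C0_on T S X f -> C0_on T S X h ->
  C0_on T S X (fun g => f g - h g).
Proof. by move=> hf hh; apply: C0_add => //; exact: C0_opp. Qed.

Lemma C0_comp X (f : Hpath H -> R) (c : R -> R) :
  continuous c -> C0_on T S X f -> C0_on T S X (fun g => c (f g)).
Proof.
move=> hc /C0_onP hf; apply/C0_onP => g Xg.
by apply: continuous_cvg; [exact: hc | exact: hf].
Qed.

Lemma C0_subset X Y (f : Hpath H -> R) : Y `<=` X -> C0_on T S X f -> C0_on T S Y f.
Proof.
move=> YX hf g Yg e e0; have [r r0 hr] := hf g (YX g Yg) e e0.
by exists r => // d Yd; apply: hr; exact: YX.
Qed.

Lemma C0_eq X (f h : Hpath H -> R) : (forall g, X g -> f g = h g) ->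
  C0_on T S X f -> C0_on T S X h.
Proof.
move=> fh hf g Xg e e0; have [r r0 hr] := hf g Xg e e0.
by exists r => // d Xd hd; rewrite -!fh//; exact: hr.
Qed.

Lemma C0_ptime t : C0_on T S (past T t) (@ptime R H).
Proof.
move=> g [hg _] e e0; exists e => // d [hd _]; apply: le_lt_trans.
by rewrite distrC /dinf lerDl; exact: pdist_ge0.
Qed.

(** End values are read at different times; the extensions of the fixed
    paths g and d are continuous in time, which controls the difference. *)
Lemma C0_pgap t d : continuous_path d -> ptime d <= t ->
  C0_on T S (past T t) (fun g => Upsilon2 (pgap S g d)).
Proof.
move=> hd dt g [hg /andP[tg gT]] e e0.
pose w := psub (flow S g T) (flow S d T).
have hw : continuous_path w by exact: cpath_pdiff.
pose c := 12 * pdist S T g d + 6.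
have m0 : 0 <= pdist S T g d by exact: pdist_ge0.
have c0 : 0 < c by rewrite /c; lra.
have e1 : 0 < e / (3 * c) by rewrite divr_gt0// mulr_gt0.
have [b b0 hb] := cpath_eps hw (ptime g) e1.
pose a := Num.min 1 (Num.min b (e / (6 * c))).
have a0 : 0 < a by rewrite !lt_min ltr01 b0 divr_gt0// mulr_gt0.
exists a => // k [hk /andP[tk kT]].
rewrite /dinf -/(pdist S T g k) !lt_min => /and3P[k1 kb ke].
have d0 : 0 <= pdist S T g k by exact: pdist_ge0.
have t1 := normr_ge0 (ptime g - ptime k).
rewrite (Upsilon2_pgap hS hk hd (le_trans dt tk) kT).
rewrite (Upsilon2_pgap hS hg hd (le_trans dt tg) gT).
set x := flow S k T (ptime k) - _; set y := flow S g T (ptime g) - _.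
have hx : 0 <= `|x| <= pdist S T k d by exact: pgap_end_le.
have hy : 0 <= `|y| <= pdist S T g d by exact: pgap_end_le.
apply: le_lt_trans (ups_dist hx hy) _.
have q1 : `|pdist S T k d - pdist S T g d| <= pdist S T g k.
  have := pdist_triangle hS T0 hk hd hg; have := pdist_triangle hS T0 hg hd hk.
  by rewrite (pdistC hS T0 hk hg) ler_norml; lra.
have q2 : `|(`|x|) - (`|y|)| < pdist S T g k + e / (3 * c).
  apply: le_lt_trans (ler_dist_dist x y) _.
  have -> : x - y = (flow S k T (ptime k) - flow S g T (ptime k)) +
     (w (ptime k) - w (ptime g)).
    by rewrite /x /y /w /= addrA subrKA.
  apply: le_lt_trans (ler_normD _ _) _.
  have := le_pdist hS T0 (ptime k) hk hg; rewrite (pdistC hS T0 hk hg).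
  have : `|w (ptime k) - w (ptime g)| < e / (3 * c) by apply: hb; rewrite distrC; lra.
  lra.
have q3 : pdist S T k d + pdist S T g d <= 2 * pdist S T g d + 1.
  by have := ler_norm (pdist S T k d - pdist S T g d); lra.
have q4 : `|pdist S T k d - pdist S T g d| + `|(`|x|) - (`|y|)| < 2 * e / (3 * c).
  have -> : 2 * e / (3 * c) = 2 * (e / (6 * c)) + e / (3 * c).
    by field; rewrite gt_eqF.
  lra.
have q5 : 0 <= pdist S T k d by exact: pdist_ge0.
apply: (@le_lt_trans _ _ (c / 2 *
   (`|pdist S T k d - pdist S T g d| + `|(`|x|) - (`|y|)|))).
  by apply: ler_wpM2r; [rewrite addr_ge0 | rewrite /c; lra].
apply: lt_le_trans (_ : c / 2 * (2 * e / (3 * c)) <= e).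
  by rewrite ltr_pM2l// divr_gt0.
have -> : c / 2 * (2 * e / (3 * c)) = e / 3 by field; rewrite gt_eqF.
lra.
Qed.

Lemma C0_gauge t d : continuous_path d -> ptime d <= t ->
  C0_on T S (past T t) (fun g => gauge S g d).
Proof.
move=> hd dt; apply: C0_add; first exact: C0_pgap.
apply: (@C0_comp _ (fun g => `|ptime g - ptime d|) (fun x => x ^+ 2)).
  exact: exprn_continuous.
apply: (@C0_comp _ (fun g => ptime g - ptime d) (fun x => `|x|)).
  exact: norm_continuous.
by apply: C0_sub; [exact: C0_ptime | exact: C0_cst].
Qed.

Definition null_path : Hpath H := Path 0 (fun=> 0).

Lemma cpath_null : continuous_path null_path.
Proof.
apply: cpathI => //= r e e0; exists 1 => // s _.
by rewrite subrr normr0.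
Qed.

Lemma pgap_null g : pgap S g null_path = g.
Proof.
apply: path_eq => // r /=; case: ifP => _; rewrite ?subr0//.
by rewrite linear0 subr0.
Qed.

Lemma C0_Upsilon2 t : 0 <= t -> C0_on T S (past T t) (@Upsilon2 R H).
Proof.
move=> t0; apply: (@C0_eq _ (fun g => Upsilon2 (pgap S g null_path))).
  by move=> g _; rewrite pgap_null.
by apply: C0_pgap => //; exact: cpath_null.
Qed.

End ContinuousFunctionals.

Section Completeness.
Context {R : realType} {H : completeNormedModType R}.
Variables (S : R -> {linear H -> H}) (T : R).
Hypothesis hS : contraction_semigroup S.
Hypothesis T0 : 0 < T.
Implicit Types (e : R).

Lemma nondecreasing_limit (u : nat -> R) M :
  (forall n m, (n <= m)%N -> u n <= u m) -> (forall n, u n <= M) ->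
  exists l, [/\ forall n, u n <= l, l <= M & forall e, 0 < e -> exists N : nat,
    forall n, (N <= n)%N -> l - e < u n].
Proof.
move=> hu hM; pose A := range u.
have hA : has_sup A by split; [exists (u 0%N), 0%N | exists M => _ [n _ <-]].
exists (sup A); split.
- by move=> n; apply: ub_le_sup; [case: hA | exists n].
- by apply: ge_sup; [case: hA | move=> _ [n _ <-]].
- move=> e e0; have [_ [N _ <-] hN] := sup_adherent e0 hA.
  by exists N => n /hu; exact: lt_le_trans.
Qed.

(** The extensions to the horizon converge uniformly. The limit curve is cut at
    the supremum of the final times, after which it is an orbit of the semigroup
    because every path of the sequence has ended. *)
Lemma path_complete (u : nat -> Hpath H) :
  (forall n, continuous_path (u n)) -> (forall n, ptime (u n) <= T) ->
  (forall n m, (n <= m)%N -> ptime (u n) <= ptime (u m)) ->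
  (forall e, 0 < e -> exists N : nat, forall n m, (N <= n)%N -> (N <= m)%N ->
     pdist S T (u n) (u m) <= e) ->
  exists z, [/\ continuous_path z, ptime z <= T, forall n, ptime (u n) <= ptime z
    & forall e, 0 < e -> exists N : nat, forall n, (N <= n)%N ->
        dinf T S z (u n) < e].
Proof.
move=> hu uT uI uC; have [t [ut tT ht]] := nondecreasing_limit uI uT.
have t0 : 0 <= t by have [h0 _ _] := hu 0%N; exact: le_trans (ut 0%N).
have /choice[c hc] (r : R) : exists l : H, forall e : R, 0 < e -> exists N : nat,
    forall n, (N <= n)%N -> `|flow S (u n) T r - l| <= e.
  apply: cauchy_seq_limit => e e0; have [N hN] := uC e e0.
  exists N => n m Nn Nm; apply: le_trans (hN n m Nn Nm).
  exact: (le_pdist hS T0 r (hu n) (hu m)).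
have unif e : 0 < e -> exists N : nat, forall n, (N <= n)%N -> forall r,
    `|flow S (u n) T r - c r| <= e.
  move=> e0; have [N hN] := uC e e0; exists N => n Nn r.
  apply/ler_addgt0Pr => b b0; have [M hM] := hc r b b0.
  have := hM _ (leq_maxr N M); have := hN _ _ Nn (leq_maxl N M).
  have := le_pdist hS T0 r (hu n) (hu (maxn N M)).
  have := ler_distD (flow S (u (maxn N M)) T r) (flow S (u n) T r) (c r).
  lra.
have ceps : curve_eps c.
  move=> r e e0; have [N hN] := unif (e / 4) (divr_gt0 e0 (ltr0n R 4)).
  have [a a0 ha] := cpath_eps (cpath_horizon hS T0 (hu N)) r
     (divr_gt0 e0 (ltr0n R 4)).
  exists a => // s sr; have h1 := ha s sr.
  have h2 := hN N (leqnn N) r; have h3 := hN N (leqnn N) s.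
  rewrite distrC in h3.
  have := ler_distD (flow S (u N) T s) (c s) (c r).
  have := ler_distD (flow S (u N) T r) (flow S (u N) T s) (c r).
  lra.
pose z : Hpath H := mkpath t c.
have hz : continuous_path z.
  apply: cpathI => //= [r|r e e0] /=; first by rewrite clampK.
  have [a a0 ha] := ceps (clamp t r) e e0; exists a => // s sr.
  by apply: ha; exact: le_lt_trans (clamp_dist _ _ _) sr.
exists z; split => // e e0.
have [N1 h1] := ht (e / 2) (divr_gt0 e0 (ltr0n R 2)).
have [N2 h2] := unif (e / 4) (divr_gt0 e0 (ltr0n R 4)).
exists (maxn N1 N2) => n; rewrite geq_max => /andP[n1 n2].
have ht1 := h1 n n1; have hut := ut n.
have hp : pdist S T z (u n) <= e / 4.
  apply: pdist_le => // r /andP[r0 rT]; rewrite distrC.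
  have [rt|/ltW tr] := leP r t.
    rewrite (flow_before hS hz)// [z r]/= clamp_id ?r0//; exact: h2.
  rewrite (flow_step hS (hu n) (ut n) tr rT).
  rewrite (flow_after S hz tr rT) /= clamp_end//.
  by apply: le_trans (semigroup_dist hS _ _ _) (h2 n n2 t); rewrite subr_ge0.
rewrite /dinf -/(pdist S T z (u n)) /= ger0_norm ?subr_ge0//; lra.
Qed.

End Completeness.

(** * The variational principle *)

Section GeometricWeights.
Context {R : realType}.
Implicit Types (c M : R) (v : nat -> R).

Definition half_pow c (n : nat) : R := c / 2 ^+ n.

Lemma half_pow_gt0 c n : 0 < c -> 0 < half_pow c n.
Proof. by move=> c0; rewrite divr_gt0// exprn_gt0. Qed.

Lemma half_pow_sum c n : \sum_(0 <= i < n) half_pow c i = 2 * c - 2 * half_pow c n.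
Proof.
elim: n => [|n IH]; first by rewrite big_geq// /half_pow expr0 divr1 subrr.
by rewrite big_nat_recr//= IH /half_pow exprS; field; rewrite expf_neq0.
Qed.

Lemma half_pow_small c (e : R) : 0 < c -> 0 < e ->
  exists N : nat, forall n, (N <= n)%N -> half_pow c n <= e.
Proof.
move=> c0 e0; exists (Num.truncn (c / e)).+1 => n Nn.
rewrite ler_pdivrMr ?exprn_gt0// mulrC -ler_pdivrMr//.
apply: le_trans (ltW (truncnS_gt (c / e))) _.
by rewrite -natrX ler_nat (leq_trans Nn)// ltnW// ltn_expl.
Qed.

Lemma nonneg_series_le v M : (forall i, 0 <= v i) ->
  (forall n, series v n <= M) ->
  [/\ cvgn (series v), forall n, series v n <= limn (series v)
    & limn (series v) <= M].
Proof.
move=> v0 vM.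
have nd : nondecreasing_seq (series v).
  by apply: nondecreasing_series => n _ _; exact: v0.
have cv : cvgn (series v).
  by apply: nondecreasing_is_cvgn => //; exists M => _ [n _ <-].
split=> // [n|]; first exact: nondecreasing_cvgn_le.
by apply: limr_le => //; exact: nearW.
Qed.

Lemma weighted_series_le c v M n : 0 <= c -> 0 <= M -> (forall i, v i <= M) ->
  series (fun i => half_pow c i * v i) n <= 2 * c * M.
Proof.
move=> c0 M0 vM; apply: (@le_trans _ _ (\sum_(0 <= i < n) half_pow c i * M)).
  by apply: ler_sum => i _; rewrite ler_wpM2l// divr_ge0// exprn_ge0.
rewrite -mulr_suml half_pow_sum ler_wpM2r// lerBlDr lerDl mulr_ge0//.
by rewrite divr_ge0// exprn_ge0.
Qed.

End GeometricWeights.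

Section VariationalPrinciple.
Context {R : realType} {Z : Type}.
Variables (X : set Z) (le : Z -> Z -> Prop) (rho : Z -> Z -> R) (f : Z -> R).
Hypothesis le_refl : forall z, X z -> le z z.
Hypothesis le_tr : forall y x z, le x y -> le y z -> le x z.
Hypothesis rho_ge0 : forall z w, X z -> X w -> 0 <= rho z w.
Hypothesis rho_refl : forall z, X z -> rho z z = 0.
Hypothesis rho_quasi : forall w y z, X w -> X y -> X z -> le w y -> le y z ->
  rho z w <= 2 * rho z y + 2 * rho y w.
Hypothesis rho_complete : forall u : nat -> Z, (forall n, X (u n)) ->
  (forall n m, (n <= m)%N -> le (u n) (u m)) ->
  (forall e, 0 < e -> exists N : nat, forall n m, (N <= n)%N -> (n <= m)%N ->
    rho (u m) (u n) <= e) ->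
  exists z, [/\ X z, forall n, le (u n) z,
    forall e, 0 < e -> exists N : nat, forall n, (N <= n)%N -> f (u n) <= f z + e
    & forall k e, 0 < e -> exists N : nat, forall n, (N <= n)%N ->
        `|rho (u n) (u k) - rho z (u k)| <= e].

(** A variational principle of Borwein and Preiss in which the admissible points
    only move forward for the preorder. Each new point almost maximizes the
    functional perturbed so far among the points lying ahead; the gauges attached
    to the points already chosen then force the sequence to be Cauchy, and its
    limit is an exact maximum of the fully perturbed functional. *)
Lemma borwein_preiss (z0 : Z) (c a : R) : X z0 -> 0 < c -> 0 < a ->
  (forall z, X z -> le z0 z -> f z <= f z0 + c * a) ->
  exists (u : nat -> Z) (z1 : Z),
  [/\ [/\ u 0%N = z0, forall n, X (u n), forall n, le (u n) z1 & X z1],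
      forall n, rho z1 (u n) <= a,
      f z0 <= f z1
    & forall z, X z -> le z1 z ->
        f z - limn (series (fun i => half_pow c i * rho z (u i))) <=
        f z1 - limn (series (fun i => half_pow c i * rho z1 (u i)))].
Proof.
move=> Xz0 c0 a0 fz0.
have /choice[G hG] (p : nat * (Z -> R) * Z) : exists w', X p.2 ->
    (exists M, forall z, X z -> le p.2 z -> p.1.2 z <= M) ->
    [/\ X w', le p.2 w', p.1.2 p.2 <= p.1.2 w'
      & forall z, X z -> le p.2 z -> p.1.2 z <= p.1.2 w' +
          half_pow c p.1.1 * half_pow a p.1.1].
  case: p => -[n F] w /=; have [[Xw [M hM]]|hn] := pselect (X w /\
      (exists M, forall z, X z -> le w z -> F z <= M)); last first.
    by exists w => h1 h2; case: hn.
  pose A := [set F z | z in [set z | X z /\ le w z]].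
  have Aw : A (F w) by exists w => //; split=> //; exact: le_refl.
  have hA : has_sup A.
    by split; [exists (F w) | exists M => _ [z [Xz wz] <-]; exact: hM].
  have e0 : 0 < half_pow c n * half_pow a n by rewrite mulr_gt0// half_pow_gt0.
  have [_ [v [Xv wv] <-] hv] := sup_adherent e0 hA.
  have ub z : X z -> le w z -> F z <= sup A.
    by move=> Xz wz; apply: ub_le_sup; [case: hA | exists z].
  have [vw|wv'] := leP (F w) (F v).
    exists v => _ _; split => // z Xz wz; have := ub z Xz wz; lra.
  exists w => _ _; split => //; first exact: le_refl.
  by move=> z Xz wz; have := ub z Xz wz; lra.
pose next n (st : (Z -> R) * Z) : (Z -> R) * Z :=
  let F := fun z => st.1 z - half_pow c n * rho z st.2 in (F, G (n.+1, F, st.2)).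
pose st := fix loop n := if n is m.+1 then next m (loop m) else (f, z0).
pose u n := (st n).2.
pose F n := (st n).1.
have FS n z : F n.+1 z = F n z - half_pow c n * rho z (u n) by [].
have hc n : 0 < half_pow c n by exact: half_pow_gt0.
have ha n : 0 < half_pow a n by exact: half_pow_gt0.
(* near maximality at u n concerns all later points, and the sets of later
   points shrink, so it persists *)
have inv n : [/\ X (u n), forall z, X z -> F n z <= f z, le z0 (u n)
  & forall z, X z -> le (u n) z -> F n z <= F n (u n) + half_pow c n * half_pow a n].
  elim: n => [|n [Xu Ff zu hF]].
    split=> //; first exact: le_refl.
    by move=> z Xz z0z; rewrite /half_pow !expr0 !divr1; exact: fz0.
  have Ff' z : X z -> F n.+1 z <= f z.
    move=> Xz; rewrite FS; apply: le_trans (Ff z Xz).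
    by rewrite lerBlDr lerDl mulr_ge0 ?(ltW (hc n))// rho_ge0.
  have [||] := hG (n.+1, F n.+1, u n) => //=.
    exists (f z0 + c * a) => z Xz uz; apply: le_trans (Ff' z Xz) _.
    by apply: fz0 => //; exact: le_tr uz.
  rewrite -/(u n.+1) => Xu' uu' _ hF'; split => //; first exact: le_tr uu'.
  by move=> z Xz uz; apply: hF' => //; exact: le_tr uz.
have step n : le (u n) (u n.+1) /\ F n (u n) <= F n.+1 (u n.+1).
  have [Xu Ff zu hF] := inv n; have [_ Ff' _ _] := inv n.+1.
  have [||] := hG (n.+1, F n.+1, u n) => //=.
    exists (f z0 + c * a) => z Xz uz; apply: le_trans (Ff' z Xz) _.
    by apply: fz0 => //; exact: le_tr uz.
  rewrite -/(u n.+1) => _ uu' h _; split=> //; apply: le_trans h.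
  by rewrite FS rho_refl// mulr0 subr0.
have Xu n : X (u n) by case: (inv n).
have le_u n m : (n <= m)%N -> le (u n) (u m).
  move=> /subnK <-; elim: (m - n)%N => [|k IH]; first exact: le_refl.
  by rewrite addSn; exact: le_tr IH (step _).1.
have Fu n m : (n <= m)%N -> F n (u n) <= F m (u m).
  move=> /subnK <-; elim: (m - n)%N => [//|k IH].
  by rewrite addSn; exact: le_trans IH (step _).2.
have Fdec n m z : X z -> (n <= m)%N -> F m z <= F n z.
  move=> Xz /subnK <-; elim: (m - n)%N => [//|k IH].
  rewrite addSn FS; apply: le_trans IH.
  by rewrite lerBlDr lerDl mulr_ge0 ?(ltW (hc _))// rho_ge0.
have rho_u n m : (n <= m)%N -> rho (u m) (u n) <= half_pow a n.
  rewrite leq_eqVlt => /orP[/eqP <-|nm]; first by rewrite rho_refl// ltW.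
  have [_ _ _ hF] := inv n; have h1 := hF _ (Xu m) (le_u _ _ (ltnW nm)).
  have h2 := Fu n m (ltnW nm); have h3 := Fdec n.+1 m (u m) (Xu m) nm.
  by rewrite FS in h3; rewrite -(ler_pM2l (hc n)); lra.
have [e e0|z1 [Xz1 uz1 fu ru]] := rho_complete Xu le_u.
  have [N hN] := half_pow_small a0 e0; exists N => n m Nn nm.
  by apply: le_trans (rho_u n m nm) _; exact: hN.
have rho_z1 n : rho z1 (u n) <= a.
  apply/ler_addgt0Pr => e e0; have [N hN] := ru n e e0.
  have h1 := hN _ (leq_maxl N n); have h2 := rho_u _ _ (leq_maxr N n).
  have h3 : half_pow a n <= a.
    by rewrite ler_pdivrMr ?exprn_gt0// ler_peMr ?(ltW a0)// exprn_ege1// ler1n.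
  by have := ler_norm (rho z1 (u n) - rho (u (maxn N n)) (u n)); rewrite distrC; lra.
have Fcont n e : 0 < e -> exists N : nat, forall m, (N <= m)%N ->
    F n (u m) <= F n z1 + e.
  elim: n e => [|n IH] e e0; first exact: fu.
  have [N1 h1] := IH (e / 2) (divr_gt0 e0 (ltr0n R 2)).
  have e1 : 0 < e / (2 * half_pow c n) by rewrite divr_gt0// mulr_gt0.
  have [N2 h2] := ru n _ e1.
  exists (maxn N1 N2) => m; rewrite geq_max => /andP[m1 m2].
  have k1 := h1 m m1; have := h2 m m2.
  rewrite -(ler_pM2l (hc n)).
  have -> : half_pow c n * (e / (2 * half_pow c n)) = e / 2.
    by field; rewrite gt_eqF.
  rewrite -[X in X * `|_|](gtr0_norm (hc n)) -normrM mulrBr !FS.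
  move: (half_pow c n * _) (half_pow c n * _) => x y.
  by rewrite ler_norml; lra.
have Fz1 n m : F m (u m) <= F n z1.
  apply: le_trans (Fdec _ _ _ Xz1 (leq_maxl n m)).
  set k := maxn n m; apply: le_trans (Fu _ _ (leq_maxr n m)) _.
  apply/ler_addgt0Pr => e e0; have [N hN] := Fcont k e e0.
  apply: le_trans (hN _ (leq_maxl N k)).
  apply: le_trans (Fu _ _ (leq_maxr N k)) _.
  exact: Fdec (leq_maxr N k).
have Fseries n z : F n z = f z - series (fun i => half_pow c i * rho z (u i)) n.
  elim: n => [|n IH]; first by rewrite /series /= big_geq// subr0.
  by rewrite FS IH seriesSr opprD addrA.
exists u, z1; split=> //.
- apply: le_trans (Fz1 1%N 0%N) _; rewrite FS lerBlDr lerDl.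
  by rewrite mulr_ge0 ?(ltW (hc 0%N))// rho_ge0.
move=> z Xz z1z.
have lim_facts y : X y -> le z1 y ->
    forall n, f y - limn (series (fun i => half_pow c i * rho y (u i))) <= F n y /\
    (forall b, (forall n, b <= F n y) ->
      b <= f y - limn (series (fun i => half_pow c i * rho y (u i)))).
  move=> Xy z1y n; pose M := 2 * rho y z1 + 2 * a.
  have M0 : 0 <= M by rewrite /M; have := rho_ge0 Xy Xz1; lra.
  have bM i : rho y (u i) <= M.
    apply: le_trans (rho_quasi (Xu i) Xz1 Xy (uz1 i) z1y) _.
    by rewrite lerD2l ler_pM2l.
  have v0 i : 0 <= half_pow c i * rho y (u i).
    by rewrite mulr_ge0 ?(ltW (hc i))// rho_ge0.
  have sM k := weighted_series_le k (ltW c0) M0 bM.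
  have [cv hl _] := nonneg_series_le v0 sM.
  split=> [|b hb]; first by rewrite Fseries lerD2l lerN2.
  rewrite lerBrDr addrC -lerBrDr; apply: limr_le => //; apply: nearW => k.
  by have := hb k; rewrite Fseries; lra.
have lz m : f z - limn (series (fun i => half_pow c i * rho z (u i))) <= F m z.
  exact: (lim_facts z Xz z1z m).1.
apply/ler_addgt0Pr => e e0.
have [N hN] := half_pow_small c0 (divr_gt0 e0 a0).
have [_ _ _ hF] := inv N.
have h1 : F N z <= F N (u N) + e.
  apply: le_trans (hF z Xz (le_tr (uz1 N) z1z)) _; rewrite lerD2l.
  have h3 : half_pow a N <= a.
    by rewrite ler_pdivrMr ?exprn_gt0// ler_peMr ?(ltW a0)// exprn_ege1// ler1n.
  have := hN N (leqnn N); rewrite ler_pdivlMr// => h4.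
  by apply: le_trans h4; rewrite ler_pM2l.
have h2 : F N (u N) <= f z1 - limn (series (fun i => half_pow c i * rho z1 (u i))).
  exact: (lim_facts z1 Xz1 (le_refl Xz1) 0%N).2.
by have := lz N; lra.
Qed.

End VariationalPrinciple.

(** * Test gauges *)

Section SeriesWithLeadingTerm.
Context {R : realType} {V : completeNormedModType R}.
Implicit Types (v : nat -> V) (x : V).

Lemma seriesS_recl v n :
  series v n.+1 = v 0%N + series (fun i => v i.+1) n.
Proof. by rewrite /series /= big_nat_recl. Qed.

Lemma series_shift_cvg v : cvgn (series (fun i => v i.+1)) ->
  series v @ \oo --> v 0%N + limn (series (fun i => v i.+1)).
Proof.
move=> cv; rewrite -(cvg_shiftS (series v)).
under eq_fun do rewrite seriesS_recl.
by apply: cvgD => //; exact: cvg_cst.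
Qed.

Lemma series_leading_bound v (c a : R) : 0 <= c -> 0 <= a ->
  (forall i, `|v i.+1| <= half_pow c i * a) ->
  `|limn (series v) - v 0%N| <= 2 * c * a.
Proof.
move=> c0 a0 hv; pose w i := `|v i.+1|.
have sw n : series w n <= 2 * c * a.
  apply: le_trans (weighted_series_le n c0 a0 (fun=> lexx a)).
  by apply: ler_sum => i _; exact: hv.
have [cw _ lw] := nonneg_series_le (fun i => normr_ge0 (v i.+1)) sw.
have cn : cvgn [normed series (fun i => v i.+1)] by [].
have cv := normed_cvg cn.
rewrite (cvg_lim _ (series_shift_cvg cv))// addrC addKr.
exact: le_trans (lim_series_norm cn) lw.
Qed.

End SeriesWithLeadingTerm.

Section TestGauges.
Context {R : realType} {H : completeNormedModType R}.
Variables (S : R -> {linear H -> H}) (T : R).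
Hypothesis hS : contraction_semigroup S.
Hypothesis T0 : 0 < T.
Implicit Types (g d k : Hpath H) (r s t e : R).

Lemma C0_sum X (v : nat -> Hpath H -> R) n : (forall i, C0_on T S X (v i)) ->
  C0_on T S X (fun g => \sum_(0 <= i < n) v i g).
Proof.
move=> hv; elim: n => [|n IH].
  apply: (@C0_eq R H S T X (fun=> 0)); last exact: C0_cst.
  by move=> g _; rewrite big_geq.
apply: (@C0_eq R H S T X (fun g => \sum_(0 <= i < n) v i g + v n g)).
  by move=> g _; rewrite big_nat_recr.
exact: C0_add.
Qed.

(** The tail of the series is uniformly small near g, as the terms are locally
    bounded by a common constant. *)
Lemma C0_series (X : set (Hpath H)) (c : R) (v : nat -> Hpath H -> R) :
  0 < c -> (forall i, C0_on T S X (v i)) ->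
  (forall g, X g -> exists M, exists2 r, 0 < r & forall d, X d ->
     dinf T S g d < r -> forall i, 0 <= v i d <= M) ->
  (forall g, X g -> dinf T S g g = 0) ->
  C0_on T S X (fun g => limn (series (fun i => half_pow c i * v i g))).
Proof.
move=> c0 hv hM hrefl g Xg e e0; have [M [r r0 hr]] := hM g Xg.
have gg : dinf T S g g < r by rewrite hrefl.
have M0 : 0 <= M by have /andP[h] := hr g Xg gg 0%N; exact: le_trans.
have e1 : 0 < e / (8 * (M + 1)) by rewrite divr_gt0// mulr_gt0//; lra.
have [N hN] := half_pow_small c0 e1; have {}hN := hN N (leqnn N).
have tailM : half_pow c N * M <= e / 8.
  apply: (@le_trans _ _ (e / (8 * (M + 1)) * M)); first exact: ler_wpM2r.
  have -> : e / (8 * (M + 1)) * M = e / 8 * (M / (M + 1)).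
    by field; rewrite gt_eqF//; lra.
  by rewrite ler_piMr ?divr_ge0// ?(ltW e0)// ler_pdivrMr; lra.
have bnd d : X d -> dinf T S g d < r ->
    series (fun i => half_pow c i * v i d) N <=
      limn (series (fun i => half_pow c i * v i d)) <=
    series (fun i => half_pow c i * v i d) N + e / 4.
  move=> Xd gd; have vd i := hr d Xd gd i.
  have v0 i : 0 <= half_pow c i * v i d.
    have /andP[h _] := vd i.
    by rewrite mulr_ge0 ?(ltW (half_pow_gt0 _ c0)).
  have sM n : series (fun i => half_pow c i * v i d) n <=
      series (fun i => half_pow c i * v i d) N + e / 4.
    have [nN|/ltnW Nn] := leqP n N.
      apply: (@le_trans _ _ (series (fun i => half_pow c i * v i d) N)).
        by apply: nondecreasing_series => // i _ _; exact: v0.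
      by rewrite lerDl; lra.
    rewrite /series /= (big_cat_nat (leq0n N) Nn) /= lerD2l.
    apply: (@le_trans _ _ (\sum_(N <= i < n) half_pow c i * M)).
      apply: ler_sum => i _; have /andP[_ h] := vd i.
      by rewrite ler_wpM2l ?(ltW (half_pow_gt0 _ c0)).
    rewrite -mulr_suml.
    have : \sum_(0 <= i < n) half_pow c i = 2 * c - 2 * half_pow c n.
      exact: half_pow_sum.
    rewrite (big_cat_nat (leq0n N) Nn) /= half_pow_sum => h.
    have -> : \sum_(N <= i < n) half_pow c i = 2 * half_pow c N - 2 * half_pow c n.
      by move: h; set s := \sum_(N <= i < n) _; lra.
    rewrite mulrBl -mulrA lerBlDr.
    have : 0 <= 2 * half_pow c n * M.
      by rewrite !mulr_ge0// ltW// half_pow_gt0.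
    lra.
  have [_ h1 h2] := nonneg_series_le v0 sM.
  by rewrite h1 h2.
have hs : C0_on T S X (fun g => \sum_(0 <= i < N) half_pow c i * v i g).
  by apply: C0_sum => i; apply: C0_mul => //; exact: C0_cst.
have [b b0 hb] := hs g Xg (e / 4) (divr_gt0 e0 (ltr0n R 4)).
exists (Num.min r b); first by rewrite lt_min r0.
move=> d Xd; rewrite lt_min => /andP[dr db].
have /andP[h1 h2] := bnd d Xd dr.
have /andP[k1 k2] : series (fun i => half_pow c i * v i g) N <=
      limn (series (fun i => half_pow c i * v i g)) <=
    series (fun i => half_pow c i * v i g) N + e / 4.
  by apply: bnd => //; rewrite hrefl.
have := hb d Xd db; move: h1 h2 k1 k2; rewrite /series /=.
set x := limn _; set y := limn _; set p := \sum_(0 <= k < N) _.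
set q := \sum_(0 <= k < N) _.
by rewrite !ltr_norml; lra.
Qed.

Lemma dinf_refl g : dinf T S g g = 0.
Proof. by rewrite /dinf -/(pdist S T g g) pdistxx// subrr normr0 addr0. Qed.

Lemma pdist_le_norm0 g d : continuous_path g -> continuous_path d ->
  ptime g <= T -> ptime d <= T -> pdist S T g d <= norm0 g + norm0 d.
Proof.
move=> hg hd gT dT; rewrite -(norm0_flow hS hg gT) -(norm0_flow hS hd dT).
apply: pdist_le => // r _; apply: le_trans (ler_normB _ _) _.
by apply: lerD; apply: le_norm0; exact: cpath_horizon.
Qed.

Lemma C0_gauge_series t (c N : R) (u : nat -> Hpath H) : 0 < c -> t <= T ->
  (forall i, [/\ continuous_path (u i), ptime (u i) <= t & norm0 (u i) <= N]) ->
  C0_on T S (past T t) (fun g => limn (series (fun i => half_pow c i * gauge S g (u i)))).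
Proof.
move=> c0 tT hu; apply: C0_series => //.
- by move=> i; have [ui uit _] := hu i; exact: C0_gauge.
- move=> g [hg /andP[tg gT]].
  have N0 : 0 <= N by have [ui _ h] := hu 0%N; apply: le_trans h; exact: norm0_ge0.
  exists (2 * (norm0 g + 1 + N) ^+ 2 + T ^+ 2), 1 => // d [hd /andP[td dT]] gd i.
  have [ui uit uiN] := hu i; rewrite gauge_ge0//=.
  have uid := le_trans uit td; have uiT := le_trans uit tT.
  apply: le_trans (gauge_upper hS T0 hd ui uid dT) _.
  have [ti0 _ _] := ui.
  have h1 := pdist_le_norm0 hd ui dT uiT.
  have h2 := norm0_pdist hS T0 hd hg dT gT.
  have h3 : pdist S T d g < 1.
    rewrite (pdistC hS T0 hd hg); apply: le_lt_trans gd.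
    by rewrite /dinf -/(pdist S T g d) lerDr.
  have h4 : 0 <= pdist S T d (u i) by exact: pdist_ge0.
  have h5 : pdist S T d (u i) ^+ 2 <= (norm0 g + 1 + N) ^+ 2.
    by rewrite lerXn2r ?nnegrE//; lra.
  have h6 : `|ptime d - ptime (u i)| ^+ 2 <= T ^+ 2.
    by rewrite lerXn2r ?nnegrE ?(ltW T0)// ger0_norm ?subr_ge0//; lra.
  lra.
- by move=> g _; exact: dinf_refl.
Qed.

Lemma gauge_series_cvg t g (c N : R) (u : nat -> Hpath H) : 0 < c -> past T t g ->
  (forall i, [/\ continuous_path (u i), ptime (u i) <= t & norm0 (u i) <= N]) ->
  cvgn (series (fun i => half_pow c i * gauge S g (u i))).
Proof.
move=> c0 [hg /andP[tg gT]] hu.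
have hpos i : 0 <= half_pow c i * gauge S g (u i).
  have [ui _ _] := hu i.
  by rewrite mulr_ge0 ?(ltW (half_pow_gt0 _ c0))// gauge_ge0.
pose M := 2 * (norm0 g + `|N|) ^+ 2 + T ^+ 2.
have M0 : 0 <= M by rewrite addr_ge0 ?sqr_ge0// mulr_ge0 ?sqr_ge0.
have hM i : gauge S g (u i) <= M.
  have [ui uit uiN] := hu i; have uid := le_trans uit tg.
  have [ti0 _ _] := ui.
  apply: le_trans (gauge_upper hS T0 hg ui uid gT) _.
  have h1 := pdist_le_norm0 hg ui gT (le_trans uid gT).
  have h4 : 0 <= pdist S T g (u i) by exact: pdist_ge0.
  have h2 := ler_norm N.
  have h5 : pdist S T g (u i) ^+ 2 <= (norm0 g + `|N|) ^+ 2.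
    by rewrite lerXn2r ?nnegrE//; lra.
  have h6 : `|ptime g - ptime (u i)| ^+ 2 <= T ^+ 2.
    by rewrite lerXn2r ?nnegrE ?(ltW T0)// ger0_norm ?subr_ge0//; lra.
  by rewrite /M; lra.
by have [cv _ _] := nonneg_series_le hpos (fun n => weighted_series_le n (ltW c0) M0 hM).
Qed.

End TestGauges.

Section TestFunctional.
Context {R : realType} {H : completeNormedModType R}.
Variables (ip : {dot H for (@idfun R)}) (S : R -> {linear H -> H}) (T : R).
Hypothesis ipH : hilbert_product ip.
Hypothesis hS : contraction_semigroup S.
Hypothesis T0 : 0 < T.
Implicit Types (g d k z : Hpath H) (r s t e a : R).

Variables (w w' Q Q' : R -> R) (b c : R) (xi : Hpath H) (u : nat -> Hpath H).
Hypothesis dw : forall t, is_derive t 1 w (w' t).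
Hypothesis dQ : forall t, is_derive t 1 Q (Q' t).
Hypothesis cw' : continuous w'.
Hypothesis cQ' : continuous Q'.
Hypothesis w_ge0 : forall t, 0 <= w t.
Hypothesis b0 : 0 < b.
Hypothesis c0 : 0 < c.

(** The centre xi is stored in front of the sequence of centres coming from the
    variational principle. *)
Definition test_rep : @gauge_rep R H := {|
  gh := fun t x => w t * (1 + x) + Q t ;
  ght := fun t x => w' t * (1 + x) + Q' t ;
  ghx := fun t _ => w t ;
  gdelta := fun i => if i is j.+1 then half_pow c j else b ;
  gpath := fun i => if i is j.+1 then u j else xi |}.

Lemma is_derive_continuous (f f' : R -> R) :
  (forall t, is_derive t 1 f (f' t)) -> continuous f.
Proof.
move=> hf t; apply: differentiable_continuous; apply/derivable1_diffP.
by have [] := hf t.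
Qed.

Lemma is_derive_slope (f : R -> R) t l : is_derive t (1 : R) f l ->
  (f r - f t) / (r - t) @[r --> within `[0, T] t^'] --> l.
Proof.
move=> [df <-]; move/cvgrPdist_le : df => hf.
apply/cvgrPdist_le => e e0; have [d /= d0 hd] := hf e e0.
exists d => // r /= rt rn _; have := hd (r - t).
rewrite /ball /= sub0r normrN distrC => /(_ rt).
rewrite subr_eq0 => /(_ rn); apply: le_trans.
by rewrite /GRing.scale/= mulr1 subrK mulrC.
Qed.

Lemma test_C1_strip : C1_strip T (gh test_rep) (ght test_rep) (ghx test_rep).
Proof.
have cw := is_derive_continuous dw.
split=> /= [t x _|t x _||].
- have -> : w' t * (1 + x) + Q' t = (1 + x) * w' t + Q' t by rewrite mulrC.
  apply: is_derive_slope.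
  have -> : (fun r => w r * (1 + x) + Q r) = (fun r => (1 + x) * w r) \+ Q.
    by apply/funext => r /=; rewrite mulrC.
  have h1 := dw t; have h2 := dQ t.
  by apply: is_deriveD; apply: is_derive_eq; rewrite /GRing.scale/= scaler0 add0r.
- have -> : (fun y => w t * (1 + y) + Q t) = (fun y => w t * y + (w t + Q t)).
    by apply/funext => y; ring.
  by apply: is_derive_eq; rewrite /GRing.scale/=; ring.
- apply: continuous_subspaceT => z.
  apply: cvgD; last by apply: continuous_comp; [exact: cvg_fst|exact: cQ'].
  apply: cvgM; first by apply: continuous_comp; [exact: cvg_fst|exact: cw'].
  by apply: cvgD; [exact: cvg_cst|exact: cvg_snd].
- apply: continuous_subspaceT => z.
  by apply: continuous_comp; [exact: cvg_fst|exact: cw].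
Qed.

Variables (t1 N : R).
Hypothesis t1_itv : 0 <= t1 <= T.
Hypothesis xi_path : continuous_path xi.
Hypothesis xi_time : ptime xi <= t1.
Hypothesis u_path : forall i,
  [/\ continuous_path (u i), ptime (u i) <= t1 & norm0 (u i) <= N].

Lemma test_series g : past T t1 g ->
  limn (series (fun i => gdelta test_rep i *
    (Upsilon2 (psub g (flow S (gpath test_rep i) (ptime g)))
     + `|ptime g - ptime (gpath test_rep i)| ^+ 2))) =
  b * gauge S g xi + limn (series (fun i => half_pow c i * gauge S g (u i))).
Proof.
move=> hg; have cv := gauge_series_cvg hS T0 c0 hg u_path.
exact: cvg_lim (series_shift_cvg (v := fun i => gdelta test_rep i *
    gauge S g (gpath test_rep i)) cv).
Qed.

Lemma test_value g : past T t1 g ->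
  gauge_value S test_rep g = w (ptime g) * (1 + Upsilon2 g) + Q (ptime g) +
  (b * gauge S g xi + limn (series (fun i => half_pow c i * gauge S g (u i)))).
Proof. by move=> hg; rewrite /gauge_value test_series. Qed.

Lemma test_class : gauge_class T S t1 (gauge_value S test_rep) test_rep.
Proof.
have /andP[t10 t1T] := t1_itv.
split.
- move=> g /Lambda_fromP hg; apply: (C0_subset (X := past T t1)).
  + by move=> d /Lambda_fromP.
  + apply: C0_eq (fun d hd => esym (test_value hd)) _.
    apply: C0_add; last apply: C0_add; first apply: C0_add.
    * apply: C0_mul.
        apply: C0_comp; last exact: C0_ptime.
        exact: is_derive_continuous dw.
      by apply: C0_add; [exact: C0_cst|exact: C0_Upsilon2].
    * apply: C0_comp; last exact: C0_ptime.
      exact: is_derive_continuous dQ.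
    * by apply: C0_mul; [exact: C0_cst|exact: C0_gauge].
    * exact: C0_gauge_series.
  + exact/Lambda_fromP.
- exact: test_C1_strip.
- by move=> s x _ /=; exact: w_ge0.
- have bp := b0; have cp := c0.
  exists (`|N| + norm0 xi + b + 2 * c).
    by have := normr_ge0 N; have := norm0_ge0 xi_path; lra.
  have xi0 := norm0_ge0 xi_path; have N0 := normr_ge0 N; have NN := ler_norm N.
  split=> [[|i] /=|].
  + split=> //; lra.
  + by have [? ? ?] := u_path i; split=> //; [exact: half_pow_gt0|lra].
  + apply: lime_le; first by apply: is_cvg_nneseries => -[|i] _ _;
      rewrite lee_fin ltW//= half_pow_gt0.
    apply: nearW => n; rewrite sumEFin lee_fin.
    case: n => [|n]; first by rewrite big_geq//; lra.
    rewrite big_nat_recl//= half_pow_sum.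
    by have := half_pow_gt0 n c0; lra.
- by [].
Qed.

Lemma test_dt z a : past T t1 z -> 0 <= a ->
  (forall i, `|ptime z - ptime (u i)| <= a) ->
  `|gauge_dt test_rep z - (w' (ptime z) * (1 + Upsilon2 z) + Q' (ptime z)
     + 2 * (b * (ptime z - ptime xi)))| <= 4 * c * a.
Proof.
move=> hz a0 ha; rewrite /gauge_dt /=.
pose v i := gdelta test_rep i * (ptime z - ptime (gpath test_rep i)).
have := @series_leading_bound R R v c a (ltW c0) a0.
rewrite -/v opprD addrACA subrr add0r -mulrBr normrM ger0_norm// => h.
have -> : 4 * c * a = 2 * (2 * c * a) by ring.
rewrite ler_pM2l//; apply: h => i; rewrite /v /= normrM.
by rewrite gtr0_norm ?half_pow_gt0// ler_wpM2l// ltW// half_pow_gt0.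
Qed.

Lemma test_dx z a : past T t1 z -> 0 <= a ->
  (forall i, pdist S T z (u i) <= a) ->
  `|gauge_dx ip S test_rep z -
    (w (ptime z) *: upsgrad (norm0 z) (z (ptime z)) +
     b *: upsgrad (pdist S T z xi)
       (flow S z T (ptime z) - flow S xi T (ptime z)))| <= 8 * c * a.
Proof.
move=> [hz /andP[tz zT]] a0 ha.
pose v i := gdelta test_rep i *:
  dx ip (@Upsilon2 R H) (pgap S z (gpath test_rep i)).
have grad d : continuous_path d -> ptime d <= t1 ->
    dx ip (@Upsilon2 R H) (pgap S z d) = upsgrad (pdist S T z d)
       (flow S z T (ptime z) - flow S d T (ptime z)).
  move=> hd dt; have dz := le_trans dt tz.
  rewrite dx_Upsilon2//; last exact: cpath_pgap.
  by rewrite (norm0_pgap hS hz hd dz zT) (pgap_end hS hz hd dz zT).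
set X := w _ *: _; set B := b *: _.
have v0 : v 0%N = B by rewrite /v /= grad.
have -> : gauge_dx ip S test_rep z - (X + B) = limn (series v) - v 0%N.
  rewrite v0 /gauge_dx (dx_Upsilon2 ipH hz).
  change (X + limn (series v) - (X + B) = limn (series v) - B).
  by rewrite opprD addrACA subrr add0r.
have -> : 8 * c * a = 2 * c * (4 * a) by ring.
apply: series_leading_bound; rewrite ?(ltW c0) ?mulr_ge0// => i.
have [ui uit _] := u_path i.
have -> : v i.+1 = half_pow c i *: upsgrad (pdist S T z (u i))
       (flow S z T (ptime z) - flow S (u i) T (ptime z)) by rewrite /v /= grad.
rewrite normrZ gtr0_norm ?half_pow_gt0//.
rewrite ler_wpM2l ?(ltW (half_pow_gt0 _ c0))//.
have h := le_pdist hS T0 (ptime z) hz ui.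
by apply: le_trans (upsgrad_norm h) _; rewrite ler_pM2l// (le_trans h).
Qed.

End TestFunctional.

(** * Viscosity inequalities for test gauges *)

Section ZeroTestFunction.
Context {R : realType} {H : completeNormedModType R}.
Variables (ip : {dot H for (@idfun R)}) (T : R).
Variables (DA : set H) (A : H -> H) (S : R -> {linear H -> H}).
Variables (U : metricType R) (F : Hpath H -> U -> H) (q : Hpath H -> U -> R).
Variable phi : Hpath H -> R.
Hypothesis ipH : hilbert_product ip.
Hypothesis hS : contraction_semigroup S.
Hypothesis hA : generates DA A S.
Implicit Types (g d z : Hpath H) (W : Hpath H -> R) (t : R).

Lemma dx_cst0 : dx ip (fun=> 0 : R) = (fun=> 0 : H) :> (Hpath H -> H).
Proof.
apply/funext => g; apply: (dx_eq ipH); rewrite /is_dx.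
under eq_fun do rewrite subrr sub0r ip0l oppr0 mul0r.
exact: cvg_cst.
Qed.

Lemma dt_cst0 : dt (fun=> 0 : R) = (fun=> 0 : R) :> (Hpath H -> R).
Proof.
apply/funext => g; apply: xget_unique.
  rewrite /is_dt /=; under eq_fun do rewrite subrr mulr0.
  exact: cvg_cst.
move=> a; rewrite /is_dt /=; under eq_fun do rewrite subrr mulr0.
move=> ha; apply/esym; apply: (cvg_unique _ _ ha) => //; exact: cvg_cst.
Qed.

Lemma Phi_cst0 : Phi ip T DA A S (fun=> 0).
Proof.
have C0c (V : normedZmodType R) X (c : V) : C0_on T S X (fun _ : Hpath H => c).
  by move=> g _ e e0; exists 1 => // d _ _; rewrite subrr normr0.
split; rewrite ?dx_cst0.
- split; rewrite ?dx_cst0 ?dt_cst0; [exact: C0c| | |exact: C0c|exact: C0c].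
    move=> g _; exists 0; rewrite /is_dt; under eq_fun do rewrite subrr mulr0.
    exact: cvg_cst.
  move=> g _; exists 0; rewrite /is_dx.
  under eq_fun do rewrite subrr sub0r ip0l oppr0 mul0r.
  exact: cvg_cst.
- by move=> g _; exact: adjoint_dom0.
- exact: C0c.
Qed.

(** With the zero functional as smooth test, only the gauge enters the
    viscosity inequality. *)
Lemma subsolution_gauge W t (g : Hpath H -> R) D z :
  viscosity_subsolution ip T DA A S F q phi W -> 0 <= t < T ->
  gauge_class T S t g D -> Lambda_at t z -> W z = g z ->
  (forall d, past T t d -> W d <= g d) ->
  0 <= gauge_dt D z + Hamiltonian ip F q z (gauge_dx ip S D z).
Proof.
move=> [_ _ hW] tT hg hz Wz Wd.
have zt : past T t z.
  have [<- hz'] := hz; split=> //; rewrite lexx /=.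
  by have [zt _] := hz; rewrite zt; move: tT => /andP[_ /ltW].
have := hW t (fun=> 0) g D z tT Phi_cst0 hg hz.
rewrite dx_cst0 dt_cst0 (adjoint0 ipH hS hA) ip0l add0r addr0 add0r; apply.
  by rewrite subr0 Wz subrr.
apply/le_anti/andP; split.
  apply: ge_ereal_sup => _ [d /Lambda_fromP hd <-].
  by rewrite lee_fin subr0 subr_le0 Wd.
apply: ereal_sup_ubound; exists z; first exact/Lambda_fromP.
by rewrite subr0 Wz subrr.
Qed.

Lemma supersolution_gauge W t (g : Hpath H -> R) D z :
  viscosity_supersolution ip T DA A S F q phi W -> 0 <= t < T ->
  gauge_class T S t g D -> Lambda_at t z -> W z = - g z ->
  (forall d, past T t d -> - g d <= W d) ->
  - gauge_dt D z + Hamiltonian ip F q z (- gauge_dx ip S D z) <= 0.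
Proof.
move=> [_ _ hW] tT hg hz Wz Wd.
have zt : past T t z.
  have [<- hz'] := hz; split=> //; rewrite lexx /=.
  by have [zt _] := hz; rewrite zt; move: tT => /andP[_ /ltW].
have := hW t (fun=> 0) g D z tT Phi_cst0 hg hz.
rewrite dx_cst0 dt_cst0 (adjoint0 ipH hS hA) ip0l !oppr0 !sub0r !addr0; apply.
  by rewrite Wz addNr.
apply/le_anti/andP; split.
  apply: ereal_inf_lbound; exists z; first exact/Lambda_fromP.
  by rewrite addr0 Wz addNr.
apply: le_ereal_inf_tmp => _ [d /Lambda_fromP hd <-].
by rewrite lee_fin addr0 -lerBlDr sub0r Wd.
Qed.

(** Near minimizers of the second infimum are tested in the first one; the bounds
    on the data make both infima finite. *)
Lemma Hamiltonian_le z1 z2 (p1 p2 : H) (M1 M2 B : R) : [set: U] !=set0 ->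
  (forall u, `|F z1 u| <= M1 /\ `|q z1 u| <= M1) ->
  (forall u, `|F z2 u| <= M2 /\ `|q z2 u| <= M2) ->
  (forall u, ip p1 (F z1 u) + q z1 u <= ip p2 (F z2 u) + q z2 u + B) ->
  Hamiltonian ip F q z1 p1 <= Hamiltonian ip F q z2 p2 + B.
Proof.
move=> [u0 _] hM1 hM2 hB.
have hinf z p M : (forall u, `|F z u| <= M /\ `|q z u| <= M) ->
    has_inf [set ip p (F z u) + q z u | u in [set: U]].
  move=> hM; split; first by exists (ip p (F z u0) + q z u0), u0.
  exists (- (`|p| * M + M)) => _ [u _ <-]; have [h1 h2] := hM u.
  have := norm_ip_le ipH p (F z u).
  have : `|p| * `|F z u| <= `|p| * M by rewrite ler_wpM2l.
  have := ler_norm (- ip p (F z u)); have := ler_norm (- q z u).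
  by rewrite !normrN; lra.
apply/ler_addgt0Pr => e e0.
have [_ [u _ <-] hu] := inf_adherent e0 (hinf z2 p2 M2 hM2).
have [_ lb1] := hinf z1 p1 M1 hM1.
have : Hamiltonian ip F q z1 p1 <= ip p1 (F z1 u) + q z1 u.
  by apply: ge_inf => //; exists u.
by have := hB u; rewrite /Hamiltonian; lra.
Qed.

End ZeroTestFunction.

(** * Doubling of variables *)

Section Doubling.
Context {R : realType} {H : completeNormedModType R}.
Variables (S : R -> {linear H -> H}) (T : R).
Hypothesis hS : contraction_semigroup S.
Hypothesis T0 : 0 < T.
Implicit Types (g d k : Hpath H) (r s t e : R) (W : Hpath H -> R).

Definition regular_functional (K : R) W :=
  [/\ forall g, past T 0 g -> `|W g| <= K * (1 + norm0 g),
      forall g d, past T 0 g -> past T 0 d -> ptime d = ptime g ->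
        `|W g - W d| <= K * pdist S T g d
    & forall g s, past T 0 g -> ptime g <= s <= T ->
        `|W (flow S g s) - W g| <= K * (1 + 2 * norm0 g) * (s - ptime g)].

Lemma past_flow t g s : past T t g -> ptime g <= s <= T -> past T t (flow S g s).
Proof.
move=> [hg /andP[tg gT]] /andP[gs sT]; have [t0 _ _] := hg.
split; first by apply: cpath_flow => //; exact: le_trans gs.
by rewrite /= sT andbT (le_trans tg).
Qed.

Variables (K : R) (W1 W2 : Hpath H -> R).
Hypothesis K0 : 0 < K.
Hypothesis regW1 : regular_functional K W1.
Hypothesis regW2 : regular_functional K W2.

Variables (alpha kappa beta : R).
Hypothesis alpha0 : 0 < alpha.
Hypothesis kappa0 : 0 < kappa.
Hypothesis beta0 : 0 < beta.

Definition discount t := alpha * expR (kappa * (T - t)).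
Definition penalty g := discount (ptime g) * (1 + Upsilon2 g).

Lemma discount_ge t : t <= T -> alpha <= discount t.
Proof.
move=> tT; rewrite /discount ler_peMr ?(ltW alpha0)// -expR0 ler_expR.
by rewrite mulr_ge0 ?(ltW kappa0)// subr_ge0.
Qed.

Lemma discount_gt0 t : 0 < discount t.
Proof. by rewrite /discount mulr_gt0// expR_gt0. Qed.

Lemma discount_le s t : s <= t -> discount t <= discount s.
Proof.
move=> st; rewrite /discount ler_pM2l// ler_expR ler_pM2l//; lra.
Qed.

Lemma Upsilon2_lower g : continuous_path g -> norm0 g ^+ 2 <= Upsilon2 g.
Proof. by move=> hg; rewrite Upsilon2E// ups_ge. Qed.

Lemma Upsilon2_upper g : continuous_path g -> Upsilon2 g <= 2 * norm0 g ^+ 2.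
Proof. by move=> hg; rewrite Upsilon2E// ups_le// normr_ge0 le_norm0. Qed.

Lemma penalty_lower g : past T 0 g -> alpha * (1 + norm0 g ^+ 2) <= penalty g.
Proof.
move=> [hg /andP[_ gT]]; have h := Upsilon2_lower hg; have := sqr_ge0 (norm0 g).
by move=> h'; apply: ler_pM; rewrite ?(ltW alpha0) ?discount_ge//; lra.
Qed.

Lemma penalty_upper g : past T 0 g ->
  penalty g <= alpha * expR (kappa * T) * (1 + 2 * norm0 g ^+ 2).
Proof.
move=> [hg /andP[tg gT]]; have h := Upsilon2_upper hg; have h' := Upsilon2_lower hg.
have k := sqr_ge0 (norm0 g).
apply: ler_pM; rewrite ?(ltW (discount_gt0 _))//; try lra.
by rewrite -[leRHS]/(alpha * expR (kappa * T)) /discount ler_pM2l// ler_expR ler_pM2l//; lra.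
Qed.

Lemma penalty_flow g s : past T 0 g -> ptime g <= s <= T ->
  penalty (flow S g s) <= penalty g.
Proof.
move=> [hg _] /andP[gs _]; have [t0 _ _] := hg.
have hf : continuous_path (flow S g s) by apply: cpath_flow => //; exact: le_trans gs.
apply: ler_pM; rewrite ?(ltW (discount_gt0 _)) ?discount_le//.
  by have := Upsilon2_lower hf; have := sqr_ge0 (norm0 (flow S g s)); lra.
by rewrite lerD2l Upsilon2_flow.
Qed.

Lemma penalty_C0 t : 0 <= t -> C0_on T S (past T t) penalty.
Proof.
move=> t0; apply: C0_mul.
  apply: (C0_comp (c := discount)); last exact: C0_ptime.
  move=> r; apply: cvgM; first exact: cvg_cst.
  apply: continuous_comp; last exact: continuous_expR.
  by apply: cvgM; [exact: cvg_cst | apply: cvgB; [exact: cvg_cst | exact: cvg_id]].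
by apply: C0_add; [exact: C0_cst | exact: C0_Upsilon2].
Qed.

(** Pairs at which the penalized difference is nonnegative stay in the ball of
    this radius ([penalized_radius]). *)
Definition radius := 1 + 4 * (K / alpha) + 2 * (K / alpha) ^+ 2.

Lemma radius_ge1 : 1 <= radius.
Proof.
have : 0 <= K / alpha by rewrite divr_ge0// ltW.
by rewrite /radius => h; have := sqr_ge0 (K / alpha); lra.
Qed.

(** Half of the quadratic penalty absorbs the linear growth of W1 and W2. *)
Lemma penalized_bound g d : past T 0 g -> past T 0 d ->
  W1 g - W2 d - penalty g - penalty d <=
    2 * K - alpha / 2 * (norm0 g ^+ 2 + norm0 d ^+ 2) + K * (K / alpha).
Proof.
move=> hg hd; have [h1 _ _] := regW1; have [h2 _ _] := regW2.
have := h1 g hg; have := h2 d hd; rewrite !ler_norml => /andP[b1 b2] /andP[b3 b4].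
have p1 := penalty_lower hg; have p2 := penalty_lower hd.
set m := norm0 g in p1 b3 b4 *; set n := norm0 d in p2 b1 b2 *.
set x := K / alpha; have xK : K = x * alpha by rewrite /x divfK// gt_eqF.
have q1 : 0 <= alpha * (m - x) ^+ 2 by rewrite mulr_ge0 ?(ltW alpha0)// sqr_ge0.
have q2 : 0 <= alpha * (n - x) ^+ 2 by rewrite mulr_ge0 ?(ltW alpha0)// sqr_ge0.
have e1 : alpha * (m - x) ^+ 2 = alpha * m ^+ 2 - 2 * (K * m) + K * x.
  by rewrite xK; ring.
have e2 : alpha * (n - x) ^+ 2 = alpha * n ^+ 2 - 2 * (K * n) + K * x.
  by rewrite xK; ring.
have := alpha0; lra.
Qed.

Lemma penalized_radius g d : past T 0 g -> past T 0 d ->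
  0 <= W1 g - W2 d - penalty g - penalty d ->
  norm0 g <= radius /\ norm0 d <= radius.
Proof.
move=> hg hd h0; have := penalized_bound hg hd; have r1 := radius_ge1.
set m := norm0 g; set n := norm0 d => h.
have h1 : m ^+ 2 + n ^+ 2 <= 4 * (K / alpha) + 2 * (K / alpha) ^+ 2.
  rewrite -(ler_pM2l alpha0).
  have -> : alpha * (4 * (K / alpha) + 2 * (K / alpha) ^+ 2) =
     4 * K + 2 * (K * (K / alpha)) by field; rewrite gt_eqF.
  lra.
have := sqr_ge0 (m - 1); have := sqr_ge0 (n - 1).
have := sqr_ge0 m; have := sqr_ge0 n; rewrite /radius in r1 *.
by split; nra.
Qed.

Definition same_time g d := [/\ past T 0 g, past T 0 d & ptime d = ptime g].

Definition Psi g d :=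
  W1 g - W2 d - beta * Upsilon2 (pgap S g d) - penalty g - penalty d.

Lemma Psi_le g d : same_time g d -> Psi g d <= W1 g - W2 d - penalty g - penalty d.
Proof.
move=> [[hg _] [hd _] dg]; rewrite /Psi.
have : 0 <= beta * Upsilon2 (pgap S g d).
  rewrite mulr_ge0 ?(ltW beta0)// Upsilon2E ?ups_ge0//; exact: cpath_pgap.
lra.
Qed.

Lemma Psi_near_max e : 0 < e -> exists g d, same_time g d /\
  forall g' d', same_time g' d' -> Psi g' d' <= Psi g d + e.
Proof.
move=> e0; pose A := [set Psi p.1 p.2 | p in [set p | same_time p.1 p.2]].
have null_st : same_time null_path (null_path : Hpath H).
  have h : past T 0 (null_path : Hpath H).
    by split; [exact: cpath_null | rewrite /= lexx ltW].
  by split.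
have hA : has_sup A.
  split; first by exists (Psi null_path null_path), (null_path, null_path).
  exists (2 * K + K * (K / alpha)) => _ [[g d] /= hgd <-].
  apply: le_trans (Psi_le hgd) _; have [hg hd _] := hgd.
  apply: le_trans (penalized_bound hg hd) _.
  have : 0 <= alpha / 2 * (norm0 g ^+ 2 + norm0 d ^+ 2).
    by rewrite mulr_ge0 ?addr_ge0 ?sqr_ge0// divr_ge0// ltW.
  lra.
have [_ [[g d] /= hgd <-] h] := sup_adherent e0 hA.
exists g, d; split=> // g' d' h'.
have : Psi g' d' <= sup A by apply: ub_le_sup; [case: hA | exists (g', d')].
lra.
Qed.

Lemma Psi_diag g : past T 0 g -> Psi g g = W1 g - W2 g - 2 * penalty g.
Proof.
move=> [hg /andP[_ gT]]; rewrite /Psi (Upsilon2_pgap hS hg hg (lexx _) gT).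
by rewrite pdistxx// subrr normr0 ups_diag expr0n /= !mulr0; ring.
Qed.

Lemma pdist_sqr_le g d : same_time g d -> pdist S T g d ^+ 2 <= Upsilon2 (pgap S g d).
Proof.
move=> [[hg /andP[_ gT]] [hd _] dg].
have dg' : ptime d <= ptime g by rewrite dg.
by rewrite (Upsilon2_pgap hS hg hd dg' gT) ups_ge.
Qed.

(** On the diagonal pairs (g, g) and (d, d) the gauge of the difference vanishes,
    and in the sum of both comparisons the penalties cancel. *)
Lemma Psi_near_max_close g d e : same_time g d ->
  (forall g' d', same_time g' d' -> Psi g' d' <= Psi g d + e) ->
  beta * pdist S T g d ^+ 2 <= K * pdist S T g d + e.
Proof.
move=> hgd hmax; have [hg hd dg] := hgd.
have h1 := hmax g g (And3 hg hg erefl); have h2 := hmax d d (And3 hd hd erefl).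
rewrite Psi_diag// in h1; rewrite Psi_diag// in h2.
have [_ l1 _] := regW1; have [_ l2 _] := regW2.
have := l1 g d hg hd dg; have := l2 g d hg hd dg.
rewrite !ler_norml => /andP[a1 a2] /andP[a3 a4].
have h3 : beta * pdist S T g d ^+ 2 <= beta * Upsilon2 (pgap S g d).
  by rewrite ler_pM2l// pdist_sqr_le.
rewrite /Psi in h1 h2; lra.
Qed.

(** The Lipschitz bound K x - beta x^2 in the distance x is at most
    K^2/(4 beta). *)
Lemma Psi_terminal g d : same_time g d -> (W1 g <= W2 g) ->
  Psi g d <= K ^+ 2 / (4 * beta).
Proof.
move=> hgd h; have [hg hd dg] := hgd.
have [_ l2 _] := regW2; have := l2 g d hg hd dg.
rewrite ler_norml => /andP[a1 a2].
have h3 : beta * pdist S T g d ^+ 2 <= beta * Upsilon2 (pgap S g d).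
  by rewrite ler_pM2l// pdist_sqr_le.
have p1 := penalty_lower hg; have p2 := penalty_lower hd.
have p3 : 0 <= alpha * (1 + norm0 g ^+ 2).
  by rewrite mulr_ge0 ?(ltW alpha0)// addr_ge0// sqr_ge0.
have p4 : 0 <= alpha * (1 + norm0 d ^+ 2).
  by rewrite mulr_ge0 ?(ltW alpha0)// addr_ge0// sqr_ge0.
set x := pdist S T g d in a1 a2 h3.
have : 0 <= beta * (x - K / (2 * beta)) ^+ 2.
  by rewrite mulr_ge0 ?(ltW beta0)// sqr_ge0.
have -> : beta * (x - K / (2 * beta)) ^+ 2 =
  beta * x ^+ 2 - K * x + K ^+ 2 / (4 * beta) by field; rewrite gt_eqF.
rewrite /Psi; lra.
Qed.

Definition Theta (xi : Hpath H) theta g d :=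
  W1 g - W2 d - 2 * beta * Upsilon2 (pgap S g xi) - 2 * beta * Upsilon2 (pgap S d xi)
  - penalty g - penalty d - (ptime g - ptime d) ^+ 2 / theta.

Lemma Theta_le xi theta g d : 0 < theta -> continuous_path xi ->
  past T (ptime xi) g -> past T (ptime xi) d ->
  Theta xi theta g d <= W1 g - W2 d - penalty g - penalty d.
Proof.
move=> th0 hxi [hg _] [hd _]; rewrite /Theta.
have u0 k : continuous_path k -> 0 <= 2 * beta * Upsilon2 (pgap S k xi).
  move=> hk; rewrite mulr_ge0 ?mulr_ge0 ?(ltW beta0)// Upsilon2E ?ups_ge0//.
  exact: cpath_pgap.
have := u0 g hg; have := u0 d hd.
have : 0 <= (ptime g - ptime d) ^+ 2 / theta by rewrite divr_ge0 ?sqr_ge0// ltW.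
lra.
Qed.

(** Extending the earlier path decreases its gauges and its penalty, so only the
    time regularity of W1 and W2 is paid for; the midpoint inequality for the
    gauge turns the two centred gauges into that of the difference. *)
Lemma Theta_le_Psi xi theta g d s : 0 < theta -> continuous_path xi ->
  past T (ptime xi) g -> past T (ptime xi) d ->
  norm0 g <= radius -> norm0 d <= radius -> s = Num.max (ptime g) (ptime d) ->
  same_time (flow S g s) (flow S d s) /\
  Theta xi theta g d + (ptime g - ptime d) ^+ 2 / theta <=
    Psi (flow S g s) (flow S d s)
    + K * (1 + 2 * radius) * `|ptime g - ptime d|.
Proof.
move=> th0 hxi [hg /andP[xg gT]] [hd /andP[xd dT]] gr dr sE.
have [tg0 _ _] := hg; have [td0 _ _] := hd.
have gs : ptime g <= s by rewrite sE le_max lexx.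
have ds : ptime d <= s by rewrite sE le_max lexx orbT.
have sT : s <= T by rewrite sE ge_max gT.
have s0 := le_trans tg0 gs.
have pg : past T 0 g by split => //; rewrite tg0.
have pd : past T 0 d by split => //; rewrite td0.
have gsT : ptime g <= s <= T by rewrite gs.
have dsT : ptime d <= s <= T by rewrite ds.
have hst : same_time (flow S g s) (flow S d s) by split => //; exact: past_flow.
split=> //.
have [_ _ e1] := regW1; have [_ _ e2] := regW2.
have := e1 g s pg gsT; have := e2 d s pd dsT.
rewrite !ler_norml => /andP[a1 a2] /andP[a3 a4].
have tau : (s - ptime g) + (s - ptime d) = `|ptime g - ptime d|.
  rewrite sE; case: (leP (ptime g) (ptime d)) => h.
    by rewrite ler0_norm ?subr_le0//; ring.
  by rewrite gtr0_norm ?subr_gt0//; ring.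
have r1 := radius_ge1.
have c1 : K * (1 + 2 * norm0 g) * (s - ptime g) <=
    K * (1 + 2 * radius) * (s - ptime g).
  by rewrite ler_wpM2r ?subr_ge0// ler_pM2l//; lra.
have c2 : K * (1 + 2 * norm0 d) * (s - ptime d) <=
    K * (1 + 2 * radius) * (s - ptime d).
  by rewrite ler_wpM2r ?subr_ge0// ler_pM2l//; lra.
have p1 := penalty_flow pg gsT; have p2 := penalty_flow pd dsT.
have hfg : continuous_path (flow S g s) by exact: cpath_flow.
have hfd : continuous_path (flow S d s) by exact: cpath_flow.
have xs := le_trans xg gs.
have u1 := Upsilon2_pgap_flow hS hg hxi xg gs.
have u2 := Upsilon2_pgap_flow hS hd hxi xd ds.
have u3 : Upsilon2 (pgap S (flow S g s) (flow S d s)) <=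
    2 * Upsilon2 (pgap S (flow S g s) xi) + 2 * Upsilon2 (pgap S (flow S d s) xi).
  have h := Upsilon2_pgap_add (g := flow S g s) (d := flow S d s) (k := xi) hS T0
    hfg hfd hxi xs (lexx _) sT (lexx _) (le_pdist hS T0 s hxi hfd).
  apply: (le_trans h); rewrite lerD2l ler_pM2l//.
  by rewrite (Upsilon2_pgap hS hfd hxi xs sT) (pdistC hS T0 hfd hxi) distrC.
have u4 : beta * Upsilon2 (pgap S (flow S g s) (flow S d s)) <=
   2 * beta * Upsilon2 (pgap S g xi) + 2 * beta * Upsilon2 (pgap S d xi).
  apply: le_trans (_ : beta * (2 * Upsilon2 (pgap S g xi) + 2 * Upsilon2 (pgap S d xi)) <= _).
    by rewrite ler_pM2l//; lra.
  by rewrite mulrDr !mulrA (mulrC beta).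
rewrite -tau /Theta /Psi; lra.
Qed.

End Doubling.

Section DoubledMaximum.
Context {R : realType} {H : completeNormedModType R}.
Variables (S : R -> {linear H -> H}) (T : R).
Variable ip : {dot H for (@idfun R)}.
Hypothesis ipH : hilbert_product ip.
Hypothesis hS : contraction_semigroup S.
Hypothesis T0 : 0 < T.
Implicit Types (g d k : Hpath H) (r s t e : R).

Lemma le_of_sqr (x e : R) : 0 <= e -> x ^+ 2 <= e ^+ 2 -> x <= e.
Proof. by move=> e0 h; rewrite leNgt; apply/negP => ex; nra. Qed.

Lemma C0_seq X (f : Hpath H -> R) z (u : nat -> Hpath H) :
  C0_on T S X f -> X z -> (forall n, X (u n)) ->
  (forall e : R, 0 < e -> exists N : nat, forall n, (N <= n)%N -> dinf T S z (u n) < e) ->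
  forall e : R, 0 < e -> exists N : nat, forall n, (N <= n)%N -> `|f (u n) - f z| <= e.
Proof.
move=> hf Xz Xu hu e e0; have [r r0 hr] := hf z Xz e e0.
by have [N hN] := hu r r0; exists N => n /hN h; rewrite ltW// hr.
Qed.

Lemma past_le s t g : s <= t -> past T t g -> past T s g.
Proof. by move=> st [hg /andP[tg gT]]; split=> //; rewrite gT andbT (le_trans st). Qed.

Lemma gauge_cauchy_limit t (u : nat -> Hpath H) :
  (forall n, past T t (u n)) ->
  (forall n m, (n <= m)%N -> ptime (u n) <= ptime (u m)) ->
  (forall e : R, 0 < e -> exists N : nat, forall n m, (N <= n)%N -> (n <= m)%N ->
    gauge S (u m) (u n) <= e) ->
  exists z, [/\ past T t z, forall n, ptime (u n) <= ptime z
    & forall e : R, 0 < e -> exists N : nat, forall n, (N <= n)%N ->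
        dinf T S z (u n) < e].
Proof.
move=> hu uI uC.
have cu n : continuous_path (u n) by have [] := hu n.
have uT n : ptime (u n) <= T by have [_ /andP[]] := hu n.
have [|z [hz zT uz hd]] := path_complete hS T0 cu uT uI.
  move=> e e0; have [N hN] := uC (e ^+ 2) (exprn_gt0 2 e0).
  have le_case n m : (N <= n)%N -> (n <= m)%N -> pdist S T (u m) (u n) <= e.
    move=> Nn nm; have [h _] := gauge_lower hS (cu m) (cu n) (uI _ _ nm) (uT m).
    by apply: le_of_sqr; [exact: ltW | exact: le_trans h (hN n m Nn nm)].
  exists N => n m Nn Nm; have [nm|/ltnW mn] := leqP n m; last exact: le_case.
  by rewrite (pdistC hS T0 (cu n) (cu m)); exact: le_case.
exists z; split=> //; split=> //; rewrite zT andbT.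
by have [_ /andP[h _]] := hu 0%N; exact: le_trans (uz 0%N).
Qed.

(** Gauges centred at the midpoint split the gauge of the difference without
    loss ([Upsilon2_midpoint]). *)
Definition midpoint g d : Hpath H :=
  Path (ptime g) (fun r => 2^-1 *: (g r + d r)).

Lemma cpath_midpoint g d : continuous_path g -> continuous_path d ->
  ptime d = ptime g -> continuous_path (midpoint g d).
Proof.
move=> hg hd dg; have [t0 sg _] := hg; have [_ sd _] := hd.
apply: cpathI => //= [r|r e e0] /=; first by rewrite -sg -dg -sd.
have [a a0 ha] := cpath_eps hg r e0; have [b b0 hb] := cpath_eps hd r e0.
exists (Num.min a b) => [|s]; rewrite lt_min ?a0// => /andP[sa sb].
rewrite -scalerBr opprD addrACA normrZ ger0_norm ?invr_ge0//.
have := ha s sa; have := hb s sb; have := ler_normD (g s - g r) (d s - d r); lra.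
Qed.

Lemma flow_midpoint g d s r : continuous_path g -> continuous_path d ->
  ptime d = ptime g ->
  flow S (midpoint g d) s r = 2^-1 *: (flow S g s r + flow S d s r).
Proof.
move=> hg hd dg; rewrite (flowE hS s r (cpath_midpoint hg hd dg)).
rewrite (flowE hS s r hg) (flowE hS s r hd) dg /=.
by rewrite -linearD -linearZ.
Qed.

Lemma half_diff (x y : H) : x - 2^-1 *: (x + y) = 2^-1 *: (x - y).
Proof.
apply: (ip_ext ipH) => z; rewrite !(ipDl, ipNl, ipZl).
by move: (ip x z) (ip y z) => a b; lra.
Qed.

Lemma flow_sub_midpoint g d r : continuous_path g -> continuous_path d ->
  ptime d = ptime g ->
  flow S g T r - flow S (midpoint g d) T r =
    2^-1 *: (flow S g T r - flow S d T r).
Proof. by move=> hg hd dg; rewrite flow_midpoint// half_diff. Qed.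

Lemma flow_sub_midpoint2 g d r : continuous_path g -> continuous_path d ->
  ptime d = ptime g ->
  flow S d T r - flow S (midpoint g d) T r =
    - (2^-1 *: (flow S g T r - flow S d T r)).
Proof.
by move=> hg hd dg; rewrite flow_midpoint// addrC (addrC (flow S g T r))
  [LHS]addrC half_diff -scalerN opprB.
Qed.

Lemma pdist_half g d k1 k2 : (forall r, `|flow S k1 T r - flow S k2 T r| =
    2^-1 * `|flow S g T r - flow S d T r|) ->
  continuous_path k1 -> continuous_path k2 -> continuous_path g -> continuous_path d ->
  pdist S T k1 k2 = 2^-1 * pdist S T g d.
Proof.
move=> h hk1 hk2 hg hd; apply/le_anti/andP; split.
  by apply: pdist_le => // r _; rewrite h ler_pM2l ?invr_gt0// le_pdist.
rewrite mulrC ler_pdivrMr// mulrC; apply: pdist_le => // r _.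
have := le_pdist hS T0 r hk1 hk2; rewrite h; lra.
Qed.

Lemma pdist_midpoint g d : continuous_path g -> continuous_path d ->
  ptime d = ptime g ->
  pdist S T g (midpoint g d) = 2^-1 * pdist S T g d /\
  pdist S T d (midpoint g d) = 2^-1 * pdist S T g d.
Proof.
move=> hg hd dg; have hm := cpath_midpoint hg hd dg.
split; apply: pdist_half => // r.
  by rewrite flow_sub_midpoint// normrZ ger0_norm.
by rewrite flow_sub_midpoint2// normrN normrZ ger0_norm.
Qed.

Lemma ups_half (m a : R) : ups (2^-1 * m) (2^-1 * a) = 4^-1 * ups m a.
Proof.
rewrite /ups; have [->|m0] := eqVneq m 0; last by field.
by rewrite mulr0 invr0 !mulr0 !expr0n /= addr0 mulr0.
Qed.

Lemma Upsilon2_midpoint g d : past T 0 g -> continuous_path d ->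
  ptime d = ptime g ->
  Upsilon2 (pgap S g (midpoint g d)) = 4^-1 * Upsilon2 (pgap S g d) /\
  Upsilon2 (pgap S d (midpoint g d)) = 4^-1 * Upsilon2 (pgap S g d).
Proof.
move=> [hg /andP[_ gT]] hd dg; have hm := cpath_midpoint hg hd dg.
have [p1 p2] := pdist_midpoint hg hd dg.
have dT : ptime d <= T by rewrite dg.
have mg : ptime (midpoint g d) <= ptime g by [].
have md : ptime (midpoint g d) <= ptime d by rewrite dg.
have dg' : ptime d <= ptime g by rewrite dg.
rewrite (Upsilon2_pgap hS hg hm mg gT) (Upsilon2_pgap hS hd hm md dT).
rewrite (Upsilon2_pgap hS hg hd dg' gT) p1 p2 dg.
rewrite flow_sub_midpoint// flow_sub_midpoint2// normrN normrZ ger0_norm//.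
by rewrite ups_half.
Qed.

Variables (W1 W2 : Hpath H -> R).
Hypothesis cW1 : C0_on T S (Lambda T) W1.
Hypothesis cW2 : C0_on T S (Lambda T) W2.
Variables (alpha kappa beta theta : R) (xi : Hpath H).
Hypothesis theta0 : 0 < theta.
Hypothesis hxi : continuous_path xi.

Let pen : Hpath H -> R := penalty T alpha kappa.
Let Th := Theta S T W1 W2 alpha kappa beta xi theta.
Let X : set (Hpath H) := past T (ptime xi).

Lemma past_Lambda g : X g -> Lambda T g.
Proof. by move=> [hg /andP[_ gT]]; apply/LambdaP. Qed.

(** Each term of the functional depends on one path or on the final times only. *)
Lemma Theta_usc (u v : nat -> Hpath H) g d : X g -> X d ->
  (forall n, X (u n)) -> (forall n, X (v n)) ->
  (forall e : R, 0 < e -> exists N : nat, forall n, (N <= n)%N -> dinf T S g (u n) < e) ->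
  (forall e : R, 0 < e -> exists N : nat, forall n, (N <= n)%N -> dinf T S d (v n) < e) ->
  forall e : R, 0 < e -> exists N : nat, forall n, (N <= n)%N ->
    Th (u n) (v n) <= Th g d + e.
Proof.
move=> Xg Xd Xu Xv ug vd e e0; have [xi0 _ _] := hxi.
pose a k := W1 k - 2 * beta * Upsilon2 (pgap S k xi) - pen k.
pose b k := W2 k + 2 * beta * Upsilon2 (pgap S k xi) + pen k.
have cU : C0_on T S X (fun k => 2 * beta * Upsilon2 (pgap S k xi)).
  by apply: C0_mul; [exact: C0_cst | exact: C0_pgap].
have ca : C0_on T S X a.
  apply: C0_sub; last exact: penalty_C0.
  by apply: C0_sub => //; apply: C0_subset cW1 => k; exact: past_Lambda.
have cb : C0_on T S X b.
  apply: C0_add; last exact: penalty_C0.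
  by apply: C0_add => //; apply: C0_subset cW2 => k; exact: past_Lambda.
have e4 : 0 < e / 4 by rewrite divr_gt0.
pose e' := e * theta / (16 * T).
have e'0 : 0 < e' by rewrite divr_gt0// mulr_gt0.
have [N1 h1] := C0_seq ca Xg Xu ug e4.
have [N2 h2] := C0_seq cb Xd Xv vd e4.
have ct := C0_ptime hS T0 (t := ptime xi).
have [N3 h3] := C0_seq ct Xg Xu ug e'0.
have [N4 h4] := C0_seq ct Xd Xv vd e'0.
exists (maxn (maxn N1 N2) (maxn N3 N4)) => n.
rewrite !geq_max => /andP[/andP[n1 n2] /andP[n3 n4]].
have := h1 n n1; have := h2 n n2; have := h3 n n3; have := h4 n n4.
rewrite !ler_norml /a /b => /andP[t1 t2] /andP[s1 s2] /andP[b1 b2] /andP[a1 a2].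
have tmb k : X k -> 0 <= ptime k <= T.
  by move=> [[k0 _ _] /andP[_ kT]]; rewrite k0.
have /andP[g0 gT] := tmb g Xg; have /andP[d0 dT] := tmb d Xd.
have /andP[u0 uT] := tmb _ (Xu n); have /andP[v0 vT] := tmb _ (Xv n).
have sq : (ptime g - ptime d) ^+ 2 <= (ptime (u n) - ptime (v n)) ^+ 2 + 8 * (T * e').
  set x := ptime g - ptime d; set y := ptime (u n) - ptime (v n).
  have q1 : `|x - y| <= 2 * e' by rewrite ler_norml /x /y; lra.
  have q2 : `|x + y| <= 2 * T by rewrite ler_norml /x /y; lra.
  have q3 : `|x - y| * `|x + y| <= 2 * e' * (2 * T) by apply: ler_pM.
  rewrite -normrM in q3; have := ler_norm ((x - y) * (x + y)).
  have -> : (x - y) * (x + y) = x ^+ 2 - y ^+ 2 by ring.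
  have : 0 <= T * e' by rewrite mulr_ge0// ltW.
  move: q3; have -> : (x - y) * (x + y) = x ^+ 2 - y ^+ 2 by ring.
  lra.
have sq' : (ptime g - ptime d) ^+ 2 / theta <=
   (ptime (u n) - ptime (v n)) ^+ 2 / theta + e / 2.
  rewrite ler_pdivrMr// mulrDl divfK ?gt_eqF//.
  have -> : e / 2 * theta = 8 * (T * e').
    by rewrite /e'; field; rewrite gt_eqF.
  exact: sq.
rewrite /Th /Theta -/(pen g) -/(pen d) -/(pen (u n)) -/(pen (v n)); lra.
Qed.

(** The variational principle is applied to pairs of paths, ordered by their two
    final times and gauged by the sum of the two gauges. *)
Lemma doubled_maximum g0 d0 (c a : R) : X g0 -> X d0 -> 0 < c -> 0 < a ->
  (forall g d, X g -> X d -> Th g d <= Th g0 d0 + c * a) ->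
  exists (ug ud : nat -> Hpath H) (g1 d1 : Hpath H),
  [/\ ug 0%N = g0 /\ ud 0%N = d0,
      X g1 /\ X d1,
      forall n, [/\ continuous_path (ug n), ptime (ug n) <= ptime g1 &
                    gauge S g1 (ug n) <= a],
      forall n, [/\ continuous_path (ud n), ptime (ud n) <= ptime d1 &
                    gauge S d1 (ud n) <= a]
    & Th g0 d0 <= Th g1 d1 /\
      forall g d, past T (ptime g1) g -> past T (ptime d1) d ->
      Th g d - limn (series (fun i => half_pow c i * (gauge S g (ug i) + gauge S d (ud i))))
      <= Th g1 d1 -
        limn (series (fun i => half_pow c i * (gauge S g1 (ug i) + gauge S d1 (ud i))))].
Proof.
move=> Xg0 Xd0 cp ap hmax.
pose XX := [set z : Hpath H * Hpath H | X z.1 /\ X z.2].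
pose le (z w : Hpath H * Hpath H) :=
  ptime z.1 <= ptime w.1 /\ ptime z.2 <= ptime w.2.
pose rho (z w : Hpath H * Hpath H) := gauge S z.1 w.1 + gauge S z.2 w.2.
have g_ge0 g d : X g -> X d -> 0 <= gauge S g d.
  by move=> [hg _] [hd _]; exact: gauge_ge0.
have B1 z : XX z -> le z z by split.
have B2 y x z : le x y -> le y z -> le x z.
  by move=> [h1 h2] [h3 h4]; split; [exact: le_trans h3|exact: le_trans h4].
have B3 z w : XX z -> XX w -> 0 <= rho z w.
  by move=> [z1 z2] [w1 w2]; rewrite addr_ge0// g_ge0.
have B4 z : XX z -> rho z z = 0.
  move=> [[z1 /andP[_ z1T]] [z2 /andP[_ z2T]]].
  by rewrite /rho (gaugexx hS T0 z1 z1T) (gaugexx hS T0 z2 z2T) addr0.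
have B5 w y z : XX w -> XX y -> XX z -> le w y -> le y z ->
    rho z w <= 2 * rho z y + 2 * rho y w.
  move=> [[w1 _] [w2 _]] [[y1 _] [y2 _]] [[z1 /andP[_ z1T]] [z2 /andP[_ z2T]]].
  move=> [wy1 wy2] [yz1 yz2].
  have := gauge_quasi_triangle hS T0 z1 w1 y1 wy1 yz1 z1T.
  by have := gauge_quasi_triangle hS T0 z2 w2 y2 wy2 yz2 z2T; rewrite /rho; lra.
have B6 (u : nat -> Hpath H * Hpath H) : (forall n, XX (u n)) ->
    (forall n m, (n <= m)%N -> le (u n) (u m)) ->
    (forall e : R, 0 < e -> exists N : nat, forall n m, (N <= n)%N -> (n <= m)%N ->
      rho (u m) (u n) <= e) ->
    exists z, [/\ XX z, forall n, le (u n) z,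
      forall e : R, 0 < e -> exists N : nat, forall n, (N <= n)%N ->
        Th (u n).1 (u n).2 <= Th z.1 z.2 + e
    & forall (k : nat) (e : R), 0 < e -> exists N : nat, forall n, (N <= n)%N ->
        `|rho (u n) (u k) - rho z (u k)| <= e].
  move=> Xu leu uC.
  have Xu1 n : X (u n).1 by have [] := Xu n.
  have Xu2 n : X (u n).2 by have [] := Xu n.
  have [||g [Xg ug hg]] := gauge_cauchy_limit Xu1.
  + by move=> n m nm; have [] := leu n m nm.
  + move=> e e0; have [N hN] := uC e e0; exists N => n m Nn nm.
    by have := hN n m Nn nm; have := g_ge0 _ _ (Xu2 m) (Xu2 n); rewrite /rho; lra.
  have [||d [Xd ud hd]] := gauge_cauchy_limit Xu2.
  + by move=> n m nm; have [] := leu n m nm.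
  + move=> e e0; have [N hN] := uC e e0; exists N => n m Nn nm.
    by have := hN n m Nn nm; have := g_ge0 _ _ (Xu1 m) (Xu1 n); rewrite /rho; lra.
  exists (g, d); split=> //.
  + by move=> e e0; exact: (Theta_usc Xg Xd Xu1 Xu2 hg hd e0).
  + move=> k e e0.
    have lim1 (v : nat -> Hpath H) z : (forall n, X (v n)) -> X z ->
       (forall n, ptime (v n) <= ptime z) ->
       (forall n m, (n <= m)%N -> ptime (v n) <= ptime (v m)) ->
       (forall e : R, 0 < e -> exists N : nat, forall n, (N <= n)%N ->
         dinf T S z (v n) < e) ->
       exists N : nat, forall n, (N <= n)%N ->
         `|gauge S (v n) (v k) - gauge S z (v k)| <= e / 2.
      move=> Xv [hz /andP[xz zT]] vz vI hv.
      have vk : continuous_path (v k) by have [] := Xv k.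
      have vp n : past T (ptime (v k)) (v (n + k)%N).
        have [h /andP[_ hT]] := Xv (n + k)%N; split=> //.
        by rewrite hT andbT vI// leq_addl.
      have zp : past T (ptime (v k)) z by split=> //; rewrite vz.
      have [|N hN] := C0_seq (C0_gauge hS T0 vk (lexx (ptime (v k)))) zp vp _ (divr_gt0 e0 (ltr0n R 2)).
        move=> b b0; have [N hN] := hv b b0; exists N => n Nn; apply: hN.
        by rewrite (leq_trans Nn)// leq_addr.
      exists (N + k)%N => n Nn; have := hN (n - k)%N.
      rewrite subnK; last by rewrite (leq_trans _ Nn)// leq_addl.
      by apply; rewrite leq_subRL ?(leq_trans _ Nn) ?leq_addl// addnC.
    have [N1 h1] : exists N : nat, forall n, (N <= n)%N ->
         `|gauge S (u n).1 (u k).1 - gauge S g (u k).1| <= e / 2.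
      by apply: (lim1 (fun n => (u n).1)) => // n m nm; have [] := leu n m nm.
    have [N2 h2] : exists N : nat, forall n, (N <= n)%N ->
         `|gauge S (u n).2 (u k).2 - gauge S d (u k).2| <= e / 2.
      by apply: (lim1 (fun n => (u n).2)) => // n m nm; have [] := leu n m nm.
    exists (maxn N1 N2) => n; rewrite geq_max => /andP[n1 n2].
    have := h1 n n1; have := h2 n n2; rewrite /rho /=.
    by rewrite !ler_norml; lra.
have B7 z : XX z -> le (g0, d0) z -> Th z.1 z.2 <= Th g0 d0 + c * a.
  by case: z => g d [Xg Xd] _; exact: hmax.
have XX0 : XX (g0, d0) by split.
have [u [[g1 d1] [[u0 Xu leu [Xg1 Xd1]] rhou hTh hfin]]] :=
  borwein_preiss B1 B2 B3 B4 B5 B6 XX0 cp ap B7.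
have Xu1 n : X (u n).1 by have [] := Xu n.
have Xu2 n : X (u n).2 by have [] := Xu n.
exists (fun n => (u n).1), (fun n => (u n).2), g1, d1; split => //.
- by rewrite u0.
- move=> n; have [h _] := Xu1 n; have [l _] := leu n; split=> //.
  have := rhou n; have := g_ge0 _ _ Xd1 (Xu2 n); rewrite /rho /=; lra.
- move=> n; have [h _] := Xu2 n; have [_ l] := leu n; split=> //.
  have := rhou n; have := g_ge0 _ _ Xg1 (Xu1 n); rewrite /rho /=; lra.
split=> // g d hg hd.
have Xg : X g by apply: past_le hg; have [_ /andP[]] := Xg1.
have Xd : X d by apply: past_le hd; have [_ /andP[]] := Xd1.
have := hfin (g, d); apply; first by split.
by have [_ /andP[h _]] := hg; have [_ /andP[h' _]] := hd; split.
Qed.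

End DoubledMaximum.

(** * Contact points *)

Section ContactPoints.
Context {R : realType} {H : completeNormedModType R}.
Variables (S : R -> {linear H -> H}) (T : R).
Variable ip : {dot H for (@idfun R)}.
Hypothesis ipH : hilbert_product ip.
Hypothesis hS : contraction_semigroup S.
Hypothesis T0 : 0 < T.
Variables (alpha kappa beta theta : R).
Hypothesis alpha0 : 0 < alpha.
Hypothesis beta0 : 0 < beta.
Implicit Types (g d z xi : Hpath H) (s t e a c : R).

Let w : R -> R := discount T alpha kappa.
Let pen : Hpath H -> R := penalty T alpha kappa.

Definition half_test s xi (u : nat -> Hpath H) c d : R :=
  pen d + 2 * beta * Upsilon2 (pgap S d xi) + (ptime d - s) ^+ 2 / theta
  + limn (series (fun i => half_pow c i * gauge S d (u i))).

Definition half_gradient z xi : H :=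
  w (ptime z) *: upsgrad (norm0 z) (z (ptime z)) +
  (2 * beta) *: upsgrad (pdist S T z xi)
    (flow S z T (ptime z) - flow S xi T (ptime z)).

(** The gauge centred at xi comes with the square of the time distance to xi,
    which has no counterpart in the doubled functional; the smooth part of the
    test subtracts it. *)
Lemma half_test_gauge z xi u s c a C : continuous_path z -> ptime z <= T ->
  continuous_path xi -> ptime xi <= ptime z -> 0 < c -> 0 <= a ->
  (forall i, [/\ continuous_path (u i), ptime (u i) <= ptime z &
                 gauge S z (u i) <= a ^+ 2]) ->
  exists (h : Hpath H -> R) (D : gauge_rep),
  [/\ gauge_class T S (ptime z) h D,
      forall d, past T (ptime z) d -> h d = half_test s xi u c d + C,
      `|gauge_dt D z - (2 * ((ptime z - s) / theta)
          - kappa * w (ptime z) * (1 + Upsilon2 z))| <= 4 * c * a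
    & `|gauge_dx ip S D z - half_gradient z xi| <= 8 * c * a].
Proof.
move=> hz zT hxi xz c0 a0 hu.
pose Q (t : R) := theta^-1 * (t - s) ^+ 2 - 2 * beta * (t - ptime xi) ^+ 2 + C.
pose Q' (t : R) := theta^-1 * (2 * (t - s)) - 2 * beta * (2 * (t - ptime xi)).
pose w' (t : R) := - kappa * w t.
have dw t : is_derive t (1 : R) w (w' t).
  rewrite /w' /w /discount; apply: is_derive_eq.
  by rewrite /GRing.scale/=; ring.
have dQ t : is_derive t (1 : R) Q (Q' t).
  by rewrite /Q /Q'; apply: is_derive_eq; rewrite /GRing.scale/=; ring.
have cw : continuous w by exact: is_derive_continuous dw.
have cw' : continuous w'.
  by move=> t; apply: cvgM; [exact: cvg_cst | exact: cw].
have cQ' : continuous Q'.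
  move=> t; rewrite /Q'; apply: cvgB; apply: cvgM; try exact: cvg_cst.
    by apply: cvgM; [exact: cvg_cst | apply: cvgB; [exact: cvg_id | exact: cvg_cst]].
  by apply: cvgM; [exact: cvg_cst | apply: cvgB; [exact: cvg_id | exact: cvg_cst]].
have w0 t : 0 <= w t by rewrite ltW// discount_gt0.
have [tz0 _ _] := hz.
have zitv : 0 <= ptime z <= T by rewrite tz0.
have close i : pdist S T z (u i) <= a /\ `|ptime z - ptime (u i)| <= a.
  have [ui uit uia] := hu i.
  have [h1 h2] := gauge_lower hS hz ui uit zT.
  by split; apply: le_of_sqr => //; apply: le_trans uia.
have b2 : 0 < 2 * beta by rewrite mulr_gt0.
have hu' i : [/\ continuous_path (u i), ptime (u i) <= ptime z &
    norm0 (u i) <= norm0 z + a].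
  have [ui uit _] := hu i; have [h1 _] := close i; split=> //.
  apply: le_trans (norm0_pdist hS T0 ui hz (le_trans uit zT) zT) _.
  by rewrite lerD2l (pdistC hS T0 ui hz).
have hzz : past T (ptime z) z by split=> //; rewrite lexx.
exists (gauge_value S (test_rep w w' Q Q' (2 * beta) c xi u)).
exists (test_rep w w' Q Q' (2 * beta) c xi u); split.
- exact: (test_class hS T0 dw dQ cw' cQ' w0 b2 c0 zitv hxi xz hu').
- move=> d hd; rewrite (test_value hS T0 w w' Q Q' (2 * beta) xi c0 hu' hd).
  rewrite /half_test /gauge /Q /pen /penalty -/w real_normK ?num_real//.
  ring.
- have := test_dt w w' Q Q' (2 * beta) xi c0 hzz a0 (fun i => (close i).2).
  apply: le_trans; rewrite le_eqVlt; apply/orP; left; apply/eqP.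
  by congr `|_|; rewrite /w' /Q'; ring.
- exact: (test_dx ipH hS T0 w w' Q Q' (2 * beta) c0 hxi xz hu' hzz a0 (fun i => (close i).1)).
Qed.

Variables (DA : set H) (A : H -> H).
Variables (U : metricType R) (F : Hpath H -> U -> H) (q : Hpath H -> U -> R).
Variable phi : Hpath H -> R.
Hypothesis hA : generates DA A S.

Lemma subsolution_contact W z xi u s c a :
  viscosity_subsolution ip T DA A S F q phi W ->
  continuous_path z -> ptime z < T ->
  continuous_path xi -> ptime xi <= ptime z -> 0 < c -> 0 <= a ->
  (forall i, [/\ continuous_path (u i), ptime (u i) <= ptime z &
                 gauge S z (u i) <= a ^+ 2]) ->
  (forall d, past T (ptime z) d ->
    W d - half_test s xi u c d <= W z - half_test s xi u c z) ->
  exists2 p : H, `|p - half_gradient z xi| <= 8 * c * a &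
    0 <= 2 * ((ptime z - s) / theta) - kappa * w (ptime z) * (1 + Upsilon2 z)
         + 4 * c * a + Hamiltonian ip F q z p.
Proof.
move=> hW hz zT hxi xz c0 a0 hu hmax.
have [h [D [hD hval hdt hdx]]] := half_test_gauge s
  (W z - half_test s xi u c z) hz (ltW zT) hxi xz c0 a0 hu.
exists (gauge_dx ip S D z) => //.
have [tz0 _ _] := hz.
have hzz : past T (ptime z) z by split=> //; rewrite lexx ltW.
have tT : 0 <= ptime z < T by rewrite tz0.
have Wz : W z = h z by rewrite hval//; ring.
have Wd d : past T (ptime z) d -> W d <= h d.
  by move=> hd; rewrite hval//; have := hmax d hd; lra.
have := subsolution_gauge ipH hS hA hW tT hD (conj erefl hz) Wz Wd.
by move: hdt; rewrite ler_norml => /andP[_]; lra.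
Qed.

Lemma supersolution_contact W z xi u s c a :
  viscosity_supersolution ip T DA A S F q phi W ->
  continuous_path z -> ptime z < T ->
  continuous_path xi -> ptime xi <= ptime z -> 0 < c -> 0 <= a ->
  (forall i, [/\ continuous_path (u i), ptime (u i) <= ptime z &
                 gauge S z (u i) <= a ^+ 2]) ->
  (forall d, past T (ptime z) d ->
    W z + half_test s xi u c z <= W d + half_test s xi u c d) ->
  exists2 p : H, `|p - half_gradient z xi| <= 8 * c * a &
    - (2 * ((ptime z - s) / theta) - kappa * w (ptime z) * (1 + Upsilon2 z)
       + 4 * c * a) + Hamiltonian ip F q z (- p) <= 0.
Proof.
move=> hW hz zT hxi xz c0 a0 hu hmin.
have [h [D [hD hval hdt hdx]]] := half_test_gauge s
  (- W z - half_test s xi u c z) hz (ltW zT) hxi xz c0 a0 hu.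
exists (gauge_dx ip S D z) => //.
have [tz0 _ _] := hz.
have hzz : past T (ptime z) z by split=> //; rewrite lexx ltW.
have tT : 0 <= ptime z < T by rewrite tz0.
have Wz : W z = - h z by rewrite hval//; ring.
have Wd d : past T (ptime z) d -> - h d <= W d.
  by move=> hd; rewrite hval//; have := hmin d hd; lra.
have := supersolution_gauge ipH hS hA hW tT hD (conj erefl hz) Wz Wd.
by move: hdt; rewrite ler_norml => /andP[_]; lra.
Qed.

End ContactPoints.

Section HamiltonianEstimate.
Context {R : realType} {H : completeNormedModType R}.
Variables (S : R -> {linear H -> H}) (T : R).
Variable ip : {dot H for (@idfun R)}.
Variables (U : metricType R) (F : Hpath H -> U -> H) (q : Hpath H -> U -> R).
Hypothesis ipH : hilbert_product ip.
Hypothesis U0 : [set: U] !=set0.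
Implicit Types (g d z xi : Hpath H) (s t e a c : R).

Variable L : R.
Hypothesis L0 : 0 < L.
Hypothesis F_bound : forall g u, past T 0 g -> `|F g u| <= L * (1 + norm0 g).
Hypothesis q_bound : forall g u, past T 0 g -> `|q g u| <= L * (1 + norm0 g).
Hypothesis F_lip : forall g d u, past T 0 g -> past T 0 d ->
  `|F g u - F d u| <= L * dinf T S g d.
Hypothesis q_lip : forall g d u, past T 0 g -> past T 0 d ->
  `|q g u - q d u| <= L * dinf T S g d.

Lemma growth_term z u : past T 0 z ->
  ip (upsgrad (norm0 z) (z (ptime z))) (F z u) <= 6 * L * (1 + norm0 z ^+ 2).
Proof.
move=> hz; have [cz _] := hz; apply: le_trans (cauchy_schwarz ipH _ _) _.
have zm := le_norm0 (ptime z) cz; have m0 := norm0_ge0 cz.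
have h1 : `|upsgrad (norm0 z) (z (ptime z))| <= 4 * norm0 z.
  by apply: le_trans (upsgrad_norm zm) _; rewrite ler_pM2l.
have h2 : `|upsgrad (norm0 z) (z (ptime z))| * `|F z u| <=
    4 * norm0 z * (L * (1 + norm0 z)).
  by apply: ler_pM => //; exact: F_bound.
apply: le_trans h2 _; have := L0; set m := norm0 z => l0.
have h3 : 0 <= L * (m - 1) ^+ 2 by rewrite mulr_ge0 ?sqr_ge0// ltW.
have -> : 4 * m * (L * (1 + m)) =
  6 * L * (1 + m ^+ 2) - 2 * (L * (m - 1) ^+ 2) - 4 * L by ring.
lra.
Qed.

(** The gradients of the two centred gauges nearly cancel, so only the Lipschitz
    continuity of the data is felt by them; the remaining gradients are tamed by
    the growth bound. *)
Lemma Hamiltonian_difference alpha kappa beta xi z1 z2 (p1 p2 : H)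
    (eta omega Gamma delta M : R) :
  0 < alpha ->
  past T 0 z1 -> past T 0 z2 -> norm0 z1 <= M -> norm0 z2 <= M ->
  `|p1 - half_gradient S T alpha kappa beta z1 xi| <= eta ->
  `|p2 - half_gradient S T alpha kappa beta z2 xi| <= eta ->
  let B z := (2 * beta) *: upsgrad (pdist S T z xi)
      (flow S z T (ptime z) - flow S xi T (ptime z)) in
  `|B z1 + B z2| <= omega -> `|B z2| <= Gamma -> dinf T S z1 z2 <= delta ->
  Hamiltonian ip F q z1 p1 <= Hamiltonian ip F q z2 (- p2) +
    (6 * L * discount T alpha kappa (ptime z1) * (1 + norm0 z1 ^+ 2)
     + 6 * L * discount T alpha kappa (ptime z2) * (1 + norm0 z2 ^+ 2)
     + (omega + 2 * eta) * (L * (1 + M)) + (Gamma + 1) * (L * delta)).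
Proof.
move=> alpha0 hz1 hz2 m1 m2 hp1 hp2 B hom hGa hde.
have bnd z : past T 0 z -> norm0 z <= M -> forall u,
    `|F z u| <= L * (1 + M) /\ `|q z u| <= L * (1 + M).
  move=> hz hm u; have h1 := F_bound u hz; have h2 := q_bound u hz.
  have : L * (1 + norm0 z) <= L * (1 + M) by rewrite ler_pM2l// lerD2l.
  by split; lra.
apply: (@Hamiltonian_le R H ip U F q ipH z1 z2 p1 (- p2) (L * (1 + M)) (L * (1 + M))) => //.
- exact: bnd.
- exact: bnd.
move=> u; have [F1 _] := bnd z1 hz1 m1 u; have [F2 _] := bnd z2 hz2 m2 u.
set w1 := discount T alpha kappa (ptime z1); set w2 := discount T alpha kappa (ptime z2).
set e1 := p1 - half_gradient S T alpha kappa beta z1 xi in hp1.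
set e2 := p2 - half_gradient S T alpha kappa beta z2 xi in hp2.
have eta0 : 0 <= eta by apply: le_trans hp1.
have om0 : 0 <= omega by apply: le_trans hom.
have Ga0 : 0 <= Gamma by apply: le_trans hGa.
have w10 : 0 < w1 by exact: discount_gt0.
have w20 : 0 < w2 by exact: discount_gt0.
have dec : ip p1 (F z1 u) + ip p2 (F z2 u) =
    ip e1 (F z1 u) + ip e2 (F z2 u)
    + w1 * ip (upsgrad (norm0 z1) (z1 (ptime z1))) (F z1 u)
    + w2 * ip (upsgrad (norm0 z2) (z2 (ptime z2))) (F z2 u)
    + ip (B z1 + B z2) (F z1 u) + ip (B z2) (F z2 u - F z1 u).
  have -> : p1 = e1 + (w1 *: upsgrad (norm0 z1) (z1 (ptime z1)) + B z1).
    by rewrite /e1 subrK.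
  have -> : p2 = e2 + (w2 *: upsgrad (norm0 z2) (z2 (ptime z2)) + B z2).
    by rewrite /e2 subrK.
  move: (e1) (e2) (B z1) (B z2) => x1 x2 b1 b2.
  by rewrite !ipDl !ipZl ipDr ipNr; ring.
have t1 : ip e1 (F z1 u) <= eta * (L * (1 + M)).
  by apply: le_trans (cauchy_schwarz ipH _ _) _; apply: ler_pM.
have t2 : ip e2 (F z2 u) <= eta * (L * (1 + M)).
  by apply: le_trans (cauchy_schwarz ipH _ _) _; apply: ler_pM.
have t3 : w1 * ip (upsgrad (norm0 z1) (z1 (ptime z1))) (F z1 u) <=
    6 * L * w1 * (1 + norm0 z1 ^+ 2).
  have -> : 6 * L * w1 * (1 + norm0 z1 ^+ 2) = w1 * (6 * L * (1 + norm0 z1 ^+ 2)).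
    by ring.
  by rewrite ler_pM2l//; exact: growth_term.
have t4 : w2 * ip (upsgrad (norm0 z2) (z2 (ptime z2))) (F z2 u) <=
    6 * L * w2 * (1 + norm0 z2 ^+ 2).
  have -> : 6 * L * w2 * (1 + norm0 z2 ^+ 2) = w2 * (6 * L * (1 + norm0 z2 ^+ 2)).
    by ring.
  by rewrite ler_pM2l//; exact: growth_term.
have t5 : ip (B z1 + B z2) (F z1 u) <= omega * (L * (1 + M)).
  by apply: le_trans (cauchy_schwarz ipH _ _) _; apply: ler_pM.
have Ld : L * dinf T S z1 z2 <= L * delta by rewrite ler_pM2l.
have t6 : ip (B z2) (F z2 u - F z1 u) <= Gamma * (L * delta).
  apply: le_trans (cauchy_schwarz ipH _ _) _; apply: ler_pM => //.
  by rewrite distrC; apply: le_trans (F_lip u hz1 hz2) Ld.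
have t7 : q z1 u - q z2 u <= L * delta.
  by apply: le_trans (ler_norm _) _; apply: le_trans (q_lip u hz1 hz2) Ld.
rewrite ipNl; lra.
Qed.

End HamiltonianEstimate.

Section GradientCancellation.
Context {R : realType} {H : completeNormedModType R}.
Variables (S : R -> {linear H -> H}) (T : R).
Variable ip : {dot H for (@idfun R)}.
Hypothesis ipH : hilbert_product ip.
Hypothesis hS : contraction_semigroup S.
Hypothesis T0 : 0 < T.
Implicit Types (g d z xi : Hpath H) (r s t e : R).

(** Near a pair of paths with midpoint xi, the end values relative to xi are
    nearly opposite. The two end times may differ, but the half difference v of
    the pair is fixed, so the strong continuity of the semigroup at v applies. *)
Lemma gradients_cancel g d z1 z2 e r : past T 0 g -> past T 0 d ->
  ptime d = ptime g ->
  past T (ptime g) z1 -> past T (ptime g) z2 ->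
  pdist S T z1 g <= e -> pdist S T z2 d <= e ->
  let v := 2^-1 *: (g (ptime g) - d (ptime g)) in
  (forall a, 0 <= a <= r -> `|S a v - v| <= e) -> `|ptime z1 - ptime z2| <= r ->
  let G z := upsgrad (pdist S T z (midpoint g d))
    (flow S z T (ptime z) - flow S (midpoint g d) T (ptime z)) in
  `|G z1 + G z2| <= 52 * e /\ `|G z2| <= 2 * pdist S T g d + 4 * e.
Proof.
move=> hg hd dg [hz1 /andP[gz1 z1T]] [hz2 /andP[gz2 z2T]] dz1 dz2 v hv hr G.
have [cg /andP[tg0 gT]] := hg; have [cd _] := hd.
set xi := midpoint g d in G *.
have cx : continuous_path xi by exact: cpath_midpoint.
have [m1 m2] := pdist_midpoint ipH hS T0 cg cd dg; rewrite -/xi in m1 m2.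
set x := flow S z1 T (ptime z1) - flow S xi T (ptime z1).
set y := flow S z2 T (ptime z2) - flow S xi T (ptime z2).
have dE : flow S d T (ptime g) = d (ptime g) by rewrite -dg flow_at_end// dg.
have vE : flow S g T (ptime g) - flow S xi T (ptime g) = v.
  by rewrite /xi (flow_sub_midpoint T ipH hS _ cg cd dg) (flow_at_end hS cg gT) dE.
have gxi t : ptime g <= t -> t <= T ->
    flow S g T t - flow S xi T t = S (t - ptime g) v.
  move=> gt tT; rewrite (flow_step hS cg (lexx _) gt tT).
  rewrite (flow_step hS (s := ptime g) cx (lexx _) gt tT).
  by rewrite -semigroupB vE.
have dxi t : ptime g <= t -> t <= T ->
    flow S d T t - flow S xi T t = - S (t - ptime g) v.
  move=> gt tT; rewrite -gxi// /xi.
  by rewrite (flow_sub_midpoint2 T ipH hS _ cg cd dg) (flow_sub_midpoint T ipH hS _ cg cd dg).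
have e1 : `|x - S (ptime z1 - ptime g) v| <= e.
  have -> : x - S (ptime z1 - ptime g) v =
    flow S z1 T (ptime z1) - flow S g T (ptime z1).
    by rewrite -gxi// /x opprB addrA subrK.
  exact: le_trans (le_pdist hS T0 _ hz1 cg) dz1.
have e2 : `|y + S (ptime z2 - ptime g) v| <= e.
  have -> : y + S (ptime z2 - ptime g) v =
    flow S z2 T (ptime z2) - flow S d T (ptime z2).
    by rewrite -[S _ v]opprK -dxi// /y opprB addrA subrK.
  exact: le_trans (le_pdist hS T0 _ hz2 cd) dz2.
have e3 : `|S (ptime z1 - ptime g) v - S (ptime z2 - ptime g) v| <= e.
  apply: le_trans (orbit_dist hS v _ _) _; rewrite ?subr_ge0//.
  apply: hv; rewrite normr_ge0 /=; apply: le_trans hr.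
  by rewrite opprB addrA subrK.
have xy : `|x - - y| <= 3 * e.
  have -> : x - - y = (x - S (ptime z1 - ptime g) v)
    + (y + S (ptime z2 - ptime g) v)
    + (S (ptime z1 - ptime g) v - S (ptime z2 - ptime g) v) by vring ipH.
  apply: le_trans (ler_normD _ _) _.
  by apply: le_trans (lerD (ler_normD _ _) (lexx _)) _; lra.
have n1 : `|pdist S T z1 xi - 2^-1 * pdist S T g d| <= e.
  rewrite -m1 ler_norml.
  have := pdist_triangle hS T0 hz1 cx cg; have := pdist_triangle hS T0 cg cx hz1.
  by rewrite (pdistC hS T0 cg hz1); lra.
have n2 : `|pdist S T z2 xi - 2^-1 * pdist S T g d| <= e.
  rewrite -m2 ler_norml.
  have := pdist_triangle hS T0 hz2 cx cd; have := pdist_triangle hS T0 cd cx hz2.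
  by rewrite (pdistC hS T0 cd hz2); lra.
have n12 : `|pdist S T z1 xi - pdist S T z2 xi| <= 2 * e.
  by move: n1 n2; rewrite !ler_norml; lra.
have hx : `|x| <= pdist S T z1 xi by exact: le_pdist.
have hy : `|y| <= pdist S T z2 xi by exact: le_pdist.
split.
  have -> : G z1 + G z2 =
      upsgrad (pdist S T z1 xi) x - upsgrad (pdist S T z2 xi) (- y).
    by rewrite upsgradN opprK.
  apply: le_trans (upsgrad_dist ipH hx _) _; first by rewrite normrN.
  lra.
apply: le_trans (upsgrad_norm hy) _; move: n2; rewrite ler_norml; lra.
Qed.

End GradientCancellation.

(** * Comparison *)

Section InteriorMaximum.
Context {R : realType} {H : completeNormedModType R}.
Variables (S : R -> {linear H -> H}) (T : R).
Variable ip : {dot H for (@idfun R)}.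
Variables (DA : set H) (A : H -> H).
Variables (U : metricType R) (F : Hpath H -> U -> H) (q : Hpath H -> U -> R).
Variable phi : Hpath H -> R.
Hypothesis ipH : hilbert_product ip.
Hypothesis hS : contraction_semigroup S.
Hypothesis T0 : 0 < T.
Hypothesis hA : generates DA A S.
Hypothesis U0 : [set: U] !=set0.
Implicit Types (g d z xi : Hpath H) (s t e a c : R).

Variable L : R.
Hypothesis L0 : 0 < L.
Hypothesis F_bound : forall g u, past T 0 g -> `|F g u| <= L * (1 + norm0 g).
Hypothesis q_bound : forall g u, past T 0 g -> `|q g u| <= L * (1 + norm0 g).
Hypothesis F_lip : forall g d u, past T 0 g -> past T 0 d ->
  `|F g u - F d u| <= L * dinf T S g d.
Hypothesis q_lip : forall g d u, past T 0 g -> past T 0 d ->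
  `|q g u - q d u| <= L * dinf T S g d.

Variables (K : R) (W1 W2 : Hpath H -> R).
Hypothesis K0 : 0 < K.
Hypothesis regW1 : regular_functional S T K W1.
Hypothesis regW2 : regular_functional S T K W2.
Hypothesis subW1 : viscosity_subsolution ip T DA A S F q phi W1.
Hypothesis superW2 : viscosity_supersolution ip T DA A S F q phi W2.

Variables (alpha beta theta lam : R).
Hypothesis alpha0 : 0 < alpha.
Hypothesis beta0 : 0 < beta.
Hypothesis theta0 : 0 < theta.
Hypothesis lam0 : 0 < lam.

(* 6 L compensates the growth of F, as in [growth_term]; the excess 1 yields the
   strict decay *)
Let kappa := 6 * L + 1.
Let Rb := radius K alpha.
Let pen : Hpath H -> R := penalty T alpha kappa.
Let Th xi := Theta S T W1 W2 alpha kappa beta xi theta.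

(** At an interior maximum of the doubled functional, the two viscosity
    inequalities are subtracted: the time derivatives of the time penalty cancel,
    and the decay of the discount factor beats the growth of the data, leaving a
    negative quantity that the errors cannot compensate. *)
Lemma interior_maximum g0 d0 (ug ud : nat -> Hpath H) g1 d1 r :
  same_time T g0 d0 -> let xi := midpoint g0 d0 in
  ug 0%N = g0 -> ud 0%N = d0 ->
  past T (ptime xi) g1 -> past T (ptime xi) d1 ->
  ptime g1 < T -> ptime d1 < T -> norm0 g1 <= Rb -> norm0 d1 <= Rb ->
  (forall n, [/\ continuous_path (ug n), ptime (ug n) <= ptime g1 &
     gauge S g1 (ug n) <= lam ^+ 2]) ->
  (forall n, [/\ continuous_path (ud n), ptime (ud n) <= ptime d1 &
     gauge S d1 (ud n) <= lam ^+ 2]) ->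
  (forall g d, past T (ptime g1) g -> past T (ptime d1) d ->
    Th xi g d - limn (series (fun i => half_pow lam i *
      (gauge S g (ug i) + gauge S d (ud i))))
    <= Th xi g1 d1 - limn (series (fun i => half_pow lam i *
      (gauge S g1 (ug i) + gauge S d1 (ud i))))) ->
  let v := 2^-1 *: (g0 (ptime g0) - d0 (ptime g0)) in
  (forall a, 0 <= a <= r -> `|S a v - v| <= lam) ->
  let m := pdist S T g0 d0 in
  `|ptime g1 - ptime d1| <= r -> `|ptime g1 - ptime d1| <= lam ->
  2 * alpha <= 8 * lam ^+ 2 +
    (104 * beta * lam + 16 * lam ^+ 2) * (L * (1 + Rb)) +
    (4 * beta * m + 8 * beta * lam + 1) * (L * (3 * lam + m)).
Proof.
move=> [hg0 hd0 dg0] xi ug0 ud0 Xg1 Xd1 g1T d1T ng nd hug hud hmax v hv m hr hl.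
have [cg0 /andP[tg0 g0T]] := hg0; have [cd0 _] := hd0.
have [cg1 /andP[xg1 _]] := Xg1; have [cd1 /andP[xd1 _]] := Xd1.
have cxi : continuous_path xi by exact: cpath_midpoint.
have pg1 : past T 0 g1 by split=> //; rewrite (le_trans tg0 xg1) ltW.
have pd1 : past T 0 d1 by split=> //; rewrite (le_trans tg0 xd1) ltW.
have close z (u : nat -> Hpath H) n : continuous_path z -> ptime z <= T ->
    [/\ continuous_path (u n), ptime (u n) <= ptime z & gauge S z (u n) <= lam ^+ 2] ->
    pdist S T z (u n) <= lam /\ `|ptime z - ptime (u n)| <= lam.
  move=> hz zT [un unz una]; have [h1 h2] := gauge_lower hS hz un unz zT.
  by split; apply: le_of_sqr; rewrite ?(ltW lam0)//; apply: le_trans una.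
have conv z u : continuous_path z -> ptime z <= T -> (forall n,
    [/\ continuous_path (u n), ptime (u n) <= ptime z & gauge S z (u n) <= lam ^+ 2]) ->
    forall k, past T (ptime z) k ->
    cvgn (series (fun i => half_pow lam i * gauge S k (u i))).
  move=> hz zT hu k hk; apply: (gauge_series_cvg hS T0 lam0 hk (N := norm0 z + lam)).
  move=> i; have [un unz una] := hu i; split=> //.
  apply: le_trans (norm0_pdist hS T0 un hz (le_trans unz zT) zT) _.
  by rewrite lerD2l (pdistC hS T0 un hz); have [] := close z u i hz zT (hu i).
have split_lim g d : past T (ptime g1) g -> past T (ptime d1) d ->
    limn (series (fun i => half_pow lam i * (gauge S g (ug i) + gauge S d (ud i)))) =
    limn (series (fun i => half_pow lam i * gauge S g (ug i))) +
    limn (series (fun i => half_pow lam i * gauge S d (ud i))).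
  move=> hg hd; rewrite -lim_seriesD; last first.
  - by apply: (conv d1 ud) => //; exact: ltW.
  - by apply: (conv g1 ug) => //; exact: ltW.
  by congr (limn (series _)); apply/funext => i /=; rewrite mulrDr.
have gg1 : past T (ptime g1) g1 by split=> //; rewrite lexx ltW.
have dd1 : past T (ptime d1) d1 by split=> //; rewrite lexx ltW.
pose hT := half_test S T alpha kappa beta theta.
have max1 g : past T (ptime g1) g ->
    W1 g - hT (ptime d1) xi ug lam g <= W1 g1 - hT (ptime d1) xi ug lam g1.
  move=> hg; have := hmax g d1 hg dd1; rewrite !split_lim//.
  rewrite /Th /Theta /hT /half_test; lra.
have max2 d : past T (ptime d1) d ->
    W2 d1 + hT (ptime g1) xi ud lam d1 <= W2 d + hT (ptime g1) xi ud lam d.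
  move=> hd; have := hmax g1 d gg1 hd; rewrite !split_lim//.
  have sqC (x y : R) : (x - y) ^+ 2 = (y - x) ^+ 2 by ring.
  rewrite /Th /Theta /hT /half_test (sqC (ptime d1)) (sqC (ptime d)); lra.
have [p1 hp1 ineq1] := subsolution_contact ipH hS T0 alpha0 beta0 hA subW1
  cg1 g1T cxi xg1 lam0 (ltW lam0) hug max1.
have [p2 hp2 ineq2] := supersolution_contact ipH hS T0 alpha0 beta0 hA superW2
  cd1 d1T cxi xd1 lam0 (ltW lam0) hud max2.
have [c1 _] := close g1 ug 0%N cg1 (ltW g1T) (hug 0%N).
have [c2 _] := close d1 ud 0%N cd1 (ltW d1T) (hud 0%N).
rewrite ug0 in c1; rewrite ud0 in c2.
have [G12 G2] := gradients_cancel ipH hS T0 hg0 hd0 dg0 Xg1 Xd1 c1 c2 hv hr.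
have m0 : 0 <= m by exact: pdist_ge0.
have dd : dinf T S g1 d1 <= 3 * lam + m.
  rewrite /dinf -/(pdist S T g1 d1).
  have := pdist_triangle hS T0 cg1 cd1 cg0; have := pdist_triangle hS T0 cg0 cd1 cd0.
  by rewrite (pdistC hS T0 cd0 cd1) -/m; lra.
pose om := 104 * beta * lam; pose Ga := 4 * beta * m + 8 * beta * lam.
have b2 : 0 < 2 * beta by rewrite mulr_gt0.
have hom : `|(2 * beta) *: upsgrad (pdist S T g1 xi)
      (flow S g1 T (ptime g1) - flow S xi T (ptime g1)) +
    (2 * beta) *: upsgrad (pdist S T d1 xi)
      (flow S d1 T (ptime d1) - flow S xi T (ptime d1))| <= om.
  rewrite -scalerDr normrZ gtr0_norm//.
  have -> : om = 2 * beta * (52 * lam) by rewrite /om; ring.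
  by rewrite ler_pM2l.
have hGa : `|(2 * beta) *: upsgrad (pdist S T d1 xi)
      (flow S d1 T (ptime d1) - flow S xi T (ptime d1))| <= Ga.
  rewrite normrZ gtr0_norm//.
  have -> : Ga = 2 * beta * (2 * m + 4 * lam) by rewrite /Ga; ring.
  by rewrite ler_pM2l.
have ham := Hamiltonian_difference ipH U0 L0 F_bound q_bound F_lip q_lip alpha0
  pg1 pd1 ng nd hp1 hp2 hom hGa dd.
have w1a := discount_ge alpha0 (_ : 0 < kappa) (ltW g1T).
have w2a := discount_ge alpha0 (_ : 0 < kappa) (ltW d1T).
have kap0 : 0 < kappa by rewrite /kappa; have := L0; lra.
have {}w1a := w1a kap0; have {}w2a := w2a kap0.
have pl w z : continuous_path z -> alpha <= w ->
    alpha + 6 * L * w * (1 + norm0 z ^+ 2) <= kappa * w * (1 + Upsilon2 z).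
  move=> hz aw; have h1 := Upsilon2_lower hz.
  have k2 := sqr_ge0 (norm0 z).
  have w0 : 0 < w by exact: lt_le_trans alpha0 aw.
  have h2 : kappa * w * (1 + norm0 z ^+ 2) <= kappa * w * (1 + Upsilon2 z).
    by rewrite ler_pM2l ?mulr_gt0// lerD2l.
  have h3 : w <= w * (1 + norm0 z ^+ 2) by rewrite ler_peMr ?(ltW w0)// lerDl.
  have h4 : kappa * w * (1 + norm0 z ^+ 2) =
     6 * L * w * (1 + norm0 z ^+ 2) + w * (1 + norm0 z ^+ 2) by rewrite /kappa; ring.
  lra.
have pl1 := pl _ g1 cg1 w1a; have pl2 := pl _ d1 cd1 w2a.
have tt : (ptime g1 - ptime d1) / theta = - ((ptime d1 - ptime g1) / theta).
  by rewrite -mulNr opprB.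
move: ineq1 ineq2 ham; rewrite tt /om /Ga.
move: (Hamiltonian _ _ _ _ _) (Hamiltonian _ _ _ _ _) => h1 h2.
set X := (_ - _) / theta.
have -> : 4 * lam * lam = 4 * lam ^+ 2 by ring.
have -> : 8 * lam * lam = 8 * lam ^+ 2 by ring.
have -> : 2 * (8 * lam ^+ 2) = 16 * lam ^+ 2 by ring.
lra.
Qed.

End InteriorMaximum.

Section ComparisonPrinciple.
Context {R : realType} {H : completeNormedModType R}.
Variables (S : R -> {linear H -> H}) (T : R).
Variable ip : {dot H for (@idfun R)}.
Variables (DA : set H) (A : H -> H).
Variables (U : metricType R) (F : Hpath H -> U -> H) (q : Hpath H -> U -> R).
Variable phi : Hpath H -> R.
Hypothesis ipH : hilbert_product ip.
Hypothesis hS : contraction_semigroup S.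
Hypothesis T0 : 0 < T.
Hypothesis hA : generates DA A S.
Hypothesis U0 : [set: U] !=set0.
Implicit Types (g d z xi : Hpath H) (s t e a c : R).

Variable L : R.
Hypothesis L0 : 0 < L.
Hypothesis F_bound : forall g u, past T 0 g -> `|F g u| <= L * (1 + norm0 g).
Hypothesis q_bound : forall g u, past T 0 g -> `|q g u| <= L * (1 + norm0 g).
Hypothesis F_lip : forall g d u, past T 0 g -> past T 0 d ->
  `|F g u - F d u| <= L * dinf T S g d.
Hypothesis q_lip : forall g d u, past T 0 g -> past T 0 d ->
  `|q g u - q d u| <= L * dinf T S g d.

Variables (K : R) (W1 W2 : Hpath H -> R).
Hypothesis K0 : 0 < K.
Hypothesis regW1 : regular_functional S T K W1.
Hypothesis regW2 : regular_functional S T K W2.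
Hypothesis subW1 : viscosity_subsolution ip T DA A S F q phi W1.
Hypothesis superW2 : viscosity_supersolution ip T DA A S F q phi W2.

Lemma terminal_order g : past T 0 g -> ptime g = T -> W1 g <= W2 g.
Proof.
move=> [hg _] gT; have [_ h1 _] := subW1; have [_ h2 _] := superW2.
by apply: le_trans (h1 g _) (h2 g _).
Qed.

Lemma small_parameter (D rho al beta : R) : 0 <= D -> 0 < rho -> 0 < al -> 0 < beta ->
  exists lam, [/\ 0 < lam, lam <= 1, lam * beta <= 1, lam * D <= al & 8 * lam <= rho].
Proof.
move=> D0 rho0 al0 be0; pose s := 1 + beta + D / al + 8 / rho.
have h1 : 0 <= D / al by rewrite divr_ge0// ltW.
have h2 : 0 < 8 / rho by rewrite divr_gt0.
have s0 : 0 < s by rewrite /s; lra.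
exists s^-1; split.
- by rewrite invr_gt0.
- by rewrite invf_le1// /s; lra.
- by rewrite mulrC ler_pdivrMr// mul1r /s; lra.
- rewrite mulrC ler_pdivrMr// mulrC -ler_pdivrMr// /s; lra.
- by rewrite ler_pdivrMr// mulrC -ler_pdivrMr// /s; lra.
Qed.

Lemma errors_small (CF lam m al be : R) : 0 < CF -> 0 < be -> 0 <= lam -> 0 <= m ->
  lam <= 1 -> lam * be <= 1 -> be * m <= K + 1 ->
  lam * (8 + 16 * CF + 104 * be * CF + 3 * ((4 * K + 13) * L)) <= al ->
  (4 * K + 13) * L * ((K + 1) / be) <= al / 2 ->
  8 * lam ^+ 2 + (104 * be * lam + 16 * lam ^+ 2) * CF +
    (4 * be * m + 8 * be * lam + 1) * (L * (3 * lam + m)) <= 3 / 2 * al.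
Proof.
move=> CF0 be0 lam0 m0 lam1 lamb mb lamD be2.
have l2 : lam ^+ 2 <= lam by rewrite -[leRHS]expr1 ler_wiXn2l.
have e1 : (104 * be * lam + 16 * lam ^+ 2) * CF <= lam * (104 * be * CF + 16 * CF).
  have -> : lam * (104 * be * CF + 16 * CF) = (104 * be * lam + 16 * lam) * CF by ring.
  by rewrite ler_pM2r//; lra.
have e2 : (4 * be * m + 8 * be * lam + 1) * (L * (3 * lam + m)) <=
    (4 * K + 13) * L * (3 * lam + (K + 1) / be).
  have m1 : m <= (K + 1) / be by rewrite ler_pdivlMr// mulrC.
  rewrite -[leRHS]mulrA; apply: ler_pM.
  - by rewrite !addr_ge0// !mulr_ge0// ltW.
  - by rewrite mulr_ge0 ?(ltW L0)// addr_ge0// mulr_ge0.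
  - by rewrite -!mulrA (mulrC be lam); lra.
  - by rewrite ler_pM2l//; lra.
have e3 : lam * (8 + 16 * CF + 104 * be * CF + 3 * ((4 * K + 13) * L)) =
  8 * lam + lam * (104 * be * CF + 16 * CF) + (4 * K + 13) * L * (3 * lam) by ring.
have e4 : (4 * K + 13) * L * (3 * lam + (K + 1) / be) =
  (4 * K + 13) * L * (3 * lam) + (4 * K + 13) * L * ((K + 1) / be) by ring.
rewrite e3 in lamD; lra.
Qed.

(** If W1 exceeded W2 somewhere, the doubled functional would have an interior
    maximum with arbitrarily small errors. The parameters are chosen in the
    order alpha, beta, lam, near maximizer, theta: each choice makes the terms
    that involve the previous ones small. *)
Lemma comparison g : past T 0 g -> W1 g <= W2 g.
Proof.
move=> hg; rewrite leNgt; apply/negP => gap.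
pose kappa := 6 * L + 1.
have kap0 : 0 < kappa by rewrite /kappa; have := L0; lra.
pose P0 := expR (kappa * T) * (1 + 2 * norm0 g ^+ 2).
have P00 : 0 < P0.
  by rewrite mulr_gt0 ?expR_gt0//; have := sqr_ge0 (norm0 g); lra.
pose rho := (W1 g - W2 g) / 2.
have rho0 : 0 < rho by rewrite divr_gt0// subr_gt0.
pose al := rho / (2 * P0).
have al0 : 0 < al by rewrite divr_gt0// mulr_gt0.
have [hgc _] := hg.
have pen_g beta : rho <= Psi S T W1 W2 al kappa beta g g.
  rewrite (Psi_diag hS T0 _ _ _ _ _ hg); have := penalty_upper al0 kap0 hg.
  rewrite -mulrA -/P0.
  have -> : al * P0 = rho / 2 by rewrite /al; field; rewrite gt_eqF.
  rewrite /rho; lra.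
pose Rb := radius K al.
have Rb1 : 1 <= Rb by exact: radius_ge1.
pose CF := L * (1 + Rb); pose C := K * (1 + 2 * Rb).
have CF0 : 0 < CF by rewrite mulr_gt0//; lra.
have C0 : 0 < C by rewrite mulr_gt0//; lra.
(* b1 excludes maxima at the final time T, and b2 makes the distance between g0
   and d0 negligible against alpha *)
pose b1 := K ^+ 2 / rho; pose b2 := 2 * ((4 * K + 13) * L * (K + 1)) / al.
pose be := b1 + b2 + 1.
have b10 : 0 <= b1 by rewrite divr_ge0 ?sqr_ge0// ltW.
have b20 : 0 <= b2.
  by rewrite divr_ge0 ?(ltW al0)// !mulr_ge0 ?(ltW L0)//; have := K0; lra.
have be0 : 0 < be by rewrite /be; lra.
have be1 : K ^+ 2 / (4 * be) <= rho / 4.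
  rewrite ler_pdivrMr ?mulr_gt0//.
  have -> : rho / 4 * (4 * be) = rho * be by field.
  have h : K ^+ 2 = rho * b1 by rewrite /b1 mulrC divfK// gt_eqF.
  by rewrite h ler_pM2l// /be; lra.
have be2 : (4 * K + 13) * L * ((K + 1) / be) <= al / 2.
  rewrite mulrA ler_pdivrMr//.
  have h : (4 * K + 13) * L * (K + 1) = al / 2 * b2.
    by rewrite /b2; field; rewrite gt_eqF.
  by rewrite h ler_pM2l ?divr_gt0// /be; lra.
pose D := 8 + 16 * CF + 104 * be * CF + 3 * ((4 * K + 13) * L).
have D0 : 0 <= D.
  have h1 : 0 <= be * CF by rewrite mulr_ge0 ?ltW.
  have h2 : 0 <= (4 * K + 13) * L.
    by rewrite mulr_ge0 ?(ltW L0)//; have := K0; lra.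
  have := CF0; rewrite /D; lra.
have [lam [lam0 lam1 lamb lamD lamr]] := small_parameter D0 rho0 al0 be0.
have l3 : lam ^+ 3 <= lam.
  by rewrite -[leRHS]expr1 ler_wiXn2l// ltW.
pose eps := lam ^+ 3 / 2.
have eps0 : 0 < eps by rewrite divr_gt0// exprn_gt0.
have epsl : eps <= lam / 2 by rewrite /eps ler_pM2r.
have [g0 [d0 [st0 nmax]]] := Psi_near_max hS T0 regW1 regW2 al0 kap0 be0 eps0.
have [hg0 hd0 dg0] := st0.
have [cg0 /andP[tg0 g0T]] := hg0; have [cd0 _] := hd0.
have Psi0 : rho - eps <= Psi S T W1 W2 al kappa be g0 d0.
  have := nmax g g (And3 hg hg erefl); have := pen_g be; lra.
pose m := pdist S T g0 d0.
have m0 : 0 <= m by exact: pdist_ge0.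
have mb : be * m <= K + 1.
  have h := Psi_near_max_close hS T0 regW1 regW2 be0 st0 nmax; rewrite -/m in h.
  rewrite leNgt; apply/negP => h1.
  have h2 : m <= eps by nra.
  have h3 : be * m <= be * lam by rewrite ler_pM2l//; lra.
  have := K0; lra.
pose xi := midpoint g0 d0.
have cxi : continuous_path xi by exact: cpath_midpoint.
pose v := 2^-1 *: (g0 (ptime g0) - d0 (ptime g0)).
have [r r0 hr] := semigroup_near0 hS v lam0.
pose tau := Num.min lam (Num.min r (rho / (4 * C))).
have tau0 : 0 < tau by rewrite !lt_min lam0 r0 divr_gt0// mulr_gt0.
have tau3 : [/\ tau <= lam, tau <= r & C * tau <= rho / 4].
  have : tau <= tau by []. 
  rewrite {2}/tau !le_min => /and3P[h1 h2 h3]; split=> //.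
  have -> : rho / 4 = C * (rho / (4 * C)) by field; rewrite gt_eqF.
  by rewrite ler_pM2l.
have [taul taur tauC] := tau3.
(* the first bound forces the final times within tau of each other, the second
   one keeps the doubled functional below its value at (g0, d0) plus lam^3 *)
pose th := Num.min (tau ^+ 2 / (1 + C * T)) (2 * lam ^+ 3 / C ^+ 2).
have CT0 : 0 < C * T by rewrite mulr_gt0.
have th0 : 0 < th.
  by rewrite lt_min !divr_gt0 ?exprn_gt0 ?mulr_gt0 ?exprn_gt0//; lra.
have th1 : th * (1 + C * T) <= tau ^+ 2.
  by rewrite -ler_pdivlMr; [rewrite /th ge_min lexx | lra].
have th2 : C ^+ 2 * th <= 2 * lam ^+ 3.
  by rewrite mulrC -ler_pdivlMr ?exprn_gt0// /th ge_min lexx orbT.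
pose Th := Theta S T W1 W2 al kappa be xi th.
have Th0 : Th g0 d0 = Psi S T W1 W2 al kappa be g0 d0.
  rewrite /Th /Theta /Psi; have [-> ->] := Upsilon2_midpoint ipH hS T0 hg0 cd0 dg0.
  by rewrite dg0 subrr expr0n /= mul0r; field.
have past0 z : past T (ptime xi) z -> past T 0 z by apply: past_le.
(* the penalty bounds the pairs that are at least as good as (g0, d0), which
   makes the time regularity of W1 and W2 uniform on them *)
have ctrl z1 z2 : past T (ptime xi) z1 -> past T (ptime xi) z2 ->
    Th g0 d0 <= Th z1 z2 ->
    [/\ norm0 z1 <= Rb, norm0 z2 <= Rb &
    exists z1' z2', [/\ same_time T z1' z2',
      ptime z1' = Num.max (ptime z1) (ptime z2) &
      Th z1 z2 + (ptime z1 - ptime z2) ^+ 2 / th <=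
      Psi S T W1 W2 al kappa be z1' z2' + C * `|ptime z1 - ptime z2|]].
  move=> hz1 hz2 hz.
  have := Theta_le hS W1 W2 al kappa be0 th0 cxi hz1 hz2; rewrite -/(Th z1 z2) => h1.
  have [n1 n2] : norm0 z1 <= Rb /\ norm0 z2 <= Rb.
    apply: (penalized_radius K0 regW1 regW2 al0 kap0 (past0 _ hz1) (past0 _ hz2)).
    rewrite Th0 in hz; lra.
  split=> //; exists (flow S z1 (Num.max (ptime z1) (ptime z2))).
  exists (flow S z2 (Num.max (ptime z1) (ptime z2))).
  have [h2 h3] := Theta_le_Psi hS T0 K0 regW1 regW2 al0 kap0 be0 th0 cxi
    hz1 hz2 n1 n2 erefl.
  by split.
have Xg0 : past T (ptime xi) g0 by split=> //=; rewrite lexx.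
have Xd0 : past T (ptime xi) d0 by split=> //=; rewrite dg0 lexx.
have hsup z1 z2 : past T (ptime xi) z1 -> past T (ptime xi) z2 ->
    Th z1 z2 <= Th g0 d0 + lam * lam ^+ 2.
  move=> hz1 hz2; have l30 : 0 < lam * lam ^+ 2 by rewrite mulr_gt0// exprn_gt0.
  have [hz|/ltW hz] := leP (Th z1 z2) (Th g0 d0); first by lra.
  have [_ _ [z1' [z2' [hst _ h]]]] := ctrl z1 z2 hz1 hz2 hz.
  have := nmax z1' z2' hst; rewrite -Th0.
  set t := `|ptime z1 - ptime z2| in h.
  have tE : (ptime z1 - ptime z2) ^+ 2 = t ^+ 2 by rewrite /t real_normK// num_real.
  have q1 : 0 <= (t - C * th / 2) ^+ 2 / th by rewrite divr_ge0 ?sqr_ge0// ltW.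
  have q2 : (t - C * th / 2) ^+ 2 / th = t ^+ 2 / th - C * t + C ^+ 2 * th / 4.
    by field; rewrite gt_eqF.
  have q3 : lam * lam ^+ 2 = lam ^+ 3 by rewrite -exprS.
  rewrite tE in h; rewrite q3 /eps; lra.
have [cW1 _ _] := subW1; have [cW2 _ _] := superW2.
have [ug [ud [g1 [d1 [[ug0 ud0] [Xg1 Xd1] hug hud [hTh hmax]]]]]] :=
  doubled_maximum hS T0 cW1 cW2 th0 cxi Xg0 Xd0 lam0 (exprn_gt0 2 lam0) hsup.
have [n1 n2 [z1' [z2' [hst hT h]]]] := ctrl g1 d1 Xg1 Xd1 hTh.
have [_ /andP[_ g1T]] := Xg1; have [_ /andP[_ d1T]] := Xd1.
set t := `|ptime g1 - ptime d1| in h.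
have t0 : 0 <= t by exact: normr_ge0.
have tT : t <= T.
  have [[z1 _ _] _] := Xg1; have [[z2 _ _] _] := Xd1.
  by rewrite /t ler_norml; lra.
have tE : (ptime g1 - ptime d1) ^+ 2 = t ^+ 2 by rewrite /t real_normK// num_real.
rewrite tE in h.
have ttau : t <= tau.
  apply: le_of_sqr; first exact: ltW.
  have h1 := nmax z1' z2' hst; rewrite -Th0 in h1.
  have h2 : t ^+ 2 / th <= eps + C * t.
    move: hTh h h1; rewrite -/(Th g0 d0) -/(Th g1 d1); lra.
  have h3 : C * t <= C * T by rewrite ler_pM2l.
  apply: le_trans th1; rewrite mulrC -ler_pdivrMr//; lra.
have interior : Num.max (ptime g1) (ptime d1) < T.
  rewrite lt_neqAle ge_max g1T d1T /= andbT; apply/eqP => hmT.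
  have [hz1' _ _] := hst; rewrite hmT in hT.
  have h1 := Psi_terminal hS regW2 al0 kap0 be0 hst (terminal_order hz1' hT).
  have h2 : 0 <= t ^+ 2 / th by rewrite divr_ge0 ?sqr_ge0// ltW.
  have h3 : C * t <= C * tau by rewrite ler_pM2l.
  move: hTh h; rewrite -/(Th g0 d0) -/(Th g1 d1) Th0; lra.
move: interior; rewrite gt_max => /andP[g1lt d1lt].
have := interior_maximum ipH hS T0 hA U0 L0 F_bound q_bound F_lip q_lip
  subW1 superW2 al0 be0 lam0 st0 ug0 ud0 Xg1 Xd1 g1lt d1lt n1 n2 hug hud hmax hr
  (le_trans ttau taur) (le_trans ttau taul).
rewrite -/m -/Rb -/CF.
have := errors_small CF0 be0 (ltW lam0) m0 lam1 lamb mb lamD be2.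
have := al0; lra.
Qed.

End ComparisonPrinciple.

Theorem theorem4p1 (R : realType) (H : completeNormedModType R)
    (ip : {dot H for (@idfun R)}) (T : R)
    (DA : set H) (A : H -> H) (S : R -> {linear H -> H})
    (U : metricType R)
    (F : Hpath H -> U -> H) (q : Hpath H -> U -> R)
    (phi : Hpath H -> R)
    (W1 W2 : Hpath H -> R) :
  hilbert_product ip -> separable H -> 0 < T ->
  contraction_semigroup S -> generates DA A S ->
  [set: U] !=set0 ->
  hypothesis_b T F q ->
  hypothesis_c T S F q phi ->
  viscosity_subsolution ip T DA A S F q phi W1 ->
  viscosity_supersolution ip T DA A S F q phi W2 ->
  (exists2 K : R, 0 < K &
    forall (t s : R) (g d : Hpath H), 0 <= t -> t <= s -> s <= T ->
      Lambda_at t g -> Lambda_at t d ->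
      Num.max `|W1 g| `|W2 g| <= K * (1 + norm0 g) /\
      Num.max `|W1 (flow S g s) - W1 d| `|W2 (flow S g s) - W2 d|
        <= K * (1 + norm0 g + norm0 d) * `|s - t| + K * norm0 (psub g d)) ->
  forall g, Lambda T g -> W1 g <= W2 g.
Proof.
move=> ipH _ T0 hS hA U0 _ [L L0 [hF hlip hq _ _]] sub super [K K0 hK] g.
have LP (d : Hpath H) : past T 0 d -> Lambda T d by move/Lambda_fromP.
have F_bound d u : past T 0 d -> `|F d u| <= L * (1 + norm0 d).
  move=> hd; have [cd _] := hd; have m0 := norm0_ge0 cd.
  have h := hF d u (LP d hd).
  apply: le_of_sqr; first by rewrite mulr_ge0 ?(ltW L0)// addr_ge0.
  apply: (le_trans h); rewrite exprMn ler_pM2l ?exprn_gt0//; nra.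
have reg W : (W = W1 \/ W = W2) -> regular_functional S T K W.
  move=> hW.
  have sel (a b c : R) : Num.max a b <= c -> a <= c /\ b <= c.
    by rewrite ge_max => /andP[].
  have bnd t s d k : 0 <= t -> t <= s -> s <= T -> Lambda_at t d -> Lambda_at t k ->
      `|W d| <= K * (1 + norm0 d) /\ `|W (flow S d s) - W k| <=
        K * (1 + norm0 d + norm0 k) * `|s - t| + K * norm0 (psub d k).
    move=> t0 ts sT hd hk; have [/sel[a1 a2] /sel[b1 b2]] := hK t s d k t0 ts sT hd hk.
    by case: hW => ->.
  have at_ (d : Hpath H) : past T 0 d -> Lambda_at (ptime d) d by move=> [hd _].
  split=> [d hd|d k hd hk kd|d s hd /andP[ds sT]].
  - have [_ /andP[d0 dT]] := hd.
    by have [] := bnd _ _ d d d0 (lexx _) dT (at_ d hd) (at_ d hd).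
  - have [cd /andP[d0 dT]] := hd; have [ck _] := hk.
    have [_] := bnd _ _ d k d0 (lexx _) dT (at_ d hd) (conj kd ck).
    rewrite subrr normr0 mulr0 add0r (flow_id hS cd).
    have -> : psub d k = pgap S d k by rewrite /pgap -kd (flow_id hS ck).
    by rewrite (norm0_pgap hS cd ck _ dT)// kd.
  - have [cd /andP[d0 dT]] := hd.
    have [_] := bnd _ _ d d d0 ds sT (at_ d hd) (at_ d hd).
    have -> : norm0 (psub d d) = 0.
      have -> : psub d d = pgap S d d by rewrite /pgap (flow_id hS cd).
      by rewrite (norm0_pgap hS cd cd (lexx _) dT) pdistxx.
    rewrite mulr0 addr0 (ger0_norm (_ : 0 <= s - ptime d)) ?subr_ge0//.
    by have -> : 1 + norm0 d + norm0 d = 1 + 2 * norm0 d by ring.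
move=> hg; apply: (@comparison R H S T ip DA A U F q phi ipH hS T0 hA U0 L L0
  _ _ _ _ K W1 W2 K0) => //.
- by move=> d u hd; apply: hq; apply/Lambda_fromP.
- by move=> d k u hd hk; have [] := hlip d k u (LP d hd) (LP k hk).
- by move=> d k u hd hk; have [] := hlip d k u (LP d hd) (LP k hk).
- by apply: reg; left.
- by apply: reg; right.
- exact/Lambda_fromP.
Qed.
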